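(* Let $(W,S)$ be an odd-angled Coxeter system. Then $W$ contains a proper finite index reflection subgroup if and only if the divisibility diagram $\mathrm{Cox}_{\mathrm{div}}(W)$ contains at least one connected component $C$ of one of the following three types: 1. the order (number of vertices) of $C$ is $1$ or $2$; 2. $C$ contains at most one multiple edge; 3. $C$ contains a (full) subdiagram $D$ of order $3$ whose three edges have labels $5,5,3$, and every non-absent edge of $C$ except the edges of $D$ is simple.
   Context: A Coxeter system $(W,S)$ consists of a nonempty finite set $S=\{s_1,\dots,s_r\}$ and the group $W=\langle S\mid (s_is_j)^{m_{ij}}=1\ \forall i,j\rangle$, where $m_{ii}=1$ and $m_{ij}=m_{ji}\in\{2,3,4,\dots\}\cup\{\infty\}$ for $i\ne j$ ($m_{ij}=\infty$ means no relation is imposed on $s_is_j$). It is odd-angled if every $m_{ij}$ with $i\neq j$ is odd or infinite. A reflection of $W$ is an element conjugate in $W$ to an element of $S$. A reflection subgroup is a proper subgroup (index greater than $1$) generated by reflections; the trivial subgroup counts as generated by the empty set of reflections. The divisibility diagram $\mathrm{Cox}_{\mathrm{div}}(W)$ is the labeled graph with vertices corresponding to the elements of $S$; the vertices of $s_i\ne s_j$ are joined by an edge labeled by the smallest divisor $k>1$ of $m_{ij}$ if $m_{ij}<\infty$, and are not joined if $m_{ij}=\infty$. An edge with label $3$ is called simple, an edge with any other label is called multiple; two vertices which are not joined are said to be joined by an absent edge. A subdiagram always means a full (induced) subdiagram. *)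

(* Defs.v *)
From HB Require Import structures.
From mathcomp Require Import all_boot.
From mathcomp Require Import boolp classical_sets cardinality.

Set Implicit Arguments.
Unset Strict Implicit.
Unset Printing Implicit Defensive.

Local Open Scope classical_set_scope.
Local Open Scope card_scope.
Local Open Scope group_scope.
Local Open Scope quotient_scope.

Section Presentation.
Variable I : choiceType.

(* The letter (i, false) stands for the generator i, (i, true) for its
   inverse. *)
Definition word := seq (I * bool).

Implicit Types (u v w : word) (R : set word).

Definition letter_inv (x : I * bool) : I * bool := (x.1, ~~ x.2).

Definition word_inv w : word := rev (map letter_inv w).

Definition word_pow w n : word := flatten (nseq n w).

Inductive word_equiv R : word -> word -> Prop :=
| WordRefl u : word_equiv R u u
| WordSym u v : word_equiv R u v -> word_equiv R v u
| WordTrans u v w : word_equiv R u v -> word_equiv R v w -> word_equiv R u w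
| WordCancel u v x : word_equiv R (u ++ [:: x; letter_inv x] ++ v) (u ++ v)
| WordRel u v r : R r -> word_equiv R (u ++ r ++ v) (u ++ v).

Definition word_eqb R u v : bool := `[< word_equiv R u v >].

Lemma word_eqb_refl R : reflexive (word_eqb R).
Proof. by move=> u; apply/asboolP; constructor. Qed.

Lemma word_eqb_sym R : symmetric (word_eqb R).
Proof. by move=> u v; apply/asboolP/asboolP; apply: WordSym. Qed.

Lemma word_eqb_trans R : transitive (word_eqb R).
Proof.
by move=> v u w /asboolP uv /asboolP vw; apply/asboolP; apply: WordTrans uv vw.
Qed.

Canonical word_eqb_equiv R :=
  EquivRel (word_eqb R) (@word_eqb_refl R) (@word_eqb_sym R) (@word_eqb_trans R).

Section PresentedGroup.
Variable R : set word.

(* The group with generating set I and relators R. *)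
Definition presented_group := {eq_quot word_eqb R}.

HB.instance Definition _ : EqQuotient _ (word_eqb R) presented_group :=
  EqQuotient.on presented_group.
HB.instance Definition _ := Choice.on presented_group.

End PresentedGroup.

Lemma word_equivP R u v :
  \pi_(presented_group R) u = \pi_(presented_group R) v <-> word_equiv R u v.
Proof.
by split=> [/eqmodP/asboolP//|uv]; apply/eqmodP/asboolP.
Qed.

Lemma word_equiv_ctx R a b u v :
  word_equiv R u v -> word_equiv R (a ++ u ++ b) (a ++ v ++ b).
Proof.
elim=> {u v} [u|u v _ IH|u v w _ IHu _ IHv|u v x|u v r Rr].
- exact: WordRefl.
- exact: WordSym.
- exact: WordTrans IHu IHv.
- have := WordCancel R (a ++ u) (v ++ b) x.
  by rewrite -!catA /=.
- have := WordRel (a ++ u) (v ++ b) Rr.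
  by rewrite -!catA.
Qed.

Lemma word_equiv_cat R u u' v v' :
  word_equiv R u u' -> word_equiv R v v' -> word_equiv R (u ++ v) (u' ++ v').
Proof.
move=> uu' vv'; apply: (@WordTrans R _ (u' ++ v)).
  exact: (word_equiv_ctx [::] v uu').
by have := word_equiv_ctx u' [::] vv'; rewrite !cats0.
Qed.

Lemma letter_invK : involutive letter_inv.
Proof. by case=> i b; rewrite /letter_inv negbK. Qed.

Lemma word_invK : involutive word_inv.
Proof.
by move=> w; rewrite /word_inv map_rev revK -map_comp (eq_map letter_invK) map_id.
Qed.

Lemma word_mulV R w : word_equiv R (w ++ word_inv w) [::].
Proof.
elim: w => [|x w IH]; first exact: WordRefl.
rewrite /word_inv /= rev_cons -cats1 -/(word_inv w).
have := word_equiv_ctx [:: x] [:: letter_inv x] IH; rewrite -catA /= => H.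
by apply: WordTrans H _; apply: (WordCancel R [::] [::]).
Qed.

Lemma word_mulVl R w : word_equiv R (word_inv w ++ w) [::].
Proof. by have := word_mulV R (word_inv w); rewrite word_invK. Qed.

Lemma word_equiv_inv R u v :
  word_equiv R u v -> word_equiv R (word_inv u) (word_inv v).
Proof.
move=> uv; apply: (@WordTrans R _ (word_inv u ++ v ++ word_inv v)).
  have := word_equiv_cat (WordRefl R (word_inv u)) (WordSym (word_mulV R v)).
  by rewrite cats0.
apply: (@WordTrans R _ (word_inv u ++ u ++ word_inv v)).
  exact: word_equiv_ctx (WordSym uv).
by rewrite catA; apply: (word_equiv_cat (word_mulVl R u) (WordRefl R _)).
Qed.

Section Group.
Variable R : set word.
Notation G := (presented_group R).

Definition pg_one : G := \pi_G [::].
Definition pg_mul (x y : G) : G := \pi_G (repr x ++ repr y).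
Definition pg_inv (x : G) : G := \pi_G (word_inv (repr x)).

Lemma word_equiv_repr u : word_equiv R (repr (\pi_G u)) u.
Proof. by apply/word_equivP; rewrite reprK. Qed.

Lemma pg_mulE u v : pg_mul (\pi_G u) (\pi_G v) = \pi_G (u ++ v).
Proof. by apply/word_equivP; apply: word_equiv_cat; apply: word_equiv_repr. Qed.

Lemma pg_invE u : pg_inv (\pi_G u) = \pi_G (word_inv u).
Proof. by apply/word_equivP; apply: word_equiv_inv; apply: word_equiv_repr. Qed.

Lemma pg_mulA : associative pg_mul.
Proof.
elim/quotW=> u; elim/quotW=> v; elim/quotW=> w.
by rewrite (pg_mulE v) (pg_mulE u v) !pg_mulE catA.
Qed.

Lemma pg_mul1 : left_id pg_one pg_mul.
Proof. by elim/quotW=> u; rewrite pg_mulE. Qed.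

Lemma pg_mulr1 : right_id pg_one pg_mul.
Proof. by elim/quotW=> u; rewrite pg_mulE cats0. Qed.

Lemma pg_mulV : left_inverse pg_one pg_inv pg_mul.
Proof.
elim/quotW=> u; rewrite pg_invE pg_mulE.
by apply/word_equivP; apply: word_mulVl.
Qed.

Lemma pg_mulVr : right_inverse pg_one pg_inv pg_mul.
Proof.
elim/quotW=> u; rewrite pg_invE pg_mulE.
by apply/word_equivP; apply: word_mulV.
Qed.

HB.instance Definition _ :=
  isGroup.Build G pg_mulA pg_mul1 pg_mulr1 pg_mulV pg_mulVr.

Definition pg_gen (i : I) : G := \pi_G [:: (i, false)].

End Group.
End Presentation.

Section Subgroup.
Variable G : groupType.
Implicit Types H T : set G.

Definition is_subgroup H :=
  [/\ H 1, forall x y, H x -> H y -> H (x * y) & forall x, H x -> H x^-1].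

Definition generated_subgroup T : set G := smallest is_subgroup T.

Definition left_coset H (x : G) : set G := [set x * h | h in H].

Definition left_cosets H : set (set G) := range (left_coset H).

Definition has_index H (n : nat) := left_cosets H #= `I_n.

End Subgroup.

Section Coxeter.
Variable S : finType.

(* None stands for infinity. *)
Variable m : S -> S -> option nat.

Definition coxeter_matrix :=
  [/\ forall s, m s s = Some 1%N,
      forall s t, m s t = m t s
    & forall s t k, s != t -> m s t = Some k -> (2 <= k)%N].

Definition odd_angled := forall s t k, s != t -> m s t = Some k -> odd k.

Definition coxeter_relators : set (word S) :=
  [set r | exists s t k,
     m s t = Some k /\ r = word_pow [:: (s, false); (t, false)] k].

Definition coxeter_group : groupType := presented_group coxeter_relators.

Definition coxeter_gen (s : S) : coxeter_group := pg_gen coxeter_relators s.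

Definition reflection : set coxeter_group :=
  [set x | exists (w : coxeter_group) (s : S), x = coxeter_gen s ^ w].

Definition reflection_subgroup (H : set coxeter_group) :=
  H <> setT /\
  exists T : set coxeter_group, T `<=` reflection /\ H = generated_subgroup T.

Definition finite_index_reflection_subgroup (H : set coxeter_group) :=
  reflection_subgroup H /\ exists n, has_index H n.

(* The list of divisors is sorted, so the head of the filtered list is the
   smallest divisor greater than 1. *)
Definition least_divisor (n : nat) : nat :=
  head 1%N [seq k <- divisors n | (1 < k)%N].

(* Some k is an edge with label k, None an absent edge; there are no loops. *)
Definition cox_div (s t : S) : option nat :=
  if s == t then None else omap least_divisor (m s t).

Definition joined : rel S := [rel s t | cox_div s t != None].

Definition simple_edge : rel S := [rel s t | cox_div s t == Some 3].

Definition multiple_edge : rel S :=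
  [rel s t | joined s t && ~~ simple_edge s t].

Definition is_component (C : {set S}) :=
  exists s, C = [set t | connect joined s t]%SET.

(* Edges are unordered pairs. *)
Definition multiple_edges (C : {set S}) : {set {set S}} :=
  [set [set p.1; p.2]%SET
     | p in [set p : S * S | [&& p.1 \in C, p.2 \in C & multiple_edge p.1 p.2]]%SET
  ]%SET.

Definition component_type1 (C : {set S}) := #|C| = 1%N \/ #|C| = 2.

Definition component_type2 (C : {set S}) := (#|multiple_edges C| <= 1)%N.

Definition component_type3 (C : {set S}) :=
  exists D : {set S},
    [/\ D \subset C, #|D| = 3,
        exists a b c, [/\ D = [set a; b; c]%SET, cox_div a b = Some 5,
                          cox_div b c = Some 5 & cox_div a c = Some 3]
      & forall s t, s \in C -> t \in C -> joined s t ->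
          ~~ ((s \in D) && (t \in D)) -> simple_edge s t].

End Coxeter.

(* Main.v *)
Require Import Defs.
From mathcomp Require Import all_boot.
From mathcomp Require Import boolp classical_sets cardinality functions.
From mathcomp Require Import all_boot all_order all_algebra all_field.
From mathcomp Require Import zify ring.

(** A subgroup [H] of finite index gives a finite set [X = W/H] on which [S] acts
    by involutions; it is drawn as a graph with an edge of colour [s] between
    [x] and [s x] whenever they differ, so that a reflection conjugate to [s] lies
    in [H] exactly when it comes from a point of [X] fixed by [s].  That [H] is
    generated by reflections means that this graph, with its fixed points filled
    in, is simply connected: if [W] acts on a set [Z] over [X] in such a way that
    [s] fixes the points of [Z] lying over its fixed points in [X], then the
    stabiliser of a point of [X] fixes every point of [Z] above it ([stab_lift]).

    Oddness enters as follows.  When [m_st] is odd, the word [(st)^m_st] is a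
    palindrome around one letter, so it acts trivially at a fixed point of [s] or
    [t]: a family of involutions covering [X] as above satisfies the relation of
    [s] and [t] on each <s,t>-orbit that contains such a point, and only orbits
    without fixed points impose a condition ([cover_obeys]).  Call the orbits of
    the latter kind cycles; the others are paths, one end of which is fixed by
    [s] and the other by [t].

    _Necessity._  Two covers of [X] give all that is used.  The first shows that
    the graph has no double edges and that a closed walk becomes trivial in [W]
    once its stationary steps are dropped; by the theorem that a subset [B] of [S]
    generates a subgroup presented by the relations within [B], that word acts
    trivially already where just the relations of [B] hold ([closed_lift]).  The
    second, with fibre the field of two elements, then shows that every function
    on the edges with colours in [B] whose sum around each cycle vanishes is a
    coboundary.  Counting dimensions ([edge_rank]), if every colour has [e] edges,
    [[
      |B| e + #(common fixed points of B) + 1 <= |X| + sum of F_st over pairs in B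
    ]]
    where [F_st] is the number of <s,t>-cycles.  All colours of a component of the
    diagram have the same number of edges since [s] and [t] are conjugate when
    [m_st] is odd.  Moreover, if [P_st] is the number of <s,t>-paths with more than
    one vertex and [l] is the label of [st], such a path has at least [l] vertices
    and a cycle at least [2 l], so [(l - 1) P_st + 2 l F_st <= 2 e].  Finally
    [|X| <= #(common fixed points of B) + 2 e + sum of P over consecutive pairs],
    for each ordering of [B].  Combining these ([path_inequality]),
    [[
      |B| e + 1 <= 2 e + sum of P over consecutive pairs + sum of F over all pairs.
    ]]
    Simple edges satisfy [P + 3 F <= e] and multiple ones [2 P + 5 F <= e].  Two
    multiple edges with a common vertex contradict the inequality unless their
    labels are 5 and the third edge is simple ([triple_multiple]); two disjoint
    ones joined by a shortest path contradict the average of two orderings of that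
    path ([no_connecting_path]); the few diagrams with four vertices that remain
    are excluded by averaging, except for the complete diagram with two opposite
    multiple edges, which needs a finer count ([no_simple_quadrangle]).

    _Sufficiency._  Conversely a finite set [X] with involutions obeying the
    relations yields a reflection subgroup as soon as coset representatives
    [g x] can be chosen with [s (g x) = g (s x)] whenever [s] moves [x]
    ([tiling_subgroup]): think of [X] as the chambers of a convex union of
    chambers.  One starts with the set [D] of vertices of the multiple edges, for
    which [X] is the path of a dihedral group, or a cycle with petals for the
    labels 5, 5, 3, and hangs one additional chamber for each of the other
    generators on the chambers of one of two colours; since all the other edges
    are simple, the relations hold again ([attach_leaves]). *)

Set Implicit Arguments.
Unset Strict Implicit.
Unset Printing Implicit Defensive.

(** * Words and sets with an action of a Coxeter group *)
Section Action.
Local Open Scope group_scope.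
Local Open Scope quotient_scope.
Variables (S : finType) (m : S -> S -> option nat).
Hypothesis m_cox : coxeter_matrix m.
Notation W := (coxeter_group m).
Notation gen := (coxeter_gen m).

Lemma m_diag s : m s s = Some 1%N. Proof. by case: m_cox => + _ _; apply. Qed.
Lemma m_sym s t : m s t = m t s. Proof. by case: m_cox => _ + _; apply. Qed.

Definition word_val (w : word S) : W := \pi_(presented_group (coxeter_relators m)) w.

Lemma word_val_cat u v : word_val (u ++ v) = word_val u * word_val v.
Proof. by rewrite /word_val -pg_mulE. Qed.

Lemma word_val_inv u : word_val (word_inv u) = (word_val u)^-1.
Proof. by rewrite /word_val -pg_invE. Qed.

Lemma word_val0 : word_val [::] = 1. Proof. by []. Qed.

Lemma word_val_gen s : word_val [:: (s, false)] = gen s. Proof. by []. Qed.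

Lemma word_val_equiv u v : word_val u = word_val v <-> word_equiv (coxeter_relators m) u v.
Proof. exact: word_equivP. Qed.

Lemma genM s t k : m s t = Some k -> (gen s * gen t) ^+ k = 1.
Proof.
move=> mk.
have -> n : (gen s * gen t) ^+ n = word_val (word_pow [:: (s, false); (t, false)] n).
  elim: n => [|n IH]; first by rewrite expg0.
  by rewrite expgS IH -!word_val_gen -!word_val_cat.
apply/word_val_equiv.
have := @WordRel S (coxeter_relators m) [::] [::] (word_pow [:: (s, false); (t, false)] k).
by rewrite cats0 => /=; apply; exists s, t, k.
Qed.

Lemma gen2 s : gen s * gen s = 1.
Proof. by have := genM (m_diag s). Qed.

Lemma genV s : (gen s)^-1 = gen s.
Proof. by apply: (mulgI (gen s)); rewrite mulgV gen2. Qed.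

Lemma genK s g : gen s * (gen s * g) = g.
Proof. by rewrite mulgA gen2 mul1g. Qed.

Lemma word_val_cons l w : word_val (l :: w) = gen l.1 * word_val w.
Proof.
rewrite -cat1s word_val_cat; congr (_ * _); case: l => s [] //=.
by rewrite -(genV s) -word_val_gen -word_val_inv.
Qed.

Lemma word_val_ex (g : W) : exists w, g = word_val w.
Proof. by exists (repr g); rewrite /word_val reprK. Qed.

Lemma gen_ind (P : W -> Prop) :
  P 1 -> (forall s g, P g -> P (gen s * g)) -> forall g, P g.
Proof.
move=> P1 PS g; have [w ->] := word_val_ex g.
by elim: w => [|l w IH] //; rewrite word_val_cons; apply: PS.
Qed.

Definition word_act (Z : Type) (tau : S -> Z -> Z) (w : word S) (z : Z) : Z :=
  foldr (fun l => tau l.1) z w.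

Definition rotation (Z : Type) (tau : S -> Z -> Z) s t (z : Z) : Z := tau s (tau t z).

(** Only the relations between letters of [B] are required, so that a letter
    outside [B] may act by an arbitrary function. *)
Definition obeys (Z : Type) (B : {pred S}) (tau : S -> Z -> Z) : Prop :=
  forall s t k z, s \in B -> t \in B -> m s t = Some k -> iter k (rotation tau s t) z = z.

Section Obey.
Variables (Z : Type) (tau : S -> Z -> Z).

Lemma word_act_cat u v z : word_act tau (u ++ v) z = word_act tau u (word_act tau v z).
Proof. by rewrite /word_act foldr_cat. Qed.

Lemma obeys_inv (B : {pred S}) s z : obeys B tau -> s \in B -> tau s (tau s z) = z.
Proof. by move=> ob sB; have := ob s s 1%N z sB sB (m_diag s). Qed.

Hypothesis tau_ob : obeys predT tau.

Lemma step_invol s z : tau s (tau s z) = z.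
Proof. exact: obeys_inv tau_ob _. Qed.

Lemma word_act_pow s t k z :
  word_act tau (word_pow [:: (s, false); (t, false)] k) z = iter k (rotation tau s t) z.
Proof. by elim: k => //= k IH; rewrite /word_pow /= in IH *; rewrite IH. Qed.

Lemma word_act_equiv u v : word_equiv (coxeter_relators m) u v -> word_act tau u =1 word_act tau v.
Proof.
elim=> {u v} [u|u v _ IH|u v w _ IHu _ IHv|u v x|u v r Rr] z //.
- by rewrite IHu IHv.
- by rewrite !word_act_cat /= step_invol.
- rewrite !word_act_cat; congr word_act.
  by case: Rr => s [t [k [mk ->]]]; rewrite word_act_pow; apply: tau_ob.
Qed.

(** A family of maps obeying all the relations is an action of [W]: the value
    does not depend on the word that represents [g] ([word_act_equiv]). *)
Definition act (g : W) (z : Z) := word_act tau (repr g) z.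

Lemma act_word_val w z : act (word_val w) z = word_act tau w z.
Proof. by apply: word_act_equiv; apply: word_equiv_repr. Qed.

Lemma act1 z : act 1 z = z. Proof. exact: (act_word_val [::]). Qed.

Lemma actM g h z : act (g * h) z = act g (act h z).
Proof.
have [u ->] := word_val_ex g; have [v ->] := word_val_ex h.
by rewrite -word_val_cat !act_word_val word_act_cat.
Qed.

Lemma act_gen s z : act (gen s) z = tau s z.
Proof. exact: (act_word_val [:: (s, false)]). Qed.

Lemma actVK g z : act g^-1 (act g z) = z.
Proof. by rewrite -actM mulVg act1. Qed.

Lemma actKV g z : act g (act g^-1 z) = z.
Proof. by rewrite -actM mulgV act1. Qed.

End Obey.

Lemma gensub_subgroup (G : groupType) (T : set G) : is_subgroup (generated_subgroup T).
Proof.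
split.
- by move=> A [[A1 _ _] _].
- by move=> x y Hx Hy A HA; case: (HA) => [[_ AM _] _]; apply: AM; [apply: Hx|apply: Hy].
- by move=> x Hx A HA; case: (HA) => [[_ _ AV] _]; apply: AV; apply: Hx.
Qed.

Lemma gensub_sub (G : groupType) (T : set G) x : T x -> generated_subgroup T x.
Proof. by move=> Tx A [_]; apply. Qed.

Lemma gensub_min (G : groupType) (T A : set G) :
  is_subgroup A -> (forall x, T x -> A x) -> forall x, generated_subgroup T x -> A x.
Proof. by move=> sA TA x; apply; split. Qed.

End Action.

(** * The order of a product of two generators *)
Section Geometric.
Import GRing.Theory Num.Theory.
Variables (S : finType) (m : S -> S -> option nat).
Hypotheses (m_cox : coxeter_matrix m) (m_odd : odd_angled m).
Notation W := (coxeter_group m).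
Notation gen := (coxeter_gen m).
Local Open Scope ring_scope.

Lemma label_odd3 s t k : s != t -> m s t = Some k -> odd k /\ (2 < k)%N.
Proof.
move=> st mk; have ok := m_odd st mk; split=> //.
have : (1 < k)%N by case: m_cox => _ _ h; exact: h st mk.
by case: k ok {mk} => [|[|[|]]].
Qed.

Definition order_dvd (o : option nat) j := if o is Some k then (k %| j)%N else j == 0%N.

(** For an odd order [k] take a primitive [k]-th root of unity, whose square is
    again primitive; for an infinite order any nonzero number that is not a root
    of unity serves. *)
Lemma root_ex (o : option nat) :
  exists x : algC, (forall k, o = Some k -> odd k /\ (2 < k)%N) ->
  [/\ x != 0, x ^+ 2 != 1 & forall j, ((x ^+ 2) ^+ j == 1) = order_dvd o j].
Proof.
case: o => [k|].
  have [->|k_gt0] := posnP k; first by exists 1 => /(_ _ erefl)[].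
  have [x px] := C_prim_root_exists k_gt0.
  exists x => /(_ _ erefl)[ok k2].
  have E j : ((x ^+ 2) ^+ j == 1) = (k %| j)%N.
    by rewrite -exprM -(prim_order_dvd px) Gauss_dvdr // coprimen2.
  split=> //; last by rewrite -[x ^+ 2]expr1 E dvdn1; lia.
  apply: contra_eq_neq (prim_expr_order px) => ->.
  by rewrite expr0n; case: (k) k_gt0 => //= _ _; rewrite eq_sym oner_neq0.
exists 2%:R => _; split; first by rewrite pnatr_eq0.
  by rewrite -natrX -[1]/(1%:R) eqr_nat.
move=> j; rewrite -!natrX -[1]/(1%:R) eqr_nat /=.
by case: j => [|j] //=; rewrite expnS; lia.
Qed.

Definition xroot o : algC := sval (cid (root_ex o)).

(** Twice the opposite of the Gram matrix of the geometric representation, up to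
    the choice of the roots: with [x = xroot (m s t)], the product [st] will
    have the eigenvalues [x ^+ 2] and [x ^- 2], and it is odd angles that allow
    the square to be as good as [x]. *)
Definition form s t : algC :=
  if s == t then - 2%:R else xroot (m s t) + (xroot (m s t))^-1.

(** The reflections act on coordinates; functions on [S] are the dual of the
    space spanned by the simple roots, so that no vector space has to be
    named. *)
Definition georefl s (f : S -> algC) : S -> algC := fun u => f u + form u s * f s.

(** An eigenvector of [st], seen as a linear form on coordinates. *)
Lemma georefl_scale s t (x : algC) f : s != t -> x != 0 -> form s t = x + x^-1 ->
  let h := rotation georefl s t f in h s + x * h t = x ^+ 2 * (f s + x * f t).
Proof.
move=> st x0 c.
have c' : form t s = x + x^-1 by rewrite /form eq_sym (m_sym m_cox) -c.
have cs u : form u u = - 2%:R by rewrite /form eqxx.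
by rewrite /rotation /georefl !cs c c' /=; field.
Qed.

Lemma geo_scale_iter s t (x : algC) f j :
  s != t -> x != 0 -> form s t = x + x^-1 ->
  let h := iter j (rotation georefl s t) f in h s + x * h t = (x ^+ 2) ^+ j * (f s + x * f t).
Proof.
move=> st x0 c /=; elim: j => [|j IH]; first by rewrite expr0 mul1r.
by rewrite iterS (georefl_scale _ st x0 c) IH mulrA -exprS.
Qed.

(** Correcting the coordinate [u] by a combination of the coordinates [s] and
    [t] gives a linear form fixed by both generators; such [a] and [b] exist
    when [4 - (form s t)^2 != 0]. *)
Lemma geo_inv_iter s t (a b : algC) f u j : s != t ->
  form u s + 2%:R * a - b * form s t = 0 -> form u t + 2%:R * b - a * form s t = 0 ->
  let h := iter j (rotation georefl s t) f in h u - a * h s - b * h t = f u - a * f s - b * f t.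
Proof.
move=> st ha hb; elim: j => //= j <-; move: (iter j _ f) => h.
have c' : form t s = form s t by rewrite /form eq_sym (m_sym m_cox).
have cs v : form v v = - 2%:R by rewrite /form eqxx.
rewrite /rotation /georefl !cs c'.
have -> : form u s = b * form s t - 2%:R * a.
  by apply/eqP; rewrite -subr_eq0 -ha; apply/eqP; ring.
have -> : form u t = a * form s t - 2%:R * b.
  by apply/eqP; rewrite -subr_eq0 -hb; apply/eqP; ring.
by ring.
Qed.

Lemma xrootP s t : s != t ->
  [/\ xroot (m s t) != 0, xroot (m s t) ^+ 2 != 1 &
   forall j, ((xroot (m s t) ^+ 2) ^+ j == 1) = order_dvd (m s t) j].
Proof.
by move=> st; rewrite /xroot; case: cid => x /= hx; apply: hx => k mk; exact: label_odd3 st mk.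
Qed.

Lemma georefl_obeys : obeys m predT georefl.
Proof.
move=> s t k f _ _ mk.
have cs v : form v v = - 2%:R by rewrite /form eqxx.
have [est|st] := eqVneq s t.
  subst t; move: mk; rewrite (m_diag m_cox) => -[<-] /=.
  by apply/funext => u; rewrite /rotation /georefl cs; ring.
have [x0 x1 xk] := xrootP st.
move: (xk k); rewrite mk /= dvdnn => /eqP xk1.
have c : form s t = xroot (m s t) + (xroot (m s t))^-1 by rewrite /form (negPf st).
rewrite mk in x0 x1 c; move: (xroot (Some k)) x0 x1 xk1 c {xk} => x x0 x1 xk1 c.
set h := iter k _ f.
have E1 : h s + x * h t = f s + x * f t.
  by rewrite /h geo_scale_iter // xk1 mul1r.
have E2 : h s + x^-1 * h t = f s + x^-1 * f t.
  rewrite /h geo_scale_iter ?invr_eq0 //; last by rewrite invrK c addrC.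
  by rewrite exprVn exprVn xk1 invr1 mul1r.
have nz : x - x^-1 != 0.
  apply: contraNneq x1 => /eqP; rewrite subr_eq0 => /eqP e.
  by rewrite expr2 {2}e mulfV.
have Et : h t = f t.
  apply: (mulfI nz); transitivity ((h s + x * h t) - (h s + x^-1 * h t)); first by ring.
  by rewrite E1 E2; ring.
have Es : h s = f s by move: E1; rewrite Et => /addIr.
apply/funext => u.
have nz4 : 4%:R - form s t ^+ 2 != 0.
  rewrite c; have -> : 4%:R - (x + x^-1) ^+ 2 = - (x - x^-1) ^+ 2 by field.
  by rewrite oppr_eq0 sqrf_eq0.
pose a := - (form s t * form u t + 2%:R * form u s) / (4%:R - form s t ^+ 2).
pose b := - (form s t * form u s + 2%:R * form u t) / (4%:R - form s t ^+ 2).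
have H : h u - a * h s - b * h t = f u - a * f s - b * f t.
  by apply: geo_inv_iter => //; rewrite /a /b; field.
by move: H; rewrite Es Et => /addIr /addIr.
Qed.

(** The relations only bound the order of [st] from above; the eigenvalue
    [x ^+ 2] of its action on coordinates bounds it from below, and for an
    infinite label excludes every positive exponent. *)
Lemma gen_order s t j : s != t -> ((gen s * gen t) ^+ j)%g = 1%g -> order_dvd (m s t) j.
Proof.
move=> st gj; have [x0 x1 <-] := xrootP st.
have c : form s t = xroot (m s t) + (xroot (m s t))^-1 by rewrite /form (negPf st).
pose f u : algC := (u == s)%:R.
have E : iter j (rotation georefl s t) f = f.
  rewrite -[RHS](act1 m_cox georefl_obeys) -gj.
  elim: j {gj} => [|j IH]; first by rewrite expg0 (act1 m_cox georefl_obeys).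
  by rewrite expgS !(actM m_cox georefl_obeys) -IH !(act_gen m_cox georefl_obeys).
have := geo_scale_iter f j st x0 c; rewrite E /= /f eqxx eq_sym (negPf st).
by rewrite mulr0 addr0 mulr1 => <-.
Qed.

Lemma gen_neq s t : s != t -> gen s <> gen t.
Proof.
move=> st e; have := @gen_order s t 1 st; rewrite e expg1 (gen2 m_cox) => /(_ erefl).
case mk : (m s t) => [k|] //=; have [_] := label_odd3 st mk; rewrite dvdn1; lia.
Qed.

End Geometric.

(** * The inversion cocycle and the presentation of parabolic subgroups *)
Section Parabolic.
Variables (S : finType) (m : S -> S -> option nat).
Hypotheses (m_cox : coxeter_matrix m) (m_odd : odd_angled m).
Notation W := (coxeter_group m).
Notation gen := (coxeter_gen m).
Local Open Scope group_scope.
Implicit Types (g h r : W) (w a b c : word S).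

(** The second component changes when [r] is the wall crossed by the letter [s]:
    along a word, it records the parity of the number of crossings of the wall
    [r]. *)
Definition flip s (p : W * bool) : W * bool :=
  (gen s * p.1 * gen s, p.2 (+) (p.1 == gen s)).

Lemma gen_swap s t j : gen t * (gen s * gen t) ^+ j = ((gen s * gen t) ^+ j)^-1 * gen t.
Proof.
elim: j => [|j IH]; first by rewrite expg0 invg1 mul1g mulg1.
rewrite expgSr [LHS]mulgA IH -expgSr expgS invgM -!mulgA; congr (_ * _).
by rewrite invgM !genV // !mulgA.
Qed.

(** The walls crossed by [(st)^j] form the sequence [((st)^i)^-1 t], [i < 2 j],
    of period [m_st]; for [j = m_st] every wall is therefore met an even number
    of times, which is why [flip] obeys the relations. *)
Lemma flip_iter s t j r e :
  iter j (rotation flip s t) (r, e) =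
  (r ^ ((gen s * gen t) ^+ j)^-1,
   e (+) \big[addb/false]_(0 <= i < j.*2) (r == ((gen s * gen t) ^+ i)^-1 * gen t)).
Proof.
set q := gen s * gen t; elim: j => [|j IH]; first by rewrite expg0 invg1 conjg1 big_geq // addbF.
have tp : gen t * q ^+ j = (q ^+ j)^-1 * gen t by rewrite gen_swap.
have conjV x y : (x ^ (q ^+ j)^-1 == y) = (x == y ^ (q ^+ j)).
  exact: (can2_eq (conjgKV _) (conjgK _)).
rewrite iterS IH /rotation /flip /= doubleS !big_nat_recr //= !addbA; congr (_, _ (+) _ (+) _).
- by rewrite !conjgE !invgK expgS !invgM !genV // !mulgA.
- by rewrite conjV conjgE tp -addnn expgnDr invgM !mulgA.
- have -> : (gen t * r ^ (q ^+ j)^-1 * gen t == gen s) = (r ^ (q ^+ j)^-1 == gen t * (gen s * gen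
  t)).
    by rewrite -{1}[gen s in LHS](genK m_cox t) -(inj_eq (mulgI (gen t))) -(inj_eq (mulIg (gen t)))
      -!mulgA !genK // gen2 // !mulg1.
  rewrite conjV conjgE -!mulgA tp; have -> : (j.*2).+1 = (j + (1 + j))%N by lia.
  by rewrite !expgnDr expg1 !invgM !genV // !mulgA.
Qed.

Lemma flip_obeys : obeys m predT flip.
Proof.
move=> s t k [r e] _ _ mk.
have qk := genM mk; rewrite flip_iter qk invg1 conjg1; congr (_, _).
rewrite -addnn (big_cat_nat (n := k)) ?leq_addr //=.
rewrite -{2}[k]addn0 addnC big_addn addnK.
under [X in _ (+) (_ (+) X)]eq_bigr => i _ do rewrite expgnDr qk mulg1.
by rewrite addbb addbF.
Qed.

(** Whether the wall of the reflection [r] separates [1] from the chamber of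
    [g]: the parity of the crossings depends on [g] alone. *)
Definition inversion g r := (act flip g (r, false)).2.

Lemma act_flip g r e : act flip g (r, e) = (g * r * g^-1, e (+) inversion g r).
Proof.
rewrite /inversion; elim/(gen_ind m_cox): g e => [|s g IH] e.
  by rewrite !(act1 m_cox flip_obeys) invg1 mulg1 mul1g addbF.
have E e' : act flip (gen s * g) (r, e') = flip s (g * r * g^-1, e' (+) (act flip g (r, false)).2).
  by rewrite (actM m_cox flip_obeys) (act_gen m_cox flip_obeys) IH.
by rewrite !E /flip /= invgM genV // !mulgA addbA.
Qed.

Lemma inversion1 r : inversion 1 r = false.
Proof. by rewrite /inversion (act1 m_cox flip_obeys). Qed.

Lemma inversionS s g r : inversion (gen s * g) r = inversion g r (+) (g * r * g^-1 == gen s).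
Proof.
by rewrite {1}/inversion (actM m_cox flip_obeys) act_flip (act_gen m_cox flip_obeys).
Qed.

(** If a word crosses the wall [r] an odd number of times, it crosses it at
    least once, at some letter [l]. *)
Lemma exchange w r : inversion (word_val m w) r ->
  exists a l c, w = a ++ l :: c /\ r = gen l.1 ^ word_val m c.
Proof.
elim: w => [|l w IH]; first by rewrite inversion1.
rewrite word_val_cons // inversionS; case E : (inversion _ _) => /= H.
  have [a [l' [c [-> ->]]]] := IH E.
  by exists (l :: a), l', c.
exists [::], l, w; split=> //; move/eqP: H => <-.
by rewrite conjgE !mulgA mulVg mul1g -mulgA mulVg mulg1.
Qed.

Lemma deletion w r : inversion (word_val m w) r ->
  exists2 w', word_val m w' = word_val m w * r & (size w' < size w)%N /\ {subset w' <= w}.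
Proof.
move=> /exchange[a [l [c [-> ->]]]]; exists (a ++ c).
  rewrite !word_val_cat word_val_cons // conjgE -!mulgA; congr (_ * _).
  by rewrite mulVKg genK.
split; first by rewrite !size_cat /= addnS.
by move=> x; rewrite !mem_cat inE => /orP[->|->] //; rewrite !orbT.
Qed.

Lemma len_ex g : exists n, `[< exists2 w, word_val m w = g & size w = n >].
Proof. by have [w ->] := word_val_ex g; exists (size w); apply/asboolP; exists w. Qed.

Definition len g := ex_minn (len_ex g).

Lemma len_le w : (len (word_val m w) <= size w)%N.
Proof. by rewrite /len; case: ex_minnP => n _ h; apply: h; apply/asboolP; exists w. Qed.

Lemma len_word g : exists2 w, word_val m w = g & size w = len g.
Proof. by rewrite /len; case: ex_minnP => n /asboolP. Qed.

Lemma len_del g r : inversion g r -> (len (g * r) < len g)%N.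
Proof.
have [w <- <-] := len_word g => /deletion[w' <- [h _]].
exact: leq_ltn_trans (len_le w') h.
Qed.

Lemma conj_gen g s : g * gen s ^ g = gen s * g.
Proof. by rewrite -conjgC. Qed.

Lemma len_desc s g : inversion g (gen s ^ g) -> (len (gen s * g) < len g)%N.
Proof. by move/len_del; rewrite conj_gen. Qed.

(** Together with [len_desc] this says that multiplying by [s] changes the
    length according to the side of one wall; in particular the length always
    changes. *)
Lemma len_asc s g : ~~ inversion g (gen s ^ g) -> (len g < len (gen s * g))%N.
Proof.
move=> h; rewrite -{1}(genK m_cox s g); apply: len_desc.
have -> : gen s ^ (gen s * g) = gen s ^ g by rewrite conjgM (conjgE (gen s) (gen s)) gen2 // mulg1
  genV.
by rewrite inversionS (negPf h) conj_gen mulgK eqxx.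
Qed.

(** Reduced words, recognised letter by letter without mentioning the length. *)
Fixpoint increasing w :=
  if w is l :: c then ~~ inversion (word_val m c) (gen l.1 ^ word_val m c) && increasing c
  else true.

Lemma increasing_cons l c : increasing (l :: c) ->
  (len (word_val m c) < len (word_val m (l :: c)))%N.
Proof. by move=> /= /andP[h _]; rewrite word_val_cons //; apply: len_asc. Qed.

Section Sub.
Variable (B : {pred S}).
Definition word_over w := all (fun l => l.1 \in B) w.

(** A letter that does not lengthen the word can be cancelled by the deletion
    property, which uses only letters already present; so reduced words need no
    generator outside [B]. *)
Lemma increasing_ex w : word_over w -> exists c, [/\ word_over c,
  increasing c & word_val m c = word_val m w].
Proof.
suff: word_over w -> exists c, [/\ word_over c, increasing c,
  word_val m c = word_val m w & (size c <= size w)%N].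
  by move=> h /h [c []]; exists c.
have [n] := ubnP (size w); elim: n w => // n IH [|l w] /=; first by exists [::].
rewrite ltnS => wn /andP[lB wB].
have [c [cB ci cv cs]] := IH _ wn wB.
case E : (inversion (word_val m c) (gen l.1 ^ word_val m c)); last first.
  by exists (l :: c); rewrite /= E ci lB cB ltnS; split=> //; rewrite !word_val_cons // cv.
have [w' w'v [w's w'B]] := deletion E.
have w'B' : word_over w' by apply/allP => x /w'B xc; move/allP: cB; apply.
have [|c' [? ? c'v c's]] := IH w' _ w'B'; first by apply: leq_ltn_trans wn; apply: ltnW;
  apply: leq_trans w's cs.
exists c'; split=> //; first by rewrite c'v w'v conj_gen word_val_cons // cv.
by apply: leq_trans c's _; apply: ltnW; apply: leq_trans (leq_trans w's cs) (leqnSn _).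
Qed.
End Sub.

(** The word [.. s t s] of length [j], ending in [s]. *)
Fixpoint alternating s t j : word S :=
  if j is i.+1 then (if odd i then t else s, false) :: alternating s t i else [::].

Section Alternating.
Variables (Z : Type) (B : {pred S}) (tau : S -> Z -> Z) (s t : S).
Hypotheses (tau_ob : obeys m B tau) (sB : s \in B) (tB : t \in B).

Lemma word_act_alternating j z : word_act tau (alternating s t j) z =
  if odd j then tau s (iter j./2 (rotation tau t s) z) else iter j./2 (rotation tau t s) z.
Proof.
elim: j => //= j ->; rewrite uphalf_half; case: (odd j) => //=.
Qed.

Lemma rotation_swap j z : tau s (iter j (rotation tau t s) z) = iter j (rotation tau s t) (tau s z).
Proof. by elim: j => //= j <-. Qed.
End Alternating.

(** For odd [k], [(st)^k = 1] says that the alternating words of length [k] that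
    end in [s] and in [t] agree. *)
Lemma word_act_braid (Z : Type) (B : {pred S}) (tau : S -> Z -> Z) s t k z :
  obeys m B tau -> s \in B -> t \in B -> s != t -> m s t = Some k ->
  word_act tau (alternating s t k) z = word_act tau (alternating t s k) z.
Proof.
move=> ob sB tB st mk; have [ok _] := label_odd3 m_cox m_odd st mk.
rewrite !word_act_alternating ok; set h := k./2.
have ek : k = h + h.+1 by rewrite /h; lia.
have iK u v j y : u \in B -> v \in B -> iter j (rotation tau u v) (iter j (rotation tau v u) y) = y.
  move=> uB vB; elim: j y => //= j IH y; rewrite -iterS iterSr /rotation.
  by rewrite -!/(rotation _ _ _) !(obeys_inv m_cox _ ob) // IH.
have := ob _ _ _ z sB tB mk; rewrite ek iterD /= => E.
rewrite -{1}E (iK t s) // /rotation (obeys_inv m_cox _ ob) //.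
Qed.

Definition lmul s g := gen s * g.

Lemma iter_lmul s t j g : iter j (rotation lmul s t) g = (gen s * gen t) ^+ j * g.
Proof. by elim: j => [|j IH]; rewrite ?expg0 ?mul1g // iterS IH /rotation /lmul expgS !mulgA. Qed.

Lemma lmul_obeys : obeys m predT lmul.
Proof. by move=> s t k g _ _ mk; rewrite iter_lmul (genM mk) mul1g. Qed.

Lemma word_val_lmul w : word_val m w = word_act lmul w 1.
Proof. by elim: w => //= l w <-; rewrite word_val_cons. Qed.

Lemma word_val_alternating s t j : word_val m (alternating s t j) =
  (if odd j then gen s else 1) * (gen t * gen s) ^+ j./2.
Proof.
rewrite word_val_lmul word_act_alternating iter_lmul mulg1.
by case: ifP; rewrite ?mul1g.
Qed.

Definition below (o : option nat) j : bool := if o is Some k then (j <= k)%N else true.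

Definition next_letter s t j := if odd j then t else s : S.

(** The walls met by alternating words, one for each length;
    [alternating_refl_inj] says that they are distinct up to the length [m s t],
    because [st] has that exact order. *)
Lemma alternating_refl s t j :
  gen (next_letter s t j) ^ word_val m (alternating s t j) = gen s * (gen t * gen s) ^+ j.
Proof.
have E : j = j./2 + odd j + j./2 by rewrite -[LHS]odd_double_half -addnn; lia.
rewrite word_val_alternating /next_letter [in RHS]E !expgnDr; set q := _ ^+ j./2.
have sw := gen_swap t s j./2; rewrite -/q in sw.
rewrite conjgE; case: (odd j) => /=.
  by rewrite expg1 invgM genV // !mulgA -!sw -!mulgA; congr (_ * _); rewrite !mulgA.
by rewrite expg0 mulg1 !mul1g !mulgA sw.
Qed.

Lemma alternating_refl_inj s t i j : s != t -> (i < j)%N -> below (m s t) j.+1 ->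
  gen s * (gen t * gen s) ^+ i <> gen s * (gen t * gen s) ^+ j.
Proof.
move=> st ij jk /mulgI E; have ts : t != s by rewrite eq_sym.
have : order_dvd (m t s) (j - i).
  apply: gen_order => //; apply: (mulIg ((gen t * gen s) ^+ i)).
  by rewrite mul1g -expgnDr subnK ?(ltnW ij).
rewrite m_sym //; move: jk; rewrite /below; case: (m s t) => [k|] /=; last by lia.
move=> jk /dvdn_leq; lia.
Qed.

Definition dihedral_word s t : word S -> bool := word_over [pred x | (x == s) || (x == t)].

Lemma dihedral_wordC s t w : dihedral_word s t w = dihedral_word t s w.
Proof. by apply: eq_all => l; rewrite !inE orbC. Qed.

Lemma alternating_dihedral s t j : dihedral_word s t (alternating s t j).
Proof. by elim: j => //= j; rewrite /dihedral_word /= => ->; rewrite !inE; case: odd;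
  rewrite eqxx ?orbT. Qed.

Lemma dihedral_word_inv s t w : dihedral_word s t w -> dihedral_word s t (word_inv w).
Proof. by rewrite /dihedral_word /word_over /word_inv all_rev all_map; apply: sub_all => -[]. Qed.

(** In the dihedral group every element is alternating of length at most
    [m s t]: an attempt to exceed that length is undone by the braid relation,
    which yields a shorter word ending in the other letter. *)
Lemma dihedral_alternating s t w : s != t -> dihedral_word s t w ->
  exists j, [/\ word_val m w = word_val m (alternating s t j) \/ word_val m w = word_val m
    (alternating t s j) &
    below (m s t) j].
Proof.
move=> st; elim: w => [|l w IH] /=; first by exists 0%N; split; [left|rewrite /below;
  case: (m s t)].
rewrite /dihedral_word /= => /andP[ls /IH[j [+ jk]]].
wlog E : s t st ls jk {IH} / word_val m w = word_val m (alternating s t j).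
  move=> H [] h; first by apply: H => //; left.
  have := H t s; rewrite eq_sym m_sym //; case=> //; first by rewrite !inE orbC in ls *.
    by left.
  by move=> i [h1 h2]; exists i; split=> //; case: h1; [right|left].
move=> _; rewrite word_val_cons // E.
have [el|nl] := eqVneq l.1 (next_letter s t j).
  have [jltk|] := boolP (below (m s t) j.+1).
    by exists j.+1; split=> //; left; rewrite /= word_val_cons //= el.
  case mk : (m s t) jk => [k|] //= jk kj; have {jk kj}ek : j = k by lia.
  have [ok k2] := label_odd3 m_cox m_odd st mk.
  have B : word_val m (alternating s t k) = word_val m (alternating t s k).
    by rewrite !word_val_lmul (word_act_braid 1 lmul_obeys _ _ st mk).
  exists k.-1; split; last by lia.
  right; subst j; rewrite B el; case: k ok {E B k2 mk el} => //= k ok.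
  by rewrite word_val_cons //= /next_letter /= ok (negPf ok) /= genK.
case: j E jk nl => [|j] E jk nl.
  exists 1%N; split; last by case mk: (m s t) => [k|] //=;
    have [_] := label_odd3 m_cox m_odd st mk; lia.
  right; rewrite /= word_val_cons //=; move: ls nl; rewrite !inE /next_letter /=.
  by case/orP => /eqP -> //; rewrite eqxx.
exists j; split; last by case: (m s t) jk => //= k; lia.
left; rewrite /= word_val_cons //=; suff -> : l.1 = (if odd j then t else s) by rewrite genK.
by move: ls nl; rewrite !inE /next_letter /=; case: odd => /=; case/orP => /eqP ->; rewrite ?eqxx.
Qed.

(** Above the shortest element [g] of a coset of <s,t>, alternating words keep
    ascending: by minimality of [g] none of the walls of the dihedral group is
    crossed by [g], and the walls crossed afterwards are distinct. *)
Lemma inversion_alternating s t g j : s != t -> below (m s t) j.+1 ->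
  (forall w, dihedral_word s t w -> (len g <= len (word_val m w * g))%N) ->
  ~~ inversion (word_val m (alternating s t j) * g) (gen (next_letter s t j) ^ (word_val m
    (alternating s t j) * g)).
Proof.
move=> st jk gmin; rewrite conjgM alternating_refl.
suff H n : (n <= j)%N -> ~~ inversion (word_val m (alternating s t n) * g) ((gen s * (gen t * gen
  s) ^+ j) ^ g).
  exact: H.
elim: n => [|n IH] nj.
  rewrite word_val0 mul1g; apply/negP => /len_del; rewrite -conjgC -alternating_refl => lt.
  have := gmin (word_inv (alternating s t j) ++ (next_letter s t j, false) :: alternating s t j).
  rewrite word_val_cat word_val_inv word_val_cons // -conjgE leqNgt lt.
  have u2 := alternating_dihedral s t j; have := dihedral_word_inv u2;
    rewrite /dihedral_word /word_over all_cat /= => -> /=.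
  rewrite -/(word_over _ _) -/(dihedral_word s t _) u2 andbT !inE /next_letter.
  by case: odd; rewrite eqxx ?orbT => /(_ isT).
rewrite /= word_val_cons // -mulgA inversionS (negPf (IH (ltnW nj))) /=.
apply/eqP => E.
have : gen (next_letter s t n) ^ (word_val m (alternating s t n) * g) = (gen s * (gen t * gen s)
  ^+ j) ^ g.
  by rewrite /next_letter -E conjgE mulgVK mulKg.
by rewrite conjgM alternating_refl => /conjg_inj; apply: alternating_refl_inj nj jk.
Qed.

Section Uniq.
Variables (Z : Type) (B : {pred S}) (tau : S -> Z -> Z).
Hypothesis tau_ob : obeys m B tau.

Lemma dihedral_word_over s t w : s \in B -> t \in B -> dihedral_word s t w -> word_over B w.
Proof. by move=> sB tB; apply: sub_all => l /= /orP[] /eqP ->. Qed.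

Lemma increasing_alternating s t c j : s != t -> below (m s t) j -> increasing c ->
  (forall w, dihedral_word s t w -> (len (word_val m c) <= len (word_val m w * word_val m c))%N) ->
  increasing (alternating s t j ++ c).
Proof.
move=> st + ci cmin; elim: j => // j IH jk /=.
rewrite IH ?andbT; last by move: jk; rewrite /below; case: (m s t) => // k /ltnW.
by rewrite word_val_cat; apply: inversion_alternating.
Qed.

Lemma coset_min s t g : exists2 w0, dihedral_word s t w0 &
  forall w, dihedral_word s t w -> (len (word_val m w0 * g) <= len (word_val m w * (word_val m w0
    * g)))%N.
Proof.
have ex : exists n, `[< exists2 w, dihedral_word s t w & len (word_val m w * g) = n >].
  by exists (len (word_val m [::] * g)); apply/asboolP; exists [::].
case: (ex_minnP ex) => n /asboolP[w0 w0i <-] h; exists w0 => // w wi.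
rewrite mulgA -word_val_cat; apply: h; apply/asboolP; exists (w ++ w0) => //.
by rewrite /dihedral_word /word_over all_cat; apply/andP.
Qed.

(** Matsumoto's argument. If the first letters [s] and [t] differ, both shorten
    the element, so it is an alternating word of full length [m s t] above the
    shortest element of its <s,t>-coset; both words are compared, by induction,
    with one of the two such words, and these are related by a braid
    relation. *)
Lemma increasing_uniq a b z : word_over B a -> word_over B b -> increasing a -> increasing b ->
  word_val m a = word_val m b -> word_act tau a z = word_act tau b z.
Proof.
have len1 : len 1 = 0%N.
  by apply/eqP; rewrite -leqn0; have := len_le [::].
have [n] := ubnP (len (word_val m a)); elim: n a b => // n IH a b.
rewrite ltnS => an aB bB ai bi ab.
case: a b aB bB ai bi ab an => [|[s e] a] [|[t e'] b] //.
- by move=> _ _ _ /increasing_cons + e1; rewrite -e1 word_val0 len1.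
- by move=> _ _ /increasing_cons + _ e1; rewrite e1 word_val0 len1.
move=> /= /andP[sB aB] /andP[tB bB] /[dup] si /andP[_ ai] /[dup] ti /andP[_ bi] ab an.
have la := @increasing_cons (s, e) a si; have lb := @increasing_cons (t, e') b ti.
have lan : (len (word_val m a) < n)%N by apply: leq_trans la an.
have lbn : (len (word_val m b) < n)%N by apply: leq_trans lb _; rewrite -ab.
have Ea : gen s * word_val m ((s, e) :: a) = word_val m a by rewrite word_val_cons // genK.
have Eb : gen t * word_val m ((s, e) :: a) = word_val m b by rewrite ab word_val_cons // genK.
have [est|st] := eqVneq s t.
  by subst t; congr (tau s _); apply: IH => //; rewrite -Ea -Eb.
set g := word_val m ((s, e) :: a) in ab an la Ea Eb.
have dg u : u = s \/ u = t -> (len (gen u * g) < len g)%N.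
  by case=> ->; rewrite ?Ea ?Eb // ab.
(* [word_val c] below is the shortest element of the coset of [g]. *)
have [w0 w0i w0min] := coset_min s t g.
have [c [cB ci cv]] : exists c, [/\ word_over B c, increasing c & word_val m c = word_val m w0 * g].
  have : word_over B (w0 ++ (s, e) :: a).
    by rewrite /word_over all_cat -/(word_over _ _) (dihedral_word_over sB tB w0i) /= sB.
  by case/increasing_ex => c [cB ci]; rewrite word_val_cat -/g => cv; exists c.
rewrite -cv in w0min.
have gE : g = word_val m (word_inv w0) * word_val m c by rewrite word_val_inv cv mulKg.
have ts : t != s by rewrite eq_sym.
(* The alternating word from the shortest element to [g] must have full length,
   otherwise one of [s] and [t] would lengthen [g]. *)
have key u v j : (u = s /\ v = t) \/ (u = t /\ v = s) ->
    word_val m (word_inv w0) = word_val m (alternating u v j) -> below (m u v) j -> m s t = Some j.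
  move=> uv wj jk.
  have uv' : u != v by case: uv => -[-> ->].
  have muv : m u v = m s t by case: uv => -[-> ->] //; rewrite m_sym.
  have [jk1|] := boolP (below (m u v) j.+1).
    have := inversion_alternating (g := word_val m c) uv' jk1; rewrite -wj -gE => H.
    have {}H := H _; have /len_asc : ~~ inversion g (gen (next_letter u v j) ^ g).
      apply: H => w wi; apply: w0min.
      by case: uv wi => -[-> ->] //; rewrite dihedral_wordC.
    have /dg : next_letter u v j = s \/ next_letter u v j = t.
      by rewrite /next_letter; case: uv => -[-> ->]; case: odd; [right|left|left|right].
    by move=> /ltnW; rewrite leqNgt => /negP.
  rewrite -muv; move: jk; rewrite /below; case: (m u v) => [k|] //= jk kj.
  by congr Some; apply/eqP; rewrite eqn_leq jk andbT leqNgt.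
have [j mj] : exists j, m s t = Some j /\
    (word_val m (word_inv w0) = word_val m (alternating s t j) \/ word_val m (word_inv w0) =
      word_val m (alternating t s j)).
  have [j [h jk]] := dihedral_alternating st (dihedral_word_inv w0i); exists j; split=> //.
  case: h => h; first by apply: (key s t) => //; left.
  by apply: (key t s) => //; [right|rewrite m_sym].
case: mj => mj h.
have up_eq : word_val m (alternating s t j) = word_val m (alternating t s j).
  by rewrite !word_val_lmul (word_act_braid 1 lmul_obeys _ _ st mj).
have {}h : g = word_val m (alternating s t j) * word_val m c by rewrite gE; case: h => ->;
  rewrite ?up_eq.
have [oj _] := label_odd3 m_cox m_odd st mj.
have fin u v u' w : (u = s /\ v = t) \/ (u = t /\ v = s) -> increasing w -> word_over B w ->
   gen u * g = word_val m w -> (len (word_val m w) < n)%N ->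
   word_act tau ((u, u') :: w) z = word_act tau (alternating u v j ++ c) z.
  move=> uv wi wB gw wn.
  have uv' : u != v by case: uv => -[-> ->].
  have muv : m u v = m s t by case: uv => -[-> ->] //; rewrite m_sym.
  have uvB : u \in B /\ v \in B by case: uv => -[-> ->].
  have gu : g = word_val m (alternating u v j ++ c) by rewrite word_val_cat h;
    case: uv => -[-> ->] //; rewrite up_eq.
  have ui : increasing (alternating u v j ++ c).
    apply: increasing_alternating => //; first by rewrite muv mj /below.
    by move=> x xi; apply: w0min; case: uv xi => -[-> ->] //; rewrite dihedral_wordC.
  have uB : word_over B (alternating u v j ++ c).
    by rewrite /word_over all_cat -!/(word_over _ _) cB (@dihedral_word_over u v)
      ?alternating_dihedral //; case: uvB.
  case: j oj ui uB gu {mj h up_eq muv} => //= j oj ui uB gu.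
  rewrite (negPf oj) in ui uB gu *; congr (tau u _).
  case/andP: ui => _ ui; case/andP: uB => _ uB.
  by apply: IH => //; rewrite -gw gu word_val_cons //= genK.
transitivity (word_act tau (alternating s t j ++ c) z).
  by apply: (fin s t e a) => //; left.
transitivity (word_act tau (alternating t s j ++ c) z); last first.
  by apply: esym; apply: (fin t s e' b) => //; right.
by rewrite !word_act_cat; apply: word_act_braid tau_ob sB tB st mj.
Qed.

(** The subgroup generated by [B] has the presentation given by the relations
    within [B]: reading a word letter by letter, its action can be computed from
    any reduced word over [B] with the same value. *)
Theorem parabolic w z : word_over B w -> word_val m w = 1 -> word_act tau w z = z.
Proof.
move=> wB w1.
suff H v : word_over B v -> forall c, word_over B c -> increasing c ->
  word_val m c = word_val m v ->
    word_act tau v z = word_act tau c z by exact: (H w wB [::]).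
elim: v => [|l v IH] /= => [_ c cB ci cv|/andP[lB vB] c cB ci cv].
  by rewrite (@increasing_uniq c [::]).
have [b [bB bi bv]] := increasing_ex vB.
rewrite (IH vB b) //; rewrite word_val_cons // in cv.
case E : (inversion (word_val m b) (gen l.1 ^ word_val m b)); last first.
  rewrite (@increasing_uniq c (l :: b)) //= ?lB ?E //.
  by rewrite word_val_cons // cv bv.
have E' : ~~ inversion (word_val m c) (gen l.1 ^ word_val m c).
  rewrite cv -bv inversionS.
  have -> : gen l.1 ^ (gen l.1 * word_val m b) = gen l.1 ^ word_val m b.
    by rewrite conjgM (conjgE (gen l.1) (gen l.1)) gen2 // mulg1 genV.
  by rewrite conj_gen mulgK E eqxx.
rewrite (@increasing_uniq b (l :: c)) //= ?lB ?E' //; last by rewrite word_val_cons // cv bv genK.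
by rewrite (obeys_inv m_cox _ tau_ob).
Qed.

End Uniq.
End Parabolic.

(** * Coset graphs and their covers *)
Section CosetMap.
Local Open Scope group_scope.
Local Open Scope classical_set_scope.

Lemma left_coset_eq (G : groupType) (H : set G) g h : is_subgroup H ->
  left_coset H g = left_coset H h <-> H (g^-1 * h).
Proof.
move=> [H1 HM HV]; split=> [E|gh].
  have : left_coset H h h by exists 1 => //; rewrite mulg1.
  by rewrite -E => -[x Hx <-]; rewrite mulKg.
apply/seteqP; split=> _ [x Hx <-].
  exists (h^-1 * g * x); last by rewrite !mulgA mulgV mul1g.
  by apply: HM => //; have := HV _ gh; rewrite invgM invgK.
by exists (g^-1 * h * x); [apply: HM|rewrite !mulgA mulgV mul1g].
Qed.

(** Left cosets are numbered through a surjection [c] from the group, so that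
    the rest of the argument can speak of a finite type. *)
Lemma coset_number (G : groupType) (H : set G) n : is_subgroup H -> has_index H n ->
  exists c : G -> 'I_n, (forall x, exists g, c g = x) /\
    (forall g h, c g = c h <-> H (g^-1 * h)).
Proof.
move=> sH /card_set_bijP[f [f_fun f_inj f_surj]].
have lt g : (f (left_coset H g) < n)%N by apply: (f_fun); exists g.
exists (fun g => Ordinal (lt g)); split.
  move=> x; have [_ [g _ <-] fx] := f_surj x (ltn_ord x).
  by exists g; apply: val_inj.
move=> g h; rewrite -left_coset_eq //; split=> [/(congr1 val)/= E|E].
  by apply: f_inj E; apply: mem_set; [exists g|exists h].
by apply: val_inj; rewrite /= E.
Qed.

End CosetMap.

Section Covering.
Variables (S : finType) (m : S -> S -> option nat).
Hypotheses (m_cox : coxeter_matrix m) (m_odd : odd_angled m).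
Notation W := (coxeter_group m).
Notation gen := (coxeter_gen m).
Local Open Scope group_scope.

Lemma rotation_iterK (Z : Type) (tau : S -> Z -> Z) s t k z :
  involutive (tau s) -> involutive (tau t) ->
  iter k (rotation tau s t) (iter k (rotation tau t s) z) = z.
Proof.
move=> sK tK; elim: k z => // k IH z; rewrite iterSr iterS.
have -> y : rotation tau s t (rotation tau t s y) = y by rewrite /rotation tK sK.
exact: IH.
Qed.

Section General.
Variables (X : finType) (Z : Type) (sg : S -> X -> X) (tau : S -> Z -> Z) (p : Z -> X).
Variable (B : {pred S}).
Hypotheses (sg_ob : obeys m predT sg)
  (tauK : forall s, s \in B -> involutive (tau s))
  (p_eq : forall s z, s \in B -> p (tau s z) = sg s (p z))
  (fixl : forall s z, s \in B -> sg s (p z) = p z -> tau s z = z).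

Definition edge s t : rel X := fun x y => (y == sg s x) || (y == sg t x).

Lemma p_iter s t k z : s \in B -> t \in B ->
  p (iter k (rotation tau s t) z) = iter k (rotation sg s t) (p z).
Proof. by move=> sB tB; elim: k => //= k <-; rewrite /rotation !p_eq. Qed.

Lemma p_word_act w z : word_over B w -> p (word_act tau w z) = word_act sg w (p z).
Proof. by elim: w => //= l w IH /andP[lB wB]; rewrite p_eq // IH. Qed.

(** The relation between [s] and [t], restricted to the fibre over [x]. *)
Definition closes s t k x := forall z, p z = x -> iter k (rotation tau s t) z = z.

Lemma closesC s t k x : s \in B -> t \in B -> closes s t k x -> closes t s k x.
Proof.
by move=> sB tB g z /g e; rewrite -{1}e; apply: rotation_iterK; apply: tauK.
Qed.

Lemma closes_move s t k x : s \in B -> t \in B -> closes s t k x -> closes s t k (sg s x).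
Proof.
move=> sB tB /(closesC sB tB) g z pz; rewrite -[z in LHS](tauK sB) -rotation_swap g ?tauK //.
by rewrite p_eq // pz (step_invol m_cox sg_ob).
Qed.

(** For odd [k] the word [(st)^k] is a palindrome around the letter [t], once
    its first letter is set aside. *)
Lemma rotation_split (V : Type) (v : S -> V -> V) s t k q : odd k ->
  iter k (rotation v s t) q = v s (iter k./2 (rotation v t s) (v t (iter k./2 (rotation v s t) q))).
Proof.
move=> ok; have ek : k = (k./2 + k./2.+1)%N by lia.
have rE y : rotation v s t y = v s (v t y) by [].
by rewrite {1}ek iterD iterS rE -rotation_swap.
Qed.

(** The path starting at a fixed point of [s] ends, half a period later, at a
    fixed point of [t]; in particular [s] and [t] have equally many fixed
    points. *)
Lemma fix_half s t k x : s != t -> m s t = Some k -> sg s x = x ->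
  sg t (iter k./2 (rotation sg s t) x) = iter k./2 (rotation sg s t) x.
Proof.
move=> st mk sx; have [ok _] := label_odd3 m_cox m_odd st mk.
have := sg_ob x isT isT mk; rewrite rotation_split // -{2}sx => /(can_inj (step_invol m_cox sg_ob
  s)) E.
by rewrite -{2}E; apply: esym; apply: rotation_iterK; exact: step_invol sg_ob _.
Qed.

(** The middle letter of the palindrome acts on the fibre over a fixed point of
    [t], hence trivially, and the two halves then cancel. *)
Lemma closes_fix s t k x : s \in B -> t \in B -> s != t -> m s t = Some k ->
  sg s x = x -> closes s t k x.
Proof.
move=> sB tB st mk sx z pz.
have [ok _] := label_odd3 m_cox m_odd st mk.
have ty := fix_half st mk sx.
rewrite rotation_split // (@fixl t) ?p_iter // ?pz // rotation_iterK; try exact: tauK.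
by rewrite fixl ?pz.
Qed.

Lemma closes_connect s t k x y : s \in B -> t \in B ->
  connect (edge s t) x y -> closes s t k y -> closes s t k x.
Proof.
move=> sB tB /connectP[q + ->]; elim: q x => //= x1 q IH x /andP[xx1 /IH gq] /gq g1.
have sK := step_invol m_cox sg_ob.
case/orP: xx1 g1 => /eqP -> g1; first by rewrite -(sK s x); apply: closes_move.
by rewrite -(sK t x); apply: closesC => //; apply: closes_move => //; apply: closesC.
Qed.

(** It suffices to test one point of each orbit, since conjugating the relation
    by one of its letters moves it along the orbit; orbits with a fixed point
    pass the test. *)
Lemma cover_obeys :
  (forall s t k x, s \in B -> t \in B -> s != t -> m s t = Some k ->
    exists2 y, connect (edge s t) x y &
      [\/ sg s y = y, sg t y = y | closes s t k y]) ->
  obeys m B tau.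
Proof.
move=> H s t k z sB tB mk.
have [est|st] := eqVneq s t.
  by subst t; move: mk; rewrite (m_diag m_cox) => -[<-]; apply: tauK.
have [y cy gy] := H s t k (p z) sB tB st mk.
suff: closes s t k (p z) by apply.
apply: closes_connect cy _ => //; case: gy => // fy; first exact: closes_fix fy.
by apply: closesC => //; apply: closes_fix => //; rewrite 1?eq_sym // (m_sym m_cox).
Qed.

End General.

Section Quotient.
Variables (X : finType) (c : W -> X) (T : set W).
Hypotheses (c_surj : forall x, exists g, c g = x) (T_refl : (T `<=` @reflection S m)%classic)
  (c_eq : forall g h, c g = c h <-> generated_subgroup T (g^-1 * h)).

(** The action of [S] on the cosets; [sval (cid _)] picks a representative. *)
Definition coset_step s x : X := c (gen s * sval (cid (c_surj x))).

Lemma c_mul g h k : c h = c k -> c (g * h) = c (g * k).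
Proof. by move/c_eq => H; apply/c_eq; rewrite invgM -mulgA mulKg. Qed.

Lemma coset_step_c s g : coset_step s (c g) = c (gen s * g).
Proof. by apply: c_mul; case: cid. Qed.

Lemma coset_step_obeys : obeys m predT coset_step.
Proof.
move=> s t k x _ _ mk; have [g <-] := c_surj x.
have E j : iter j (rotation coset_step s t) (c g) = c ((gen s * gen t) ^+ j * g).
  elim: j => [|j IH]; first by rewrite expg0 mul1g.
  by rewrite iterS IH /rotation !coset_step_c expgS !mulgA.
by rewrite E (genM mk) mul1g.
Qed.

Lemma act_coset_step (h g : W) : act coset_step h (c g) = c (h * g).
Proof.
elim/(gen_ind m_cox): h => [|s h IH]; first by rewrite (act1 m_cox coset_step_obeys) mul1g.
by rewrite (actM m_cox coset_step_obeys) IH (act_gen m_cox coset_step_obeys) coset_step_c mulgA.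
Qed.

Section Lift.
Variables (Z : Type) (tau : S -> Z -> Z) (p : Z -> X).
Hypotheses (tau_ob : obeys m predT tau) (p_eq : forall s z, p (tau s z) = coset_step s (p z))
  (fixl : forall s z, coset_step s (p z) = p z -> tau s z = z).

Lemma p_act (g : W) z : p (act tau g z) = act coset_step g (p z).
Proof.
apply: (@p_word_act _ _ coset_step tau p predT) => [s z' _|]; first exact: p_eq.
exact/allP.
Qed.

(** Translated to the base coset, the stabiliser is generated by reflections
    [w^-1 s w]. The walk [w] leads from the base point to a point fixed by [s],
    where the action of [s] on the fibre is trivial; then the walk returns. *)
Lemma stab_lift (h : W) z : act coset_step h (p z) = p z -> act tau h z = z.
Proof.
have [g pz] := c_surj (p z); pose z0 := act tau g^-1 z.
have pz0 : p z0 = c 1 by rewrite p_act -pz act_coset_step mulVg.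
have -> : z = act tau g z0 by rewrite actKV.
rewrite p_act pz0 !act_coset_step mulg1 => /esym/c_eq; rewrite mulgA => Hh.
have H1 k : generated_subgroup T k -> act tau k z0 = z0.
  have sK : is_subgroup (fun k : W => act tau k z0 = z0).
    split=> /= [|x y hx hy|x hx]; first exact: (act1 m_cox tau_ob).
      by rewrite (actM m_cox tau_ob) hy.
    by rewrite -{1}hx actVK.
  apply: (gensub_min sK) => r Tr /=.
  have [w [s rE]] := T_refl Tr; rewrite rE in Tr *.
  have : c (gen s ^ w) = c 1.
    by apply/esym/c_eq; rewrite invg1 mul1g; apply: gensub_sub.
  move/(c_mul w); rewrite mulg1 conjgE mulVKg => wE.
  have fz : tau s (act tau w z0) = act tau w z0.
    by apply: fixl; rewrite p_act pz0 act_coset_step mulg1 coset_step_c.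
  by rewrite !(actM m_cox tau_ob) (act_gen m_cox tau_ob) fz actVK.
have := H1 _ Hh; rewrite !(actM m_cox tau_ob) => /(congr1 (act tau g)).
by rewrite actKV.
Qed.
End Lift.

(** The cover of [X] that remembers the element of [W] spelled by the steps that
    actually move. *)
Definition development s (z : X * W) : X * W :=
  (coset_step s z.1, if coset_step s z.1 == z.1 then z.2 else gen s * z.2).

Lemma coset_stepK s : involutive (coset_step s).
Proof. by move=> x; apply: (step_invol m_cox coset_step_obeys). Qed.

Lemma developmentK s : involutive (development s).
Proof.
move=> [x g]; rewrite /development /= coset_stepK (eq_sym x).
by case: eqP => //= _; rewrite genK.
Qed.

Lemma development_fix s z : coset_step s z.1 = z.1 -> development s z = z.
Proof. by case: z => x g; rewrite /development /= => ->; rewrite eqxx. Qed.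

(** On an orbit without fixed points every step moves, and the relation is the
    one of [W]; the other orbits impose no condition. *)
Lemma development_obeys : obeys m predT development.
Proof.
apply: (@cover_obeys X _ coset_step development fst predT coset_step_obeys) => //.
- by move=> s _; apply: developmentK.
- by move=> s z _; apply: development_fix.
move=> s t k x _ _ st mk.
have [/existsP[y /andP[cy fy]]|nfix] :=
    boolP [exists y, connect (edge coset_step s t) x y &&
      ((coset_step s y == y) || (coset_step t y == y))].
  by exists y => //; case/orP: fy => /eqP; [constructor 1|constructor 2].
exists x => //; constructor 3 => -[x' g] /= ->.
have nf y : connect (edge coset_step s t) x y -> coset_step s y != y /\ coset_step t y != y.
  move=> cy; apply/andP; move: nfix; rewrite negb_exists => /forallP/(_ y).
  by rewrite cy negb_or.
have E j : iter j (rotation development s t) (x, g) = (iter j (rotation coset_step s t) x,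
  (gen s * gen t) ^+ j * g)
    /\ connect (edge coset_step s t) x (iter j (rotation coset_step s t) x).
  elim: j => [|j [IH cj]]; first by rewrite expg0 mul1g.
  have ct : connect (edge coset_step s t) x (coset_step t (iter j (rotation coset_step s t) x)).
    by apply: connect_trans cj (connect1 _); rewrite /edge eqxx orbT.
  split; last by apply: connect_trans ct (connect1 _); rewrite /edge eqxx.
  rewrite iterS IH {1}/rotation /development /= (negPf (nf _ cj).2) (negPf (nf _ ct).1).
  by rewrite expgS !mulgA.
by rewrite (E k).1 (genM mk) mul1g (coset_step_obeys x _ _ mk).
Qed.

(** If [s x = t x != x], then [st] fixes [x] and hence acts trivially on the
    development above [x], where it multiplies by [st]. *)
Lemma no_double_edge s t x : s != t -> coset_step s x = coset_step t x -> coset_step s x = x.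
Proof.
move=> st e; apply/eqP; apply: contraT => nx.
have := @stab_lift _ development fst development_obeys (fun _ _ => erefl) development_fix (gen s *
  gen t) (x, 1).
rewrite !(actM m_cox coset_step_obeys) !(act_gen m_cox coset_step_obeys) /= -e coset_stepK => /(_
  erefl).
rewrite (actM m_cox development_obeys) !(act_gen m_cox development_obeys) /development /= -e
  coset_stepK (negPf nx).
rewrite eq_sym (negPf nx) mulg1 => -[E].
by case: (gen_neq m_cox m_odd st); rewrite -(genK m_cox s (gen t)) E mulg1.
Qed.

Fixpoint moving w x : word S :=
  if w is l :: v then
    if coset_step l.1 (word_act coset_step v x) == word_act coset_step v x then moving v x else l
      :: moving v x
  else [::].

Lemma act_moving w x : word_act development w (x, 1) = (word_act coset_step w x,
  word_val m (moving w x)).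
Proof.
elim: w => //= l w ->; rewrite /development /=.
by case: ifP => [/eqP ->|_] //; rewrite word_val_cons.
Qed.

(** The walk fixes its lift in the development, so its moving steps spell a word
    over [B] with value [1]; stationary steps act trivially above [X] and may be
    dropped. Thanks to [parabolic], [Z] needs no action of the letters outside
    [B]. *)
Lemma closed_lift (Z : Type) (tau : S -> Z -> Z) (p : Z -> X) (B : {pred S}) w z :
  obeys m B tau -> (forall s z, s \in B -> p (tau s z) = coset_step s (p z)) ->
  (forall s z, s \in B -> coset_step s (p z) = p z -> tau s z = z) ->
  word_over B w -> word_act coset_step w (p z) = p z -> word_act tau w z = z.
Proof.
move=> tau_ob p_eq fixl wB wz.
have m1 : word_val m (moving w (p z)) = 1.
  have := @stab_lift _ development fst development_obeys (fun _ _ => erefl) development_fix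
    (word_val m w) (p z, 1).
  rewrite !act_word_val //; try exact: coset_step_obeys; try exact: development_obeys.
  by rewrite /= act_moving => /(_ wz) [].
have mB : word_over B (moving w (p z)).
  elim: w wB {wz m1} => //= l w IH /andP[lB wB]; case: ifP => _; last rewrite /= lB; exact: IH.
rewrite -[RHS](parabolic m_cox m_odd tau_ob z mB m1).
elim: w wB {wz m1 mB} => //= l w IH /andP[lB wB]; rewrite (IH wB).
case: ifP => // /eqP e; apply: fixl => //; rewrite -(IH wB).
by rewrite (@p_word_act _ _ coset_step tau p B).
Qed.

End Quotient.
End Covering.

(** * Orbits of a pair of generators *)
Lemma iter_inj (T : Type) (f : T -> T) n : injective f -> injective (iter n f).
Proof. by move=> fI; elim: n => // n IH x y /= /fI /IH. Qed.

Section Orbits.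
Variables (S : finType) (m : S -> S -> option nat).
Hypotheses (m_cox : coxeter_matrix m) (m_odd : odd_angled m).
Variables (X : finType) (sg : S -> X -> X).
Hypotheses (sg_ob : obeys m predT sg)
  (no_double : forall s t x, s != t -> sg s x = sg t x -> sg s x = x).

Let sgK s : involutive (sg s). Proof. by move=> x; apply: (step_invol m_cox sg_ob). Qed.
Let sg_inj s : injective (sg s). Proof. exact: can_inj (@sgK s). Qed.

Definition fixpoints s : {set X} := [set x | sg s x == x].

Lemma fixpointsP s x : reflect (sg s x = x) (x \in fixpoints s).
Proof. by rewrite inE; apply: eqP. Qed.

Lemma edge_sym s t : connect_sym (edge sg s t).
Proof.
apply: sym_connect_sym => x y; rewrite /edge.
by apply/orP/orP => -[/eqP ->|/eqP ->]; rewrite sgK eqxx; [left|right|left|right].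
Qed.

Lemma edgeC s t : connect (edge sg s t) =2 connect (edge sg t s).
Proof. by apply: eq_connect => x y; rewrite /edge orbC. Qed.

(** The <s,t>-orbit of [x] consists of moved points, hence is a cycle in the
    coset graph; every other orbit is a path. *)
Definition on_cycle s t x := ~~ [exists y, connect (edge sg s t) x y &&
  ((sg s y == y) || (sg t y == y))].

Lemma on_cycleP s t x y : on_cycle s t x -> connect (edge sg s t) x y -> sg s y <> y /\ sg t y <> y.
Proof.
rewrite /on_cycle negb_exists => /forallP/(_ y) + cy; rewrite cy negb_or => /andP[/eqP ? /eqP ?].
by split.
Qed.

Lemma on_cycleC s t x : on_cycle s t x = on_cycle t s x.
Proof.
congr (~~ _); apply: eq_existsb => y; by rewrite edgeC orbC.
Qed.

Lemma on_cycle_connect s t x y : on_cycle s t x -> connect (edge sg s t) x y -> on_cycle s t y.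
Proof.
move=> cx xy; apply/negP => /existsP[z /andP[yz fz]].
have [h1 h2] := on_cycleP cx (connect_trans xy yz).
by case/orP: fz => /eqP.
Qed.

Definition cycle_points s t : {set X} := [set x | on_cycle s t x].
Definition cycle_reps s t : {set X} := [set x | on_cycle s t x &&
  (fingraph.root (edge sg s t) x == x)].
Definition num_cycles s t := #|cycle_reps s t|.

Section Pair.
Variables (s t : S) (k : nat).
Hypotheses (st : s != t) (mk : m s t = Some k).
Let ok : odd k. Proof. by have [] := label_odd3 m_cox m_odd st mk. Qed.
Let rho := rotation sg s t.

Lemma rho_inj : injective rho. Proof. exact: inj_comp (@sg_inj s) (@sg_inj t). Qed.

Lemma rho_k x : iter k rho x = x. Proof. exact: sg_ob mk. Qed.

Lemma rho_kM j x : iter (j * k) rho x = x.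
Proof. by elim: j => // j IH; rewrite mulSn iterD IH rho_k. Qed.

Lemma rhoV j x : iter j (rotation sg t s) x = iter (j * k.-1) rho x.
Proof.
have e : (j * k = j * k.-1 + j)%N by case: (k) ok => //= k' _; rewrite mulnS addnC.
by rewrite -[LHS](rho_kM j) e iterD /rho rotation_iterK.
Qed.

(** Reflections invert rotations, the inverse being written as the power
    [k.-1]. *)
Lemma sg_rho j x : sg s (iter j rho x) = iter (j * k.-1) rho (sg s x).
Proof. by rewrite -rhoV; apply: (@sg_inj s); rewrite sgK rotation_swap sgK. Qed.

Lemma connect_rho j x : connect (edge sg s t) x (iter j rho x).
Proof.
elim: j => // j IH; rewrite iterS; apply: connect_trans IH _.
apply: (@connect_trans _ _ (sg t (iter j rho x))); apply: connect1.
  by rewrite /edge eqxx orbT.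
by rewrite /rho /rotation /edge eqxx.
Qed.

Lemma connect_fix x y : sg s x = x -> connect (edge sg s t) x y -> exists j, y = iter j rho x.
Proof.
move=> sx /connectP[p + ->]; elim/last_ind: p => [|p z IH] /=; first by exists 0%N.
rewrite rcons_path last_rcons => /andP[/IH[j ->]] /orP[] /eqP ->.
  by exists (j * k.-1)%N; rewrite sg_rho sx.
exists (j.+1 * k.-1)%N; rewrite -{2}sx -sg_rho iterS.
have rE u : sg s (rho u) = sg t u by rewrite /rho /rotation sgK.
by rewrite rE.
Qed.

Lemma iter_mul a b x : iter a rho x = x -> iter (b * a) rho x = x.
Proof. by move=> ax; elim: b => // b IH; rewrite mulSn iterD IH. Qed.

(** A point of the path that is also fixed by [s] would be invariant under an
    even power of the rotation, and its order is odd. *)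
Lemma fixed_unique j x : sg s x = x -> sg s (iter j rho x) = iter j rho x -> iter j rho x = x.
Proof.
move=> sx; rewrite sg_rho sx => E.
have E2 : iter (j + j) rho x = x.
  rewrite iterD -{1}E -iterD; have -> : (j + j * k.-1 = j * k)%N.
    by case: (k) ok => //= k' _; rewrite mulnS.
  exact: rho_kM.
rewrite -{2}(iter_mul k.+1./2 E2).
have -> : (k.+1./2 * (j + j) = j + j * k)%N.
  rewrite -mulnS addnn -mul2n mulnA muln2 mulnC; congr (_ * _)%N.
  by rewrite -[RHS]odd_double_half /= ok.
by rewrite iterD rho_kM.
Qed.

(** The length of an orbit of the rotation is a divisor of [m s t]: when it is
    not [1], it is at least the label [d]. *)
Lemma order_dvd_k x : order rho x %| k.
Proof.
have o0 : 0 < order rho x by rewrite order_gt0.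
have : iter (k %% order rho x) rho x = x.
  have := rho_k x; rewrite {1}(divn_eq k (order rho x)) addnC iterD.
  by rewrite iter_mul //; apply: iter_order; apply: rho_inj.
move/(congr1 (findex rho x)); rewrite findex_iter ?ltn_mod // findex0 => /eqP.
by [].
Qed.

Variable d : nat.
Hypothesis kd : forall j, 1 < j -> j %| k -> d <= j.

Lemma order_ge x : rho x <> x -> d <= order rho x.
Proof.
move=> rx; apply: kd (order_dvd_k x).
rewrite ltn_neqAle order_gt0 andbT; apply/eqP => o1; apply: rx.
by have := iter_order rho_inj x; rewrite -o1.
Qed.

Let comp x : {set X} := [set y | connect (edge sg s t) x y].

Lemma orbit_sub_comp x : {subset fconnect rho x <= comp x}.
Proof. by move=> y /iter_findex <-; rewrite inE connect_rho. Qed.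

Lemma card_comp_path x : sg s x = x -> sg t x <> x -> d <= #|comp x|.
Proof.
move=> sx tx; apply: leq_trans (order_ge (x := x) _) _.
  by rewrite /rho /rotation => E; apply: tx; apply: (@sg_inj s); rewrite E sx.
rewrite -[order rho x]/(#|fconnect rho x|); apply: subset_leq_card.
by apply/subsetP => y; apply: orbit_sub_comp.
Qed.

(** The rotation splits a cycle into two orbits exchanged by [s]: were they to
    meet, [s] would agree with a rotation somewhere, and halving its odd angle
    would produce a fixed point. *)
Lemma card_comp_cycle x : on_cycle s t x -> d.*2 <= #|comp x|.
Proof.
move=> cx.
have rx : rho x <> x.
  rewrite /rho /rotation => E; have [+ _] := on_cycleP cx (connect0 _ _); apply.
  by apply: (@no_double s t) => //; rewrite -{1}E sgK.
pose A := [set y in fconnect rho x].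
have dA : d <= #|A| by rewrite cardsE; apply: order_ge.
have disj : [disjoint A & sg s @: A].
  apply/pred0P => y /=; apply/negP => /andP[]; rewrite inE => xy /imsetP[z]; rewrite inE => xz yz.
  have [i yi] : exists i, y = iter i rho x by exists (findex rho x y); rewrite iter_findex.
  have [j zj] : exists j, z = iter j rho x by exists (findex rho x z); rewrite iter_findex.
  move: yz; rewrite yi zj sg_rho => E.
  (* [l] is half of the angle [i + j] modulo the odd number [k]. *)
  pose l := ((i + j) * k.+1./2)%N.
  have [+ _] := on_cycleP cx (connect_rho l x); apply.
  have {}E : sg s x = iter (i + j) rho x.
    rewrite addnC iterD E -iterD; have -> : (j + j * k.-1 = j * k)%N.
      by case: (k) ok => //= k' _; rewrite mulnS.
    by rewrite rho_kM.
  rewrite sg_rho E -iterD.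
  have ij : (l.*2 = (i + j) + (i + j) * k)%N.
    rewrite /l -mulnS -muln2 -mulnA; congr (_ * _)%N.
    by rewrite muln2 -[RHS]odd_double_half /= ok.
  apply: (iter_inj (n := l) rho_inj); rewrite -!iterD.
  transitivity (iter (i + j) rho x).
    have -> : (l + (l * k.-1 + (i + j)) = l * k + (i + j))%N.
      by rewrite addnA; congr (_ + _)%N; case: (k) ok => //= k' _; rewrite mulnS.
    by rewrite [LHS]iterD rho_kM.
  by rewrite addnn ij [RHS]iterD rho_kM.
rewrite -addnn; apply: leq_trans (leq_add dA dA) _.
have AI : #|sg s @: A| = #|A| by apply: card_imset; apply: sg_inj.
rewrite -{2}AI; have := leq_card_setU A (sg s @: A) => -[_]; rewrite disj => /eqP <-.
apply: subset_leq_card; rewrite subUset; apply/andP; split; apply/subsetP => y.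
  by rewrite inE => /orbit_sub_comp.
case/imsetP => z; rewrite inE => /orbit_sub_comp; rewrite !inE => xz ->.
by apply: connect_trans xz (connect1 _); rewrite /edge eqxx.
Qed.

Lemma card_fix_le : #|fixpoints s| <= #|fixpoints t|.
Proof.
have I := @iter_inj _ _ k./2 rho_inj.
rewrite -(card_imset (mem (fixpoints s)) I); apply: subset_leq_card;
  apply/subsetP => _ /imsetP[x /fixpointsP sx ->].
by apply/fixpointsP; apply: (fix_half m_cox m_odd sg_ob).
Qed.

Let I := fixpoints s :|: cycle_reps s t.

(** A path contains exactly one fixed point of [s] (the other end belongs to
    [t]), so [I] represents every orbit once. *)
Lemma comp_disjoint x x' y : x \in I -> x' \in I -> y \in comp x -> y \in comp x' -> x = x'.
Proof.
rewrite !inE => Ix Ix' xy x'y.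
have xx' : connect (edge sg s t) x x' by apply: connect_trans xy _; rewrite edge_sym.
have x'x : connect (edge sg s t) x' x by rewrite edge_sym.
case/orP: Ix => [/eqP sx|/andP[cx /eqP rx]].
  case/orP: Ix' => [/eqP sx'|/andP[cx' /eqP rx']].
    by have [j xj] := connect_fix sx xx'; rewrite xj fixed_unique // -xj.
  by have [] := on_cycleP cx' x'x.
case/orP: Ix' => [/eqP sx'|/andP[cx' /eqP rx']].
  by have [] := on_cycleP cx xx'.
by rewrite -rx -rx'; apply/eqP; rewrite root_connect //; apply: edge_sym.
Qed.

Lemma sum_comp (J U : {set X}) : J \subset I -> (forall x, x \in J -> comp x \subset U) ->
  \sum_(x in J) #|comp x| <= #|U|.
Proof.
move=> /subsetP JI JU.
under eq_bigr => x _ do rewrite -sum1_card big_mkcond /=.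
rewrite exchange_big /= -sum1_card [leqRHS]big_mkcond; apply: leq_sum => y _.
have [x /andP[Jx yx]|no] := pickP (fun x => (x \in J) && (y \in comp x)).
  rewrite (bigD1 x) //= yx (subsetP (JU _ Jx)) // big1 // => x' /andP[Jx' x'x].
  case: ifP => // yx'; case/eqP: x'x; exact: comp_disjoint (JI _ Jx') (JI _ Jx) yx' yx.
by rewrite big1 // => x Jx; have := no x; rewrite /= Jx /= => ->.
Qed.

Lemma cycle_count : d.*2 * num_cycles s t <= #|cycle_points s t|.
Proof.
rewrite mulnC -sum_nat_const; apply: leq_trans (sum_comp (J := cycle_reps s t) (U := cycle_points
  s t) _ _).
- by apply: leq_sum => x; rewrite inE => /andP[cx _]; apply: card_comp_cycle.
- exact: subsetUr.
move=> x; rewrite inE => /andP[cx _]; apply/subsetP => y; rewrite !inE; exact: on_cycle_connect.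
Qed.

Lemma orbit_count :
  d * #|fixpoints s :\: fixpoints t| + d.*2 * num_cycles s t +
    #|fixpoints s :&: fixpoints t| <= #|X|.
Proof.
have le : \sum_(x in I) #|comp x| <= #|[set: X]|.
  by apply: sum_comp => // x _; apply: subsetT.
rewrite cardsT in le; apply: leq_trans le.
have dI : [disjoint fixpoints s & cycle_reps s t].
  apply/pred0P => x /=; apply/negP => /andP[/fixpointsP sx]; rewrite inE => /andP[cx _].
  by have [] := on_cycleP cx (connect0 _ x).
rewrite (eq_bigl (fun x => (x \in fixpoints s) || (x \in cycle_reps s t))); last by move=> x;
  rewrite inE.
rewrite bigU //= (bigID (mem (fixpoints t))) /= [leqLHS]addnC -addnA; apply: leq_add.
  rewrite -sum1_card; under [X in _ <= X]eq_bigl => x do rewrite -in_setI.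
  by apply: leq_sum => x _; apply/card_gt0P; exists x; rewrite inE.
apply: leq_add.
  rewrite mulnC -sum_nat_const; under [X in _ <= X]eq_bigl => x do rewrite andbC -in_setD.
  apply: leq_sum => x; rewrite in_setD => /andP[/fixpointsP tx /fixpointsP sx].
  exact: card_comp_path.
rewrite mulnC -sum_nat_const; apply: leq_sum => x; rewrite inE => /andP[cx _].
exact: card_comp_cycle.
Qed.

End Pair.

(** [s] and [t] are conjugate in the dihedral group of odd order. *)
Lemma card_fix s t k : s != t -> m s t = Some k -> #|fixpoints s| = #|fixpoints t|.
Proof.
move=> st mk; apply/eqP; rewrite eqn_leq (card_fix_le st mk) (card_fix_le (s := t) (k := k))
  1?eq_sym //.
by rewrite (m_sym m_cox).
Qed.

End Orbits.

(** * Counting edges against cycles *)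
Section Rank.
Import GRing.Theory.
Variables (S : finType) (m : S -> S -> option nat).
Hypotheses (m_cox : coxeter_matrix m) (m_odd : odd_angled m).
Variables (X : finType) (sg : S -> X -> X).
Hypotheses (sg_ob : obeys m predT sg)
  (closed_lift : forall (Z : Type) (tau : S -> Z -> Z) (p : Z -> X) (B : {pred S}) w z,
     obeys m B tau -> (forall s z, s \in B -> p (tau s z) = sg s (p z)) ->
     (forall s z, s \in B -> sg s (p z) = p z -> tau s z = z) ->
     word_over B w -> word_act sg w (p z) = p z -> word_act tau w z = z).

Let sgK s : involutive (sg s). Proof. by move=> x; apply: (step_invol m_cox sg_ob). Qed.

Variables (B : {set S}) (L : seq (S * S)).
Hypothesis L_cover : forall s t, s \in B -> t \in B -> s != t -> m s t != None ->
  ((s, t) \in L) || ((t, s) \in L).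
Let lt_end s x := enum_rank x < enum_rank (sg s x).

(** Each edge of colour [s] is represented by that one of its two ends which
    comes first in the enumeration of [X]. *)
Definition Edges : {set X * S} := [set q : X * S | (q.2 \in B) && lt_end q.2 q.1].

Definition Faces : {set 'I_(size L) * X} :=
  [set q | q.2 \in cycle_reps sg (tnth (in_tuple L) q.1).1 (tnth (in_tuple L) q.1).2].

Definition common_fixpoints : {set X} := [set x | [forall s in B, sg s x == x]].

Lemma card_Faces : #|Faces| = \sum_(q <- L) num_cycles sg q.1 q.2.
Proof.
rewrite -[L in RHS]/(tval (in_tuple L)) big_tuple -sum1_card.
rewrite (eq_bigl (fun q : 'I_(size L) * X => true && (q.2 \in cycle_reps sg (tnth (in_tuple L)
  q.1).1 (tnth (in_tuple L) q.1).2))).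
  rewrite -(pair_big_dep xpredT (fun i x => x \in cycle_reps sg (tnth (in_tuple L) i).1 (tnth
    (in_tuple L) i).2) (fun _ _ => 1)) /=.
  by apply: eq_bigr => i _; rewrite sum1_card.
by move=> q; rewrite inE.
Qed.

Lemma card_Edges phi : (forall s, s \in B -> #|fixpoints sg s| = phi) ->
  #|B| * (#|X| - phi) = #|Edges|.*2.
Proof.
move=> fixB.
have Es s : s \in B -> #|X| - phi = #|[set x | lt_end s x]|.*2.
  move=> sB; rewrite -(fixB s sB).
  have gt : #|[set x | enum_rank (sg s x) < enum_rank x]| = #|[set x | lt_end s x]|.
    rewrite -(card_imset (mem [set x | lt_end s x]) (can_inj (@sgK s))).
    apply: eq_card => x; apply/idP/imsetP => [|[y + ->]]; rewrite !inE /lt_end.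
      by move=> h; exists (sg s x); rewrite ?sgK // inE sgK.
    by rewrite sgK.
  have -> : #|X| - #|fixpoints sg s| = #|~: fixpoints sg s| by rewrite -(cardsC (fixpoints sg s))
    addKn.
  have -> : ~: fixpoints sg s = [set x | lt_end s x] :|: [set x | enum_rank (sg s x) < enum_rank x].
    apply/setP => x; rewrite !inE -neq_ltn; congr (~~ _).
    by rewrite eq_sym; apply/eqP/eqP => [<- //|/val_inj/enum_rank_inj //].
  rewrite cardsU gt -addnn (_ : _ :&: _ = set0) ?cards0 ?subn0 //.
  by apply/setP => x; rewrite !inE /lt_end; case: ltngtP.
rewrite -sum_nat_const (eq_bigr _ Es) -(big_morph _ doubleD double0); congr (_.*2).
rewrite -[RHS]sum1_card (eq_bigl (fun q : X * S => true && ((q.2 \in B) && lt_end q.2 q.1)));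
  last by move=> q; rewrite inE.
rewrite -(pair_big_dep xpredT (fun x s => (s \in B) && lt_end s x) (fun _ _ => 1)) /=.
rewrite (exchange_big_dep (mem B)) /=; last by move=> x s _ /andP[].
by apply: eq_bigr => s sB; rewrite -sum1_card; apply: eq_bigl => x; rewrite !inE sB.
Qed.

Local Open Scope ring_scope.

Lemma F2D (a : 'F_2) : a + a = 0.
Proof. by apply/eqP; case: a => [[|[|]]]. Qed.

Definition edge_rep s x : X * S := if lt_end s x then (x, s) else (sg s x, s).

Lemma edge_rep_sg s x : sg s x != x -> edge_rep s (sg s x) = edge_rep s x.
Proof.
move=> nx; rewrite /edge_rep /lt_end sgK.
have : enum_rank x != enum_rank (sg s x) by rewrite (inj_eq enum_rank_inj) eq_sym.
by rewrite -(inj_eq val_inj) /=; case: ltngtP.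
Qed.

(** The value of [f] on the edge of colour [s] at [x], and [0] if [s] fixes
    [x]. *)
Definition edge_value (f : 'rV['F_2]_#|Edges|) s x : 'F_2 :=
  \sum_j f 0 j * (enum_val j == edge_rep s x)%:R.

Lemma edge_value_sg f s x : edge_value f s (sg s x) = edge_value f s x.
Proof.
have [->//|nx] := eqVneq (sg s x) x.
by rewrite /edge_value edge_rep_sg.
Qed.

Lemma edge_value_fix f s x : sg s x = x -> edge_value f s x = 0.
Proof.
move=> sx; rewrite /edge_value big1 // => j _.
case: eqP => [e|_]; last by rewrite mulr0.
have := enum_valP j; rewrite e /edge_rep /lt_end sx if_same inE /= /lt_end sx ltnn.
by rewrite andbF.
Qed.

(** The double cover of [X] in which the edges with value [1] change sheets. *)
Definition cover_step f s (z : X * 'F_2) : X * 'F_2 := (sg s z.1, z.2 + edge_value f s z.1).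

Definition period (q : S * S) := odflt 0%N (m q.1 q.2).

(** Each column sums a function on edges along a walk around one cycle. The walk
    takes the full period [m s t], so it may go around an odd number of times,
    which is harmless over the field of two elements. *)
Definition facemx : 'M['F_2]_(#|Edges|, #|Faces|) := \matrix_(j, c)
  let q := tnth (in_tuple L) (enum_val c).1 in let x := (enum_val c).2 in
  \sum_(i < period q)
    ((enum_val j == edge_rep q.2 (iter i (rotation sg q.1 q.2) x))%:R +
     (enum_val j == edge_rep q.1 (sg q.2 (iter i (rotation sg q.1 q.2) x)))%:R).

Lemma facemxE f c :
  let q := tnth (in_tuple L) (enum_val c).1 in let x := (enum_val c).2 in
  (f *m facemx) 0 c = \sum_(i < period q)
    (edge_value f q.2 (iter i (rotation sg q.1 q.2) x) +
      edge_value f q.1 (sg q.2 (iter i (rotation sg q.1 q.2) x))).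
Proof.
move=> q x; rewrite mxE; under eq_bigr => j _ do rewrite mxE -/q -/x mulr_sumr.
rewrite exchange_big; apply: eq_bigr => i _ /=.
by rewrite /edge_value -big_split /=; apply: eq_bigr => j _; rewrite mulrDr.
Qed.

Lemma cover_step_iter f s t j x a :
  iter j (rotation (cover_step f) s t) (x, a) = (iter j (rotation sg s t) x,
    a + \sum_(i < j) (edge_value f t (iter i (rotation sg s t) x) +
      edge_value f s (sg t (iter i (rotation sg s t) x)))).
Proof.
elim: j => [|j IH]; first by rewrite big_ord0 addr0.
by rewrite iterS IH big_ord_recr /= {1}/rotation /cover_step /= !addrA.
Qed.

(** The relations of the double cover hold on paths because fixed points lift to
    fixed points, and on cycles because the sums along them vanish. *)
Lemma cocycle_obeys f : f *m facemx = 0 -> obeys m (mem B) (cover_step f).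
Proof.
move=> f0; apply: (cover_obeys m_cox m_odd (p := fst) sg_ob).
- by move=> s _ [x a]; rewrite /cover_step /= sgK edge_value_sg -addrA F2D addr0.
- by [].
- by move=> s [x a] _ /= sx; rewrite /cover_step /= sx edge_value_fix // addr0.
move=> s t k x sB tB st mk.
have [/existsP[y /andP[cy fy]]|nfix] :=
    boolP [exists y, connect (edge sg s t) x y && ((sg s y == y) || (sg t y == y))].
  by exists y => //; case/orP: fy => /eqP; [constructor 1|constructor 2].
have key u v : (u, v) \in L -> m u v = Some k -> on_cycle sg u v x ->
   closes (cover_step f) fst u v k (fingraph.root (edge sg u v) x).
  move=> /seq_tnthP[i uv] muv cx [y a] /= ->.
  set r := fingraph.root _ _.
  have rF : (i, r) \in Faces.
    rewrite inE /= -[tnth _ _]uv inE /= root_root ?eqxx ?andbT; last exact: (edge_sym m_cox sg_ob).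
    by apply: on_cycle_connect cx _ => //; apply: connect_root.
  have := facemxE f (enum_rank_in rF (i, r)); rewrite f0 mxE enum_rankK_in //=.
  rewrite -[tnth _ _]uv /period /= muv /= => E.
  by rewrite cover_step_iter -E addr0 (sg_ob _ _ _ muv).
have mk' : m t s = Some k by rewrite (m_sym m_cox).
have /orP[inL|inL] : ((s, t) \in L) || ((t, s) \in L) by apply: L_cover; rewrite ?mk.
  exists (fingraph.root (edge sg s t) x); first exact: connect_root.
  by constructor 3; apply: key.
exists (fingraph.root (edge sg t s) x); first by rewrite edgeC; apply: connect_root.
constructor 3; apply: (@closesC _ X _ (cover_step f) fst (mem B)) => //.
  by move=> u _ [y a]; rewrite /cover_step /= sgK edge_value_sg -addrA F2D addr0.
by apply: key => //; rewrite on_cycleC.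
Qed.

Definition Bedge : rel X := fun x y => [exists s in B, y == sg s x].

Lemma Bedge_sym : connect_sym Bedge.
Proof.
apply: sym_connect_sym => x y; apply/existsP/existsP => -[s /andP[sB /eqP ->]];
  by exists s; rewrite sB sgK eqxx.
Qed.

Lemma Bword x : exists2 w, word_over (mem B) w & word_act sg w (fingraph.root Bedge x) = x.
Proof.
have : connect Bedge (fingraph.root Bedge x) x by rewrite Bedge_sym connect_root.
move: (fingraph.root Bedge x) => r; case/connectP => p + ->.
elim/last_ind: p => [|p z IH] /=; first by exists [::].
rewrite rcons_path last_rcons => /andP[/IH[w wB ww] /existsP[s /andP[sB /eqP ->]]].
by exists ((s, false) :: w); rewrite /= ?sB ?ww.
Qed.

(** By [closed_lift] the sheet reached by a walk from a root of the component of
    [x] depends only on its end [x]: this is the function [g]. *)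
Lemma coboundary f : f *m facemx = 0 ->
  exists g : X -> 'F_2, forall s x, s \in B -> edge_value f s x = g x + g (sg s x).
Proof.
move=> f0; have ob := cocycle_obeys f0.
pose r x := fingraph.root Bedge x; pose w x := s2val (cid2 (Bword x)).
have wB x : word_over (mem B) (w x) by rewrite /w; case: cid2.
have wr x : word_act sg (w x) (r x) = x by rewrite /w; case: cid2.
have fstw v z : word_over (mem B) v -> (word_act (cover_step f) v z).1 = word_act sg v z.1.
  by apply: (@p_word_act _ _ _ sg (cover_step f) fst (mem B)).
exists (fun x => (word_act (cover_step f) (w x) (r x, 0)).2) => s x sB.
have rs : r (sg s x) = r x.
  apply/eqP; rewrite (root_connect Bedge_sym) (Bedge_sym (sg s x)).
  by apply/connect1/existsP; exists s; rewrite sB eqxx.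
set z := word_act _ (w x) _.
have zx : z.1 = x by rewrite /z fstw // wr.
have tK u y : u \in B -> cover_step f u (cover_step f u y) = y.
  by move=> uB; apply: (obeys_inv m_cox) ob _.
have winv v y : word_over (mem B) v -> word_act (cover_step f) (word_inv v) (word_act (cover_step
  f) v y) = y.
  elim: v y => //= l v IH y /andP[lB vB].
  by rewrite /word_inv /= rev_cons -cats1 word_act_cat /= tK // IH.
have winvB v : word_over (mem B) v -> word_over (mem B) (word_inv v).
  by rewrite /word_over /word_inv all_rev all_map; apply: sub_all => -[].
have E : word_act (cover_step f) (w (sg s x)) (r (sg s x), 0) = cover_step f s z.
  rewrite rs; apply: esym.
  have cl := @closed_lift _ (cover_step f) fst (mem B) (word_inv (w (sg s x)) ++ (s,
    false) :: w x) (r x, 0) ob.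
  have {}cl : word_act (cover_step f) (word_inv (w (sg s x)) ++ (s, false) :: w x) (r x,
    0) = (r x, 0).
    apply: cl => //.
    - by move=> u [y a] _ /= uy; rewrite /cover_step /= uy edge_value_fix // addr0.
    - by rewrite /word_over all_cat -/(word_over _ _) winvB //= sB; apply: wB.
    rewrite -[LHS]/(word_act sg _ (r x, 0 : 'F_2).1) -fstw; last first.
      by rewrite /word_over all_cat -/(word_over _ _) winvB //= sB; apply: wB.
    rewrite word_act_cat /= -/z.
    have <- : word_act (cover_step f) (w (sg s x)) (word_act (cover_step f) (word_inv (w (sg s
      x))) (cover_step f s z)) = cover_step f s z.
      by rewrite -{1}[w (sg s x)]word_invK winv // winvB.
    rewrite winv //; set y := word_act _ (word_inv _) _.
    have : word_act sg (w (sg s x)) y.1 = sg s x.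
      by rewrite -fstw // /y -{1}[w (sg s x)]word_invK winv ?winvB //= zx.
    rewrite -{2}(wr (sg s x)) rs; move: (w (sg s x)) => v.
    by elim: v => //= l v IH /(can_inj (@sgK l.1)) /IH.
  by move: cl; rewrite word_act_cat /= -/z => /(congr1 (word_act (cover_step f) (w (sg s x))));
    rewrite -{1}[w (sg s x)]word_invK winv ?winvB.
rewrite E /cover_step /= zx addrA F2D add0r //.
Qed.

(** Functions killed by the matrix of cycles form a space of dimension at least
    [#|Edges| - #|Faces|]. They are coboundaries of functions [g], in which the
    values at common fixed points do not matter, no edge being there, and [g]
    may be shifted by a constant so as to vanish at [x1]; there remain
    [#|X| - #|common_fixpoints| - 1] points. *)
Lemma edge_rank phi s0 x1 : (forall s, s \in B -> #|fixpoints sg s| = phi) ->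
  s0 \in B -> sg s0 x1 != x1 ->
  (#|Edges| + #|common_fixpoints| + 1 <= #|X| + #|Faces|)%N.
Proof.
move=> fixB s0B nx1.
pose Y := ~: (x1 |: common_fixpoints).
pose D : 'M['F_2]_(#|Y|, #|Edges|) := \matrix_(y, j)
  ((enum_val y == (enum_val j).1)%:R + (enum_val y == sg (enum_val j).2 (enum_val j).1)%:R).
have sub : (kermx facemx <= D)%MS.
  apply/row_subP => i; set f := row i _.
  have f0 : f *m facemx = 0 by rewrite /f -row_mul mulmx_ker row0.
  have [g gE] := coboundary f0.
  pose g1 x := if x \in common_fixpoints then 0 else g x - g x1.
  have -> : f = (\row_y g1 (enum_val y)) *m D; last exact: submxMl.
  apply/rowP => j; rewrite [RHS]mxE.
  have := enum_valP j; case Ej : (enum_val j) => [x s]; rewrite inE /= => /andP[sB lt].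
  have fE : f 0 j = edge_value f s x.
    rewrite /edge_value (bigD1 j) //= big1 ?addr0.
      by rewrite /edge_rep lt Ej eqxx mulr1.
    move=> j' /negPf jj'; rewrite /edge_rep lt -Ej (inj_eq enum_val_inj) jj' mulr0 //.
  have nf y : y = x \/ y = sg s x -> y \notin common_fixpoints.
    move=> hy; apply/negP; rewrite inE => /forall_inP/(_ s sB)/eqP sy.
    have {hy} : sg s x = x.
      by case: hy => e; [rewrite -e sy|move: sy; rewrite e sgK].
    by move=> sx; move: lt; rewrite /lt_end sx ltnn.
  have sumY (y : X) : y \notin common_fixpoints ->
      \sum_(i0 : 'I_#|Y|) g1 (enum_val i0) * (enum_val i0 == y)%:R = g1 y.
    move=> yF.
    have [->|yx1] := eqVneq y x1.
      rewrite big1 /g1; first by case: ifP; rewrite ?subrr.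
      move=> i0 _; case: eqP => [e|_]; last by rewrite mulr0.
      by have := enum_valP i0; rewrite e !inE eqxx.
    have yY : y \in Y by rewrite !inE negb_or yx1; move: yF; rewrite inE.
    rewrite (bigD1 (enum_rank_in yY y)) //= enum_rankK_in // eqxx mulr1 big1 ?addr0 //.
    move=> i0 ne; case: eqP => [e|_]; last by rewrite mulr0.
    by case/eqP: ne; apply: enum_val_inj; rewrite enum_rankK_in.
  under eq_bigr => i0 _ do rewrite !mxE Ej /= mulrDr.
  rewrite big_split /= !sumY; [|by apply: nf; right|by apply: nf; left].
  rewrite fE gE // /g1 (negPf (nf x _)) ?(negPf (nf (sg s x) _)); [|by right|by left].
  by rewrite addrACA -opprD F2D subr0.
have := mxrankS sub; rewrite mxrank_ker.
have x1F : x1 \notin common_fixpoints by apply: contra nx1; rewrite inE => /forall_inP; apply.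
have cY : (#|Y| + (#|common_fixpoints| + 1) = #|X|)%N.
  by rewrite -(cardsC (x1 |: common_fixpoints)) cardsU1 x1F /= addnC (addnC _ 1%N).
have r1 := rank_leq_row D; have r2 := rank_leq_col facemx.
by move=> r3; lia.
Qed.

End Rank.

(** * Exclusion of diagrams *)
Lemma least_divisorE n : 1 < n -> least_divisor n = pdiv n.
Proof.
move=> n1; rewrite /least_divisor; set s := [seq _ <- _ | _].
have n0 : 0 < n by apply: ltnW.
have ps : pdiv n \in s by rewrite mem_filter -dvdn_divisors // pdiv_dvd (prime_gt1 (pdiv_prime n1)).
have ss : sorted leq s by apply: sorted_filter (sorted_divisors n); apply: leq_trans.
have hs : head 1 s \in s by case: (s) ps => //= x s' _; rewrite inE eqxx.
apply/eqP; rewrite eqn_leq; apply/andP; split.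
  case: (s) ps ss => //= x s'; rewrite inE => /orP[/eqP->//|xs].
  by rewrite path_sortedE; [case/andP => /allP/(_ _ xs)|apply: leq_trans].
move: hs; rewrite mem_filter => /andP[h1]; rewrite -dvdn_divisors // => hd.
exact: pdiv_min_dvd.
Qed.

Section Graph.
Variables (S : finType) (m : S -> S -> option nat).
Hypotheses (m_cox : coxeter_matrix m) (m_odd : odd_angled m).

Lemma joinedP s t : reflect (s != t /\ exists2 k, m s t = Some k &
  cox_div m s t = Some (pdiv k)) (joined m s t).
Proof.
rewrite /joined /= /cox_div; apply: (iffP idP); last first.
  by case=> /negPf -> [k -> ->].
case: (eqVneq s t) => //= st; case mk : (m s t) => [k|] //= _; split=> //; exists k => //.
by rewrite least_divisorE //; have [_ /ltnW] := label_odd3 m_cox m_odd st mk.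
Qed.

Lemma cox_divC s t : cox_div m s t = cox_div m t s.
Proof. by rewrite /cox_div eq_sym (m_sym m_cox). Qed.
Lemma joinedC s t : joined m s t = joined m t s. Proof. by rewrite /joined /= cox_divC. Qed.
Lemma simpleC s t : simple_edge m s t = simple_edge m t s. Proof. by rewrite /simple_edge /=
  cox_divC. Qed.
Lemma multipleC s t : multiple_edge m s t = multiple_edge m t s.
Proof. by rewrite /multiple_edge /= /joined /simple_edge /= cox_divC. Qed.
Lemma joined_neq s t : joined m s t -> s != t. Proof. by case/joinedP. Qed.
Lemma multiple_joined s t : multiple_edge m s t -> joined m s t. Proof. by case/andP. Qed.
Lemma simple_joined s t : simple_edge m s t -> joined m s t. Proof. by rewrite /joined
  /simple_edge /= => /eqP ->. Qed.
Lemma joined_cases s t : joined m s t -> simple_edge m s t \/ multiple_edge m s t.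
Proof. by rewrite /multiple_edge /= => ->; case: (simple_edge m s t); [left|right]. Qed.

(** The label is the smallest prime factor of [m s t], so it bounds from below
    the length of any nontrivial orbit of the rotation. *)
Lemma label_bound s t k : s != t -> m s t = Some k -> cox_div m s t = Some (pdiv k) ->
  [/\ prime (pdiv k), odd (pdiv k), 2 < pdiv k & forall j, 1 < j -> j %| k -> pdiv k <= j].
Proof.
move=> st mk _; have [ok k2] := label_odd3 m_cox m_odd st mk.
have k1 := ltnW k2; have pp := pdiv_prime k1.
have op : odd (pdiv k) by apply: dvdn_odd (pdiv_dvd k) ok.
split=> //; last by move=> j; apply: pdiv_min_dvd.
by rewrite odd_prime_gt2.
Qed.

Section Numbers.
Variables (X : finType) (sg : S -> X -> X).
Hypotheses (sg_ob : obeys m predT sg)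
  (no_double : forall s t x, s != t -> sg s x = sg t x -> sg s x = x)
  (closed_lift : forall (Z : Type) (tau : S -> Z -> Z) (p : Z -> X) (B : {pred S}) w z,
     obeys m B tau -> (forall s z, s \in B -> p (tau s z) = sg s (p z)) ->
     (forall s z, s \in B -> sg s (p z) = p z -> tau s z = z) ->
     word_over B w -> word_act sg w (p z) = p z -> word_act tau w z = z).
Variables (C : {set S}) (phi e : nat).
Hypotheses (fixC : forall s, s \in C -> #|fixpoints sg s| = phi)
  (eE : #|X| = phi + e.*2) (e_gt0 : 0 < e).

Let P s t := #|fixpoints sg s :\: fixpoints sg t|.
Let F s t := num_cycles sg s t.

Lemma PC s t : s \in C -> t \in C -> P s t = P t s.
Proof. by move=> sC tC; rewrite /P !cardsD !fixC // setIC. Qed.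

(** [P s t] counts the nontrivial paths of <s,t>, each through its end fixed by
    [s]. Points fixed by both letters are subtracted from [orbit_count]. *)
Lemma count_bound s t d k : s \in C -> t \in C -> s != t -> m s t = Some k ->
  (forall j, 1 < j -> j %| k -> d <= j) -> 0 < d ->
  d.-1 * P s t + d.*2 * F s t <= e.*2.
Proof.
move=> sC tC st mk kd d0.
have := orbit_count m_cox m_odd sg_ob no_double st mk kd.
rewrite -/(P s t) -/(F s t).
have : P s t + #|fixpoints sg s :&: fixpoints sg t| = phi.
  by rewrite /P cardsD fixC // subnK // -(fixC sC) subset_leq_card // subsetIl.
rewrite eE; move: (P s t) (F s t) => p f h.
have -> : d * p = p + d.-1 * p by case: d d0 {kd}.
lia.
Qed.

Lemma simple_bound s t : s \in C -> t \in C -> simple_edge m s t -> P s t + 3 * F s t <= e.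
Proof.
move=> sC tC h; have /joinedP[st [k mk ck]] := simple_joined h.
have [_ _ _ kd] := label_bound st mk ck; move: h; rewrite /simple_edge /= ck => /eqP[p3].
rewrite p3 in kd; have := count_bound sC tC st mk kd isT; lia.
Qed.

Lemma multiple_ge5 s t : multiple_edge m s t ->
  exists k, [/\ s != t, m s t = Some k, cox_div m s t = Some (pdiv k), 5 <= pdiv k & forall j,
    1 < j -> j %| k -> pdiv k <= j].
Proof.
move=> /andP[/joinedP[st [k mk ck]] ns]; exists k; split=> //.
  have [_ op p2 kd] := label_bound st mk ck; move: ns; rewrite /simple_edge /= ck => np.
  have : pdiv k != 3 by apply: contraNneq np => ->.
  by case: (pdiv k) op p2 => [|[|[|[|[|[]]]]]].
by case: (label_bound st mk ck).
Qed.

Lemma multiple_bound s t : s \in C -> t \in C -> multiple_edge m s t -> 2 * P s t + 5 * F s t <= e.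
Proof.
move=> sC tC /multiple_ge5[k [st mk ck k5 kd]].
have := count_bound (d := 5) sC tC st mk _ isT; rewrite [_.-1]/=.
move=> h; have {}h := h (fun j j1 jk => leq_trans k5 (kd j j1 jk)); lia.
Qed.

Lemma multiple_bound7 s t : s \in C -> t \in C -> multiple_edge m s t -> cox_div m s t != Some 5 ->
  3 * P s t + 7 * F s t <= e.
Proof.
move=> sC tC /multiple_ge5[k [st mk ck k5 kd]]; rewrite ck => n5.
have [_ op _ _] := label_bound st mk ck.
have k7 : 7 <= pdiv k.
  have : pdiv k != 5 by apply: contraNneq n5 => ->.
  by case: (pdiv k) op k5 => [|[|[|[|[|[|[|[]]]]]]]].
have := count_bound (d := 7) sC tC st mk _ isT; rewrite [_.-1]/=.
move=> h; have {}h := h (fun j j1 jk => leq_trans k7 (kd j j1 jk)); lia.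
Qed.

Fixpoint steps x (p : seq S) : seq (S * S) := if p is y :: q then (x, y) :: steps y q else [::].

Definition psum (L : seq (S * S)) := \sum_(q <- L) P q.1 q.2.
Definition fsum (L : seq (S * S)) := \sum_(q <- L) F q.1 q.2.

(** A point outside the common fixed points of the list is moved by [x], which
    accounts for [2 e] points, or is passed from fixed to moved by some
    consecutive pair, which accounts for [P] points each. *)
Lemma fixpoints_bound x p : {subset x :: p <= C} ->
  #|X| <= #|common_fixpoints sg [set s in x :: p]| + e.*2 + psum (steps x p).
Proof.
elim: p x => [|y p IH] x sub.
  rewrite /psum big_nil addn0 eE leq_add2r -(fixC (sub x (mem_head _ _))) subset_leq_card //.
  apply/subsetP => v; rewrite !inE => sv; apply/forall_inP => s; by rewrite !inE => /eqP ->.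
have := IH y (fun z h => sub z (mem_behead (s := x :: y :: p) h)).
rewrite /psum big_cons /= => H; apply: leq_trans H _.
set r := bigop _ _ _; rewrite [P x y + r]addnC -!addnA [#|common_fixpoints _ _| +
  _]addnCA [leqRHS]addnCA leq_add2l.
rewrite addnC [leqRHS]addnCA leq_add2l PC ?sub ?mem_head ?inE ?eqxx ?orbT //.
apply: leq_trans (leq_card_setU _ _); apply: subset_leq_card.
apply/subsetP => v; rewrite !inE => /forall_inP h.
have [xv|xv] := boolP (sg x v == v).
  apply/orP; left; apply/forall_inP => s; rewrite !inE => /orP[/eqP->//|sp].
  by apply: h; rewrite !inE.
by apply/orP; right; apply: h; rewrite !inE eqxx.
Qed.

Lemma rank_bound x p L : {subset x :: p <= C} -> uniq (x :: p) ->
  (forall s t, s \in x :: p -> t \in x :: p -> joined m s t -> ((s, t) \in L) || ((t, s) \in L)) ->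
  (size p).+1 * e + #|common_fixpoints sg [set s in x :: p]| + 1 <= #|X| + fsum L.
Proof.
move=> sub un cov; pose B := [set s in x :: p].
have fixB s : s \in B -> #|fixpoints sg s| = phi by rewrite inE => sB; apply: fixC; apply: sub.
have xC : x \in C by apply: sub; rewrite mem_head.
(* [edge_rank] needs a point that is moved; there is one because [e_gt0]. *)
have [x1 nx1] : exists x1, sg x x1 != x1.
  have : ~~ (#|X| <= #|fixpoints sg x|) by rewrite fixC // eE -ltnNge -[ltnLHS]addn0 ltn_add2l
    double_gt0.
  rewrite -cardsT => h.
  have : ~~ ([set: X] \subset fixpoints sg x) by apply: contra h => /subset_leq_card.
  by case/subsetPn => v _; rewrite inE => nv; exists v.
have xB : x \in B by rewrite inE mem_head.
have cov' s t : s \in B -> t \in B -> s != t -> m s t != None -> ((s, t) \in L) || ((t, s) \in L).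
  rewrite !inE => sB tB st mst; apply: cov; rewrite ?inE //.
  by rewrite /joined /= /cox_div (negPf st); case: (m s t) mst.
have r := edge_rank m_cox m_odd sg_ob closed_lift cov' fixB xB nx1.
have := card_Edges m_cox sg_ob fixB.
have -> : #|B| = (size p).+1 by rewrite cardsE; apply/card_uniqP.
rewrite card_Faces -/(fsum L) in r.
by rewrite eE addKn -doubleMr => /double_inj ->; rewrite -eE.
Qed.

(** The fundamental inequality: the number of points is eliminated between
    [rank_bound] and [fixpoints_bound]. *)
Lemma path_inequality x p L : {subset x :: p <= C} -> uniq (x :: p) ->
  (forall s t, s \in x :: p -> t \in x :: p -> joined m s t -> ((s, t) \in L) || ((t, s) \in L)) ->
  (size p).+1 * e + 1 <= e.*2 + psum (steps x p) + fsum L.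
Proof.
move=> sub un cov; have := rank_bound sub un cov; have := fixpoints_bound sub.
move: (#|X|) (#|_|) (psum _) (fsum _) ((size p).+1 * e); clear; lia.
Qed.

Lemma joinedxx s : joined m s s = false.
Proof. by rewrite /joined /= /cox_div eqxx. Qed.

Lemma path_inequality_perm l0 x p L : uniq l0 -> {subset l0 <= C} ->
  (forall s t, s \in l0 -> t \in l0 -> joined m s t -> ((s, t) \in L) || ((t, s) \in L)) ->
  perm_eq (x :: p) l0 -> (size p).+1 * e + 1 <= e.*2 + psum (steps x p) + fsum L.
Proof.
move=> un sub cov pe; apply: path_inequality.
- by move=> s; rewrite (perm_mem pe); apply: sub.
- by rewrite (perm_uniq pe).
- by move=> s t; rewrite !(perm_mem pe); apply: cov.
Qed.

Ltac perm_tac := let f := fresh in apply/permP => f /=;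
  repeat match goal with |- context [nat_of_bool (f ?x)] => move: (nat_of_bool (f x)) => ? end;
  clear; lia.
Ltac sums := rewrite /psum /fsum !big_cons !big_nil /=.

(** If the third edge is absent, one ordering is enough. Otherwise the three
    orderings of the triangle are averaged; a label at least 7 would improve the
    bound on its edge just enough for a contradiction. *)
Lemma triple_multiple a b c : a \in C -> b \in C -> c \in C -> a != c ->
  multiple_edge m a b -> multiple_edge m b c ->
  [/\ simple_edge m a c, cox_div m a b = Some 5 & cox_div m b c = Some 5].
Proof.
move=> aC bC cC ac mab mbc.
have ab := joined_neq (multiple_joined mab); have bc := joined_neq (multiple_joined mbc).
have Bab := multiple_bound aC bC mab; have Bbc := multiple_bound bC cC mbc.
have sub : {subset [:: a; b; c] <= C} by move=> s; rewrite !inE => /or3P[] /eqP ->.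
have un : uniq [:: a; b; c] by rewrite /= !inE negb_or ab ac bc.
have [jac|nac] := boolP (joined m a c); last first.
  have := @path_inequality_perm _ a [:: b; c] [:: (a, b); (b, c)] un sub _ (perm_refl _).
  sums => H; exfalso.
  suff : 3 * e + 1 <= e.*2 + (P a b + (P b c + 0)) + (F a b + (F b c + 0)) by clear -Bab Bbc; lia.
  apply: H => s t; rewrite !inE => /or3P[]/eqP-> /or3P[]/eqP->;
    by rewrite ?joinedxx ?(joinedC c a) ?(negPf nac) ?xpair_eqE ?eqxx ?orbT.
have cov s t : s \in [:: a; b; c] -> t \in [:: a; b; c] -> joined m s t ->
    ((s, t) \in [:: (a, b); (b, c); (a, c)]) || ((t, s) \in [:: (a, b); (b, c); (a, c)]).
  by rewrite !inE => /or3P[]/eqP-> /or3P[]/eqP->; rewrite ?joinedxx ?xpair_eqE ?eqxx ?orbT.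
have M x p := @path_inequality_perm _ x p [:: (a, b); (b, c); (a, c)] un sub cov.
have M1 := M a [:: b; c] (perm_refl _).
have M2 : 3 * e + 1 <= e.*2 + (P b c + (P c a + 0)) + (F a b + (F b c + (F a c + 0))).
  have := M b [:: c; a] _; sums; apply; perm_tac.
have M3 : 3 * e + 1 <= e.*2 + (P c a + (P a b + 0)) + (F a b + (F b c + (F a c + 0))).
  have := M c [:: a; b] _; sums; apply; perm_tac.
move: M1; sums => M1; rewrite (PC cC aC) in M2 M3.
case: (joined_cases jac) => [sac|mac]; last first.
  have Bac := multiple_bound aC cC mac; exfalso; clear -M1 M2 M3 Bab Bbc Bac; lia.
have Bac := simple_bound aC cC sac.
split=> //; apply/eqP; apply: contraT => n5; exfalso.
  have B7 := multiple_bound7 aC bC mab n5; clear -M1 M2 M3 Bab Bbc Bac B7; lia.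
have B7 := multiple_bound7 bC cC mbc n5; clear -M1 M2 M3 Bab Bbc Bac B7; lia.
Qed.

(** For a complete diagram on [a], [b], [c], [d] whose only multiple edges are the
    opposite ones [ab] and [cd], averaging orderings is not sharp enough: the
    following section bounds the points moved by [a] or [b] together with the
    cycles of the four simple edges through them. *)
Section Half.
Variables a b c d : S.
Hypotheses (aC : a \in C) (bC : b \in C)
  (mab : multiple_edge m a b) (sac : simple_edge m a c) (sbc : simple_edge m b c).

Definition moves s x : bool := sg s x != x.
Definition still x : bool := ~~ moves c x && ~~ moves d x.
Definition dihedral_moves x : bool := moves a x || moves b x.
(** The number of letters among [a], [b] that occur at [x] in a cycle with [c]
    or [d]; a cycle through [x] of one of the four simple edges is determined by
    such a letter and a similar one among [c], [d]. *)
Definition cycle_letters x : nat := (on_cycle sg a c x || on_cycle sg a d x) +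
  (on_cycle sg b c x || on_cycle sg b d x).
(** What a still point [x] moved by [s] borrows from its neighbour [s x] in the
    balance of [local_charge]. An end of an <a,b>-path has only one neighbour,
    from which it borrows 3; an interior point borrows 1 from each of its two
    neighbours. *)
Definition charge s t x : nat := if moves s x && still x then (if moves t x then 1 else 3) else 0.

Let sgK s : involutive (sg s). Proof. by move=> x; apply: (step_invol m_cox sg_ob). Qed.

Lemma moves_sg s x : moves s (sg s x) = moves s x.
Proof. by rewrite /moves sgK eq_sym. Qed.

Lemma on_cycle_moves s t x : on_cycle sg s t x -> [/\ moves s x, moves t x & moves t (sg s x)].
Proof.
move=> cx; have [/eqP h1 /eqP h2] := on_cycleP cx (connect0 _ _); split=> //.
have : connect (edge sg s t) x (sg s x) by apply: connect1; rewrite /edge eqxx.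
by case/(on_cycleP cx) => _ /eqP.
Qed.

(** The edge of colour [s] at [x] would be a path of <s,t> with two vertices,
    but paths have an odd number of vertices. *)
Lemma edge_end s t x : joined m s t -> moves s x -> moves t x || moves t (sg s x).
Proof.
move=> /joinedP[st [k mk _]] sx; apply: contraNT sx;
  rewrite negb_or !negbK => /andP[/eqP tx /eqP tsx].
have ts : t != s by rewrite eq_sym.
have mk' : m t s = Some k by rewrite (m_sym m_cox).
have cx : connect (edge sg t s) x (sg s x) by apply: connect1; rewrite /edge eqxx orbT.
have [j xj] := connect_fix m_cox m_odd sg_ob ts mk' tx cx.
by rewrite xj (fixed_unique m_cox m_odd sg_ob ts mk' tx) // -xj.
Qed.

(** Otherwise the path of <a,b> through [x] would have three vertices, fewer
    than the label of [ab]. *)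
Lemma no_short_path x : moves a x -> moves b x -> moves b (sg a x) || moves a (sg b x).
Proof.
move=> ax bx; apply/negPn; rewrite negb_or !negbK; apply/negP => /andP[/eqP h1 /eqP h2].
have [k [ab mk ck k5 kd]] := multiple_ge5 mab.
pose rho := rotation sg a b.
have r1 : rho x = sg b x by rewrite /rho /rotation h2.
have r2 : rho (sg b x) = sg a x by rewrite /rho /rotation sgK.
have r3 : rho (sg a x) = x by rewrite /rho /rotation h1 sgK.
have : rho x <> x by rewrite r1; apply/eqP.
move/(order_ge m_cox sg_ob mk kd); rewrite -/rho.
have : order rho x <= 3.
  apply: (@order_le_cycle _ rho [:: x; sg b x; sg a x]); last by rewrite mem_head.
  by rewrite /= /frel /= r1 r2 r3 !eqxx.
by move=> o3 /(leq_trans k5); rewrite leqNgt ltnS (leq_trans o3).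
Qed.

Lemma charge_arith (fa fb fab fba st sta stb ga gb : bool) :
  ga ==> [&& fa, ~~ st & ~~ sta] -> gb ==> [&& fb, ~~ st & ~~ stb] ->
  fa && st ==> ~~ sta -> fb && st ==> ~~ stb -> fa && fb ==> fab || fba ->
  8 * (fa || fb) + 6 * ((fa || fb) && st) + (ga + gb) * (ga + gb)
    + (if fa && sta then if fab then 1 else 3 else 0)
    + (if fb && stb then if fba then 1 else 3 else 0)
  <= 6 * fa + 6 * fb + 5 * (fa (+) fb)
    + (if fa && st then if fb then 1 else 3 else 0)
    + (if fb && st then if fa then 1 else 3 else 0).
Proof.
by case: fa; case: fb => //=; case: ga; case: gb => //=; case: st => //=;
  case: sta => //=; case: stb => //=; case: fab => //=; case: fba.
Qed.

(** At a still point the right hand side reaches the left one thanks to what is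
    borrowed. The neighbours of a still point are not still, so they do not
    borrow themselves, and a point whose two letters both belong to cycles has
    no still neighbours; by [no_short_path] the two neighbours of a point do not
    both borrow 3. *)
Lemma local_charge x :
  8 * dihedral_moves x + 6 * (dihedral_moves x && still x) + cycle_letters x * cycle_letters x
    + charge a b (sg a x) + charge b a (sg b x)
  <= 6 * moves a x + 6 * moves b x + 5 * (moves a x (+) moves b x) + charge a b x + charge b a x.
Proof.
have good_ st : on_cycle sg st c x || on_cycle sg st d x ==> [&& moves st x,
  ~~ still x & ~~ still (sg st x)].
  apply/implyP; rewrite /still.
  by case/orP => /on_cycle_moves[-> -> ->]; rewrite ?andbF.
have still_ s : simple_edge m s c -> moves s x && still x ==> ~~ still (sg s x).
  move=> sc; apply/implyP; rewrite /still => /andP[sx /andP[nc nd]].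
  by have := edge_end (simple_joined sc) sx; rewrite (negPf nc) /= => ->.
have ns : moves a x && moves b x ==> moves b (sg a x) || moves a (sg b x).
  by apply/implyP => /andP[]; apply: no_short_path.
rewrite /charge /cycle_letters /dihedral_moves !moves_sg.
exact: charge_arith (good_ a) (good_ b) (still_ a sac) (still_ b sbc) ns.
Qed.

(** Sum of [local_charge] over all points: what is borrowed cancels against what
    is lent, since [x |-> s x] permutes the points, and the term in the path
    ends is removed with [orbit_count] for the label 5. *)
Lemma half_count :
  6 * #|[set x | dihedral_moves x]| + 6 * #|[set x | dihedral_moves x && still x]|
    + \sum_x cycle_letters x * cycle_letters x + 20 * F a b <= 24 * e.
Proof.
have sgI s : injective (sg s) by exact: can_inj (@sgK s).
have sumb (f : pred X) : \sum_x (f x : nat) = #|[set x | f x]|.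
  by rewrite -sum1dep_card [RHS]big_mkcond; apply: eq_bigr => x _; case: (f x).
have sum_charge s t : \sum_x charge s t (sg s x) = \sum_x charge s t x.
  by rewrite [RHS](reindex_inj (sgI s)).
have moved s : s \in C -> \sum_x (moves s x : nat) = e.*2.
  move=> sC; rewrite sumb; have -> : [set x | moves s x] = ~: fixpoints sg s by apply/setP => x;
    rewrite !inE.
  by have := cardsC (fixpoints sg s); rewrite fixC // eE => /addnI.
have ends : \sum_x (moves a x (+) moves b x : nat) = 2 * P a b.
  rewrite mulSn mul1n {2}PC // /P sumb -[RHS]cardsUI.
  rewrite [_ :&: _](_ : _ = set0) ?cards0 ?addn0.
    by apply: eq_card => x; rewrite !inE /moves; case: (_ == _); case: (_ == _).
  by apply/setP => x; rewrite !inE; case: (_ == _); case: (_ == _).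
have {}local : \sum_x (dihedral_moves x * 8 + (dihedral_moves x && still x) * 6 +
      cycle_letters x * cycle_letters x + charge a b (sg a x) + charge b a (sg b x))
   <= \sum_x (moves a x * 6 + moves b x * 6 + (moves a x (+) moves b x) * 5
      + charge a b x + charge b a x).
  apply: leq_sum => x _; have := local_charge x.
  by rewrite -!(mulnC 8) -!(mulnC 6) -!(mulnC 5).
have sumM n (f : X -> nat) : \sum_x f x * n = (\sum_x f x) * n by rewrite big_distrl.
rewrite !big_split /= !sumM !sum_charge ends !moved // !sumb in local.
have [k [ab mk ck k5 kd]] := multiple_ge5 mab.
have := orbit_count m_cox m_odd sg_ob no_double ab mk (fun j j1 jk => leq_trans k5 (kd j j1 jk)).
have : #|[set x | dihedral_moves x]| + #|fixpoints sg a :&: fixpoints sg b| = #|X|.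
  rewrite addnC -(cardsC (fixpoints sg a :&: fixpoints sg b)); congr (_ + #|pred_of_set _|).
  by apply/setP => x; rewrite !inE negb_and.
rewrite -/(P a b) -/(F a b); move: local.
move: (#|[set x | dihedral_moves x]|) (#|[set x | _ &&
  _]|) (bigop _ _ _) (bigop _ _ _) (bigop _ _ _) (P a b) (F a b) (#|_|) (#|X|).
clear; move=> n1 n2 n3 n4 n5 n6 n7 n8 n9; lia.
Qed.

End Half.

Lemma k4_arith V A1 A2 B1 B2 T n g1 g2 f1 f2 f3 f4 f5 f6 c1 c2 c3 c4 :
  V = A1 + (B2 + T) -> V = B1 + (A2 + T) ->
  4 * n + T + 1 <= V + (f1 + (f2 + (f3 + (f4 + (f5 + (f6 + 0)))))) ->
  6 * A1 + 6 * A2 + g1 + 20 * f1 <= 24 * n -> 6 * B1 + 6 * B2 + g2 + 20 * f2 <= 24 * n ->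
  (c1 + c2 + c3 + c4) * 2 <= g1 + g2 ->
  6 * f3 <= c1 -> 6 * f4 <= c2 -> 6 * f5 <= c3 -> 6 * f6 <= c4 -> False.
Proof. clear; lia. Qed.

(** At each point, the cycles of the four simple edges number at most the
    product [p q] of the two values of [cycle_letters], hence
    [2 p q <= p^2 + q^2] lets both instances of [half_count] pay for them; this
    exceeds what [rank_bound] allows. *)
Lemma no_simple_quadrangle a b c d : {subset [:: a; b; c; d] <= C} -> uniq [:: a; b; c; d] ->
  multiple_edge m a b -> multiple_edge m c d ->
  simple_edge m a c -> simple_edge m a d -> simple_edge m b c -> simple_edge m b d -> False.
Proof.
move=> sub un mab mcd sac sad sbc sbd.
have [aC bC cC dC] : [/\ a \in C, b \in C, c \in C & d \in C].
  by split; apply: sub; rewrite !inE eqxx ?orbT.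
pose L := [:: (a, b); (c, d); (a, c); (a, d); (b, c); (b, d)].
have cov s t : s \in [:: a; b; c; d] -> t \in [:: a; b; c; d] -> joined m s t ->
    ((s, t) \in L) || ((t, s) \in L).
  by rewrite !inE => /or4P[]/eqP-> /or4P[]/eqP->; rewrite ?joinedxx ?xpair_eqE ?eqxx ?orbT.
have R := rank_bound sub un cov.
have H1 := @half_count a b c d aC bC mab sac sbc.
have sca : simple_edge m c a by rewrite simpleC.
have sda : simple_edge m d a by rewrite simpleC.
have H2 := @half_count c d a b cC dC mcd sca sda.
have cross s t : s \in C -> t \in C -> simple_edge m s t -> 6 * F s t <= #|cycle_points sg s t|.
  move=> sC tC st; have /joinedP[neq [k mk ck]] := simple_joined st.
  have [_ _ _ kd] := label_bound neq mk ck; move: st; rewrite /simple_edge /= ck => /eqP[p3].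
  by rewrite p3 in kd; apply: (cycle_count m_cox m_odd sg_ob no_double neq mk kd).
have sumb (f : pred X) : \sum_x (f x : nat) = #|[set x | f x]|.
  by rewrite -sum1dep_card [RHS]big_mkcond; apply: eq_bigr => x _; case: (f x).
have G : (#|cycle_points sg a c| + #|cycle_points sg a d| + #|cycle_points sg b c| +
  #|cycle_points sg b d|) * 2
   <= \sum_x cycle_letters a b c d x * cycle_letters a b c d x
    + \sum_x cycle_letters c d a b x * cycle_letters c d a b x.
  rewrite -!sumb -!big_split big_distrl /=; apply: leq_sum => x _.
  rewrite /cycle_letters (on_cycleC sg c a) (on_cycleC sg c b) (on_cycleC sg d a) (on_cycleC sg d
    b).
  by case: (on_cycle sg a c x); case: (on_cycle sg a d x); case: (on_cycle sg b c x);
    case: (on_cycle sg b d x).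
have K1 := cross _ _ aC cC sac; have K2 := cross _ _ aC dC sad.
have K3 := cross _ _ bC cC sbc; have K4 := cross _ _ bC dC sbd.
have split4 s t u v : [:: s; t; u; v] =i [:: a; b; c; d] ->
   #|X| = #|[set x | dihedral_moves s t x]| + (#|[set x | dihedral_moves u v x && still s t x]|
    + #|common_fixpoints sg [set s in [:: a; b; c; d]]|).
  move=> e4; rewrite -(cardsC [set x | dihedral_moves s t x]); congr (_ + _).
  rewrite -(cardsID [set x | dihedral_moves u v x]); congr (_ + _); apply: eq_card => x.
    by rewrite !inE /dihedral_moves /still negb_or andbC.
  rewrite !inE /dihedral_moves !negb_or /moves !negbK; apply/idP/forall_inP.
    move=> /andP[/andP[u0 v0] /andP[s0 t0]] w; rewrite inE -e4 !inE.
    by case/or4P => /eqP ->.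
  by move=> h; do ?[apply/andP; split]; apply: h; rewrite inE -e4 !inE eqxx ?orbT.
have V1 := split4 a b c d (fun _ => erefl).
have V2 := split4 c d a b (mem_rot 2 [:: a; b; c; d]).
move: R H1 H2 G K1 K2 K3 K4; rewrite /fsum /L !big_cons big_nil /= -/(F a b) -/(F c d).
exact: k4_arith V1 V2.
Qed.

(** With four vertices the inequality is taken for several orderings, chosen so that
    their sum contradicts the bounds for the separate edges. *)
Section Quad.
Variables a b c d : S.
Hypotheses (sub : {subset [:: a; b; c; d] <= C}) (un : uniq [:: a; b; c; d]).

(** [F], except that pairs with an absent edge do not count, so that one
    inequality serves all the diagrams. *)
Definition Fj s t := if joined m s t then F s t else 0.

Lemma path_inequality4 x y z w : perm_eq [:: x; y; z; w] [:: a; b; c; d] ->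
  4 * e + 1 <= e.*2 + P x y + P y z + P z w + (Fj a b + Fj a c + Fj a d + Fj b c + Fj b d + Fj c d).
Proof.
move=> pe; pose six := [:: (a, b); (a, c); (a, d); (b, c); (b, d); (c, d)].
pose L := [seq q <- six | joined m q.1 q.2].
have cov s t : s \in [:: a; b; c; d] -> t \in [:: a; b; c; d] -> joined m s t ->
   ((s, t) \in L) || ((t, s) \in L).
  move=> sI tI st; have neq := joined_neq st.
  have ts : joined m t s by rewrite joinedC.
  rewrite !mem_filter [joined m (s, t).1 _]st [joined m (t, s).1 _]ts !andTb.
  move: neq; rewrite /six; move: sI tI; rewrite !inE.
  by move=> /or4P[]/eqP-> /or4P[]/eqP->; rewrite ?xpair_eqE ?eqxx ?orbT.
have := @path_inequality_perm _ x [:: y; z; w] _ un sub cov pe; rewrite /fsum big_filter big_mkcond.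
rewrite /psum !big_cons !big_nil /= -!/(Fj _ _).
move: (P x y) (P y z) (P z w) (Fj a b) (Fj a c) (Fj a d) (Fj b c) (Fj b d) (Fj c d); clear; lia.
Qed.

Let aC : a \in C. Proof. by apply: sub; rewrite !inE eqxx ?orbT. Qed.
Let bC : b \in C. Proof. by apply: sub; rewrite !inE eqxx ?orbT. Qed.
Let cC : c \in C. Proof. by apply: sub; rewrite !inE eqxx ?orbT. Qed.
Let dC : d \in C. Proof. by apply: sub; rewrite !inE eqxx ?orbT. Qed.

Lemma Fj_simple s t : s \in C -> t \in C -> simple_edge m s t -> P s t + 3 * Fj s t <= e.
Proof. by move=> sC tC st; rewrite /Fj (simple_joined st); apply: simple_bound. Qed.

Lemma Fj_multiple s t : s \in C -> t \in C -> multiple_edge m s t -> 2 * P s t + 5 * Fj s t <= e.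
Proof. by move=> sC tC st; rewrite /Fj (multiple_joined st); apply: multiple_bound. Qed.

Lemma Fj_absent s t : ~~ joined m s t -> Fj s t = 0.
Proof. by rewrite /Fj => /negPf ->. Qed.

Ltac quad x y z w H := have H := @path_inequality4 x y z w ltac:(perm_tac);
  rewrite ?(PC bC aC) ?(PC cC aC) ?(PC dC aC) ?(PC cC bC) ?(PC dC bC) ?(PC dC cC) in H.

Ltac gen_lia :=
  move: (P a b) (P a c) (P a d) (P b c) (P b d) (P c d)
    (Fj a b) (Fj a c) (Fj a d) (Fj b c) (Fj b d) (Fj c d); clear; lia.

(** Three multiple edges at [b]; by [triple_multiple] the other edges are simple
    in the only case of interest. *)
Lemma no_multiple_claw : multiple_edge m a b -> multiple_edge m b c -> multiple_edge m b d ->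
  simple_edge m a c -> simple_edge m a d -> simple_edge m c d -> False.
Proof.
move=> /(Fj_multiple aC bC) h1 /(Fj_multiple bC cC) h2 /(Fj_multiple bC dC) h3.
move=> /(Fj_simple aC cC) h4 /(Fj_simple aC dC) h5 /(Fj_simple cC dC) h6.
quad a b c d M1; quad c b d a M2; quad d b a c M3.
move: h1 h2 h3 h4 h5 h6 M1 M2 M3; gen_lia.
Qed.

Lemma no_multiple_path : multiple_edge m a b -> multiple_edge m b c -> multiple_edge m c d -> False.
Proof.
move=> mab mbc mcd.
have [ac bd] : a != c /\ b != d.
  by move: un; rewrite /= !inE !negb_or => /and3P[/and3P[_ -> _] /andP[_ ->]].
have [sac _ _] := triple_multiple aC bC cC ac mab mbc.
have [sbd _ _] := triple_multiple bC cC dC bd mbc mcd.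
move: mab mbc mcd sac sbd.
move=> /(Fj_multiple aC bC) h1 /(Fj_multiple bC cC) h2 /(Fj_multiple cC dC) h3.
move=> /(Fj_simple aC cC) h4 /(Fj_simple bC dC) h5.
quad a b c d M1; quad a c b d M2; quad a b d c M3; quad b a c d M4.
quad c a d b M5; quad d a b c M6; quad b c d a M7.
move: h1 h2 h3 h4 h5 M1 M2 M3 M4 M5 M6 M7.
have [jad|nad] := boolP (joined m a d); last by rewrite (Fj_absent nad); gen_lia.
case: (joined_cases jad) => [/(Fj_simple aC dC)|/(Fj_multiple aC dC)]; gen_lia.
Qed.

(** The inequalities suffice as soon as one of the edges [ac], [ad], [bd] is
    absent; if they are all present, [no_simple_quadrangle] applies. *)
Lemma cross_simple : multiple_edge m a b -> multiple_edge m c d -> simple_edge m b c ->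
  ~~ multiple_edge m a c -> ~~ multiple_edge m a d -> ~~ multiple_edge m b d -> False.
Proof.
move=> mab mcd sbc nac nad nbd.
have cases s t : ~~ multiple_edge m s t -> joined m s t -> simple_edge m s t.
  by move=> /negPf nm /joined_cases[]//; rewrite nm.
have h1 := Fj_multiple aC bC mab; have h2 := Fj_multiple cC dC mcd; have h3 := Fj_simple bC cC sbc.
quad a b c d M1; quad b a c d M2; quad a b d c M3; quad b a d c M4.
have bnd s t : s \in C -> t \in C -> ~~ multiple_edge m s t -> Fj s t = 0 \/ P s t +
  3 * Fj s t <= e.
  move=> sC tC nst; have [jst|/Fj_absent] := boolP (joined m s t); last by left.
  by right; apply: Fj_simple => //; apply: cases.
have := bnd a c aC cC nac; have := bnd a d aC dC nad; have := bnd b d bC dC nbd.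
move: h1 h2 h3 M1 M2 M3 M4.
have [jac|/Fj_absent ->] := boolP (joined m a c); last by gen_lia.
have [jad|/Fj_absent ->] := boolP (joined m a d); last by gen_lia.
have [jbd|/Fj_absent ->] := boolP (joined m b d); last by gen_lia.
by move=> *; apply: (@no_simple_quadrangle a b c d) => //; apply: cases.
Qed.
End Quad.

Lemma no_joined_multiple_edges a b c d : {subset [:: a; b; c; d] <= C} -> uniq [:: a; b; c; d] ->
  multiple_edge m a b -> multiple_edge m c d -> joined m b c -> False.
Proof.
move=> sub un mab mcd jbc.
have sub' x y z w : perm_eq [:: x; y; z; w] [:: a; b; c; d] -> {subset [:: x; y; z; w] <= C}.
  by move=> pe s; rewrite (perm_mem pe); apply: sub.
have un' x y z w : perm_eq [:: x; y; z; w] [:: a; b; c; d] -> uniq [:: x; y; z; w].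
  by move=> pe; rewrite (perm_uniq pe).
have [mac|nac] := boolP (multiple_edge m a c).
  have pe : perm_eq [:: b; a; c; d] [:: a; b; c; d] by perm_tac.
  by apply: (no_multiple_path (sub' _ _ _ _ pe) (un' _ _ _ _ pe)) => //; rewrite multipleC.
have [mad|nad] := boolP (multiple_edge m a d).
  have pe : perm_eq [:: b; a; d; c] [:: a; b; c; d] by perm_tac.
  by apply: (no_multiple_path (sub' _ _ _ _ pe) (un' _ _ _ _ pe)) => //; rewrite multipleC.
have [mbd|nbd] := boolP (multiple_edge m b d).
  have pe : perm_eq [:: a; b; d; c] [:: a; b; c; d] by perm_tac.
  by apply: (no_multiple_path (sub' _ _ _ _ pe) (un' _ _ _ _ pe)) => //; rewrite multipleC.
case: (joined_cases jbc) => [sbc|mbc]; first exact: (cross_simple sub un mab mcd).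
exact: (no_multiple_path sub un mab mbc mcd).
Qed.

Lemma steps_rcons x p y : steps x (rcons p y) = rcons (steps x p) (last x p, y).
Proof. by elim: p x => //= z p IH x; rewrite IH. Qed.

Lemma chain_sum x p : {subset x :: p <= C} -> path (joined m) x p ->
  psum (steps x p) + 2 * fsum (steps x p) <= size p * e.
Proof.
elim: p x => [|y p IH] x sub; first by rewrite /psum /fsum !big_nil.
move=> /= /andP[xy yp].
have xC : x \in C by apply: sub; rewrite mem_head.
have yC : y \in C by apply: sub; rewrite !inE eqxx orbT.
have := IH y (fun z h => sub z (mem_behead (s := x :: y :: p) h)) yp.
rewrite /psum /fsum !big_cons /=.
have : P x y + 2 * F x y <= e.
  case: (joined_cases xy) => [/(simple_bound xC yC)|/(multiple_bound xC yC)];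
    rewrite -/(P x y) -/(F x y);
    move: (P x y) (F x y); clear; lia.
move: (P x y) (F x y) (bigop _ _ _) (bigop _ _ _) => n1 n2 n3 n4; rewrite (mulSn (size p));
  move: (size p * e); clear; lia.
Qed.

(** The two multiple edges at the ends of the chain contribute only half as much
    as the others. *)
Lemma double_chain x y p z w : {subset x :: y :: rcons (rcons p z) w <= C} ->
  multiple_edge m x y -> path (joined m) y (rcons p z) -> multiple_edge m z w ->
  psum (steps x (y :: rcons (rcons p z) w)) + 2 * fsum (steps x (y :: rcons (rcons p z) w))
    <= (size p).+2 * e.
Proof.
move=> sub mxy yp mzw.
have inC u : u \in x :: y :: rcons (rcons p z) w -> u \in C by apply: sub.
have [xC yC zC wC] : [/\ x \in C, y \in C, z \in C & w \in C].
  by split; apply: inC; rewrite !(inE, mem_rcons) eqxx ?orbT.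
have := multiple_bound xC yC mxy; have := multiple_bound zC wC mzw.
have := @chain_sum y (rcons p z) _ yp; rewrite size_rcons.
have -> : steps x (y :: rcons (rcons p z) w) = (x, y) :: rcons (steps y (rcons p z)) (z, w).
  by rewrite /= steps_rcons last_rcons.
rewrite /psum /fsum !big_cons !big_rcons /= -!/(P _ _) -!/(F _ _).
have sub2 : {subset y :: rcons p z <= C}.
  by move=> u h; apply: inC; rewrite inE -rcons_cons mem_rcons inE h !orbT.
move=> /(_ sub2).
rewrite !(mulSn (size p).+1) !(mulSn (size p)).
move: (P x y) (F x y) (P z w) (F z w) (bigop _ _ _) (bigop _ _ _) (size p * e); clear; lia.
Qed.

(** An edge between vertices of the path that are not consecutive would be a
    shortcut. *)
Lemma shortest_path_induced b p : path (joined m) b p ->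
  (forall p', path (joined m) b p' -> last b p' = last b p -> {subset p' <= p} ->
    size p <= size p') ->
  forall s t, s \in b :: p -> t \in b :: p -> joined m s t ->
  ((s, t) \in steps b p) || ((t, s) \in steps b p).
Proof.
elim: p b => [|y p IH] b /= => [_ _ s t|/andP[bY yp] short s t].
  by rewrite !inE => /eqP -> /eqP ->; rewrite joinedxx.
have shorty p' : path (joined m) y p' -> last y p' = last y p -> {subset p' <= p} ->
  size p <= size p'.
  move=> pp lp sp; rewrite -ltnS; apply: (short (y :: p')) => //=; first by rewrite bY.
  by move=> z; rewrite !inE => /orP[->//|/sp ->]; rewrite orbT.
have fromb z : z \in y :: p -> joined m b z -> z = y.
  rewrite inE => /orP[/eqP//|zp]; clear IH shorty; move: short yp.
  case/splitPr: zp => p1 p2 short.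
  rewrite cat_path /= => /and3P[_ _ zp] bz.
  have := short (z :: p2); rewrite /= bz zp last_cat /= => /(_ isT erefl).
  rewrite size_cat /= => H; have {}H : (size p1 + (size p2).+1).+1 <= (size p2).+1.
    by apply: H => u; rewrite !inE mem_cat inE => /orP[->|->]; rewrite !orbT.
  by exfalso; move: H; clear; lia.
have tail u v : u \in y :: p -> v \in y :: p -> joined m u v ->
    ((u, v) \in (b, y) :: steps y p) || ((v, u) \in (b, y) :: steps y p).
  by move=> uI vI uv; rewrite !inE; have /orP[->|->] := IH y yp shorty u v uI vI uv; rewrite !orbT.
rewrite inE => /orP[/eqP ->|sI]; rewrite inE => /orP[/eqP ->|tI].
- by rewrite joinedxx.
- by move/(fromb t tI) ->; rewrite mem_head.
- by rewrite joinedC => /(fromb s sI) ->; rewrite mem_head orbT.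
exact: tail.
Qed.

(** Choose the path [p] from [b] to its end [c] as short as possible; if it is a
    single edge, [no_joined_multiple_edges] applies. Otherwise the edges among
    [a :: b :: p] and [d] are those of the path, possibly with one more from [a]
    to the second vertex of the path [b :: p], and one more from [d] to the last
    but one. [T1] orders the vertices along the path; [T2] does so after
    exchanging [a] with [b], or [c] with [d], wherever such an additional edge
    is present, so that consecutive pairs of [T1] and [T2] cover all edges. The
    sum of the two instances of [path_inequality] contradicts [double_chain]. *)
Lemma no_connecting_path a b p d : {subset [:: a, b, d & p] <= C} ->
  multiple_edge m a b -> multiple_edge m (last b p) d -> path (joined m) b p ->
  a != last b p -> a != d -> b != last b p -> b != d -> False.
Proof.
have [n] := ubnP (size p); elim: n a b p d => // n IH a b p0 d.
rewrite ltnS => pn sub mab mcd pp0; move: mcd.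
have := sub; have := pn; case/shortenP: pp0 => p pp up sp {}pn {}sub mcd ac ad bc bd.
have {}sp : {subset p <= p0} by exact: sp.
have {}pn : size p <= n by apply: leq_trans pn; apply: uniq_leq_size => //; case/andP: up.
have {p0 sp}sub : {subset [:: a, b, d & p] <= C}.
  by move=> u; rewrite !inE => h; apply: sub; rewrite !inE; case/or4P: h => [->|->|->|/sp ->];
    rewrite ?orbT.
have [aC bC dC] : [/\ a \in C, b \in C & d \in C] by split; apply: sub; rewrite !inE eqxx ?orbT.
have pC u : u \in p -> u \in C by move=> h; apply: sub; rewrite !inE h !orbT.
have mba : multiple_edge m b a by rewrite multipleC.
have ab := joined_neq (multiple_joined mab).
set c := last b p in mcd ac bc.
have cd := joined_neq (multiple_joined mcd).
have mdc : multiple_edge m d c by rewrite multipleC.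
have cC : c \in C.
  by rewrite /c; case: (p) pC => [|y q] pC //=; apply: pC; apply: mem_last.
have {}IH a' b' p' d' : size p' < size p -> a' \in C -> b' \in C -> d' \in C ->
    {subset p' <= C} -> multiple_edge m a' b' -> path (joined m) b' p' ->
    multiple_edge m (last b' p') d' ->
    a' != last b' p' -> a' != d' -> b' != last b' p' -> b' != d' -> False.
  move=> lt a'C b'C d'C p'C m1 pp' m2; apply: (IH a' b' p' d') => //; first exact: leq_trans lt pn.
  by move=> u; rewrite !inE => /or4P[/eqP->|/eqP->|/eqP->|/p'C].
have neq_sym (u v : S) : u != v -> v != u by rewrite eq_sym.
(* Minimality of the path: each of the following facts holds because a shorter
   path would connect two disjoint multiple edges. *)
have a_notin : a \notin p.
  apply/negP => ap; move: (pp) (pC) IH; rewrite /c in ac bc mcd mdc cC *; move: ac bc mcd.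
  case/splitPr: ap => p1 p2; rewrite last_cat cat_path /= => ac' bc' m2 /and3P[_ _ pa] p2C IH.
  apply: (IH b a p2 d) => //; first by rewrite size_cat /=; clear; lia.
  by move=> u up2; apply: p2C; rewrite mem_cat inE up2 !orbT.
have d_notin : d \notin p.
  apply/negP => dp; have dc := neq_sym _ _ cd.
  have := pp; have := pC; have := IH; have : last b p = c by [].
  case/splitPr: dp => p1 p2; case: p2 => [|u p2].
    by rewrite last_cat /= => dE; rewrite dE eqxx in cd.
  move=> _ {}IH p2C; rewrite cat_path /= => /and3P[p1p dd _].
  apply: (IH a b (rcons p1 d) c) => //; rewrite ?last_rcons ?rcons_path ?p1p //.
    by rewrite size_cat size_rcons /=; clear; lia.
  by move=> v; rewrite mem_rcons inE => h; apply: p2C; rewrite mem_cat inE; case/orP: h => ->;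
    rewrite ?orbT.
have geo : forall s t, s \in b :: p -> t \in b :: p -> joined m s t ->
    ((s, t) \in steps b p) || ((t, s) \in steps b p).
  apply: shortest_path_induced => // p' pp' lp' sp'; rewrite leqNgt; apply/negP => lt.
  apply: (IH a b p' d) => //; rewrite ?lp' //; first by move=> u /sp'; apply: pC.
have [mid ep] : exists mid, p = rcons mid c.
  move: bc; rewrite /c; case: (p) => [|x q] /=; first by rewrite eqxx.
  by exists (belast x q); rewrite lastI.
case: mid ep => [|y mid] ep.
  apply: (@no_joined_multiple_edges a b c d) => //.
  - by move=> u; rewrite !inE => /or4P[]/eqP->.
  - by rewrite /= !inE !negb_or ab ac ad bc bd cd.
  by move: pp; rewrite ep /= andbT.
have lt1 : 1 < size p by rewrite ep /= size_rcons.
have a_far z : z \in rcons mid c -> ~~ joined m a z.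
  move=> zp; apply/negP => az; move: pp pC IH (erefl (last b p)).
  rewrite {1 2 3 4}ep /= -/c; case/splitPr: zp => q1 q2 /=.
  rewrite cat_path /= last_cat /= => /and4P[_ _ _ zq] q2C {}IH lc.
  apply: (IH b a (z :: q2) d); rewrite /= ?lc ?az //.
    by rewrite size_cat /=; clear; lia.
  by move=> u h; apply: q2C; rewrite inE mem_cat h !orbT.
have a_d : ~~ joined m a d.
  by apply/negP => jad; apply: (IH b a [:: d] c); rewrite /= ?jad // => u; rewrite inE => /eqP ->.
have [q [r eqr]] : exists q r, y :: mid = rcons q r.
  by exists (belast y mid), (last y mid); rewrite lastI.
have er : last y mid = r by have := congr1 (last y) eqr; rewrite last_rcons.
have d_far z : z \in b :: q -> ~~ joined m z d.
  rewrite inE => /orP[/eqP->|zq]; apply/negP => zd.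
    by apply: (IH a b [:: d] c); rewrite /= ?zd // => u; rewrite inE => /eqP ->.
  move: pp pC IH; rewrite ep eqr; clear -zq zd mab mdc aC bC cC dC ac ad bc bd;
    case/splitPr: zq => q1 q2.
  rewrite !rcons_cat /= cat_path /= => /and3P[p1 pz _] q2C {}IH.
  apply: (IH a b (rcons (rcons q1 z) d) c); rewrite ?last_rcons //.
  - by rewrite size_cat /= !size_rcons; clear; lia.
  - move=> u; rewrite !(mem_rcons, inE) => /or3P[/eqP-> //|/eqP->|h]; apply: q2C.
      by rewrite mem_cat mem_head orbT.
    by rewrite mem_cat h.
  by rewrite !rcons_path last_rcons p1 pz zd.
pose h := if joined m a y then (b, a) else (a, b).
pose t := if joined m r d then (d, c) else (c, d).
pose T1 := a :: b :: rcons (rcons (y :: mid) c) d.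
pose T2 := h.1 :: h.2 :: rcons (rcons (y :: mid) t.1) t.2.
have eT1 : T1 = a :: b :: rcons p d by rewrite ep.
have h_edge : multiple_edge m h.1 h.2 by rewrite /h; case: ifP.
have t_edge : multiple_edge m t.1 t.2 by rewrite /t; case: ifP.
have [by_ pmid rc] : [/\ joined m b y, path (joined m) y mid & joined m r c].
  by move: pp; rewrite ep /= rcons_path er => /and3P[].
have hy : joined m h.2 y by rewrite /h; case: ifP.
have rt : joined m r t.1 by rewrite /t; case: ifP.
have T1C : {subset T1 <= C}.
  move=> u; rewrite eT1 !(inE, mem_rcons).
  by case/or4P => [/eqP->|/eqP->|/eqP->|/pC].
have T12 : perm_eq T2 T1.
  apply/permP => f; rewrite /T1 /T2 /= -!cats1 !count_cat /=.
  by rewrite /h /t; case: ifP; case: ifP => _ _ /=; clear; lia.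
have uT1 : uniq T1.
  move: up; rewrite eT1 /= => /andP[bp upp].
  by rewrite !(inE, mem_rcons) rcons_uniq !negb_or ab ad a_notin bd bp d_notin upp.
pose L := steps a (behead T1) ++ steps h.1 (behead T2).
have inL1 x : x \in steps b p -> x \in L.
  by move=> h1; rewrite mem_cat eT1 /= steps_rcons inE mem_rcons inE h1 !orbT.
have ab_L : (a, b) \in L by rewrite mem_cat eT1 /= mem_head.
have cd_L : (c, d) \in L by rewrite mem_cat eT1 /= steps_rcons inE mem_rcons mem_head !orbT.
have hy_L : (h.2, y) \in L by rewrite mem_cat /= !inE eqxx !orbT.
have rt_L : (r, t.1) \in L.
  rewrite mem_cat /= !steps_rcons er; apply/orP; right.
  by rewrite !(inE, mem_rcons) eqxx !orbT.
have a_cov u : u \in T1 -> joined m a u -> (a, u) \in L.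
  rewrite eT1 inE => /orP[/eqP->|]; first by rewrite joinedxx.
  rewrite inE => /orP[/eqP->//|]; rewrite mem_rcons inE => /orP[/eqP->|].
    by rewrite (negPf a_d).
  rewrite ep inE => /orP[/eqP->|/a_far/negPf->//] jay.
  by move: hy_L; rewrite /h jay.
have d_cov u : u \in T1 -> joined m u d -> (u, d) \in L.
  rewrite eT1 inE => /orP[/eqP->|]; first by rewrite (negPf a_d).
  rewrite inE => /orP[/eqP->|].
    by move=> bd'; have := d_far b (mem_head _ _); rewrite bd'.
  rewrite mem_rcons inE => /orP[/eqP->|]; first by rewrite joinedxx.
  rewrite ep eqr !(mem_rcons, inE) => /or3P[/eqP->//|/eqP->|uq] jud.
    by move: rt_L; rewrite /t jud.
  by have := d_far u; rewrite inE uq orbT jud => /(_ isT).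
have cov u v : u \in T1 -> v \in T1 -> joined m u v -> ((u, v) \in L) || ((v, u) \in L).
  move=> uT vT uv.
  have [ua|ua] := eqVneq u a; first by subst u; rewrite a_cov.
  have [va|va] := eqVneq v a; first by subst v; rewrite (a_cov u) ?orbT // joinedC.
  have [ud|ud] := eqVneq u d; first by subst u; rewrite (d_cov v) ?orbT // joinedC.
  have [vd|vd] := eqVneq v d; first by subst v; rewrite d_cov.
  have mid_in w : w \in T1 -> w != a -> w != d -> w \in b :: p.
    by rewrite eT1 !(inE, mem_rcons) => wT /negPf wa /negPf wd; move: wT; rewrite wa wd.
  have /orP[/inL1->//|/inL1->] := geo u v (mid_in u uT ua ud) (mid_in v vT va vd) uv.
  by rewrite orbT.
have T2C : {subset T2 <= C} by move=> u; rewrite (perm_mem T12); apply: T1C.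
have M1 := path_inequality T1C uT1 cov; have M2 := path_inequality_perm uT1 T1C cov T12.
have pb : path (joined m) b (rcons (y :: mid) c) by rewrite -ep.
have ph : path (joined m) h.2 (rcons (y :: mid) t.1).
  by rewrite /= hy rcons_path pmid er rt.
have D1 := double_chain T1C mab pb mcd; have D2 := double_chain T2C h_edge ph t_edge.
have fL : fsum L = fsum (steps a (behead T1)) + fsum (steps h.1 (behead T2)).
  by rewrite /fsum big_cat.
move: M1 M2 D1 D2; rewrite fL /= !size_rcons.
rewrite !(mulSn (size mid).+4) !(mulSn (size mid).+3) !(mulSn (size mid).+2).
move: (psum _) (psum _) (fsum _) (fsum _) ((size mid).+2 * e) ; clear; lia.
Qed.

Hypotheses (C_connect : {in C &, forall x y, connect (joined m) x y})
  (C_closed : forall x y, x \in C -> joined m x y -> y \in C).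

Lemma path_in x p : x \in C -> path (joined m) x p -> {subset p <= C}.
Proof.
elim: p x => //= y p IH x xC /andP[xy yp] z; have yC := C_closed xC xy.
by rewrite inE => /orP[/eqP->//|]; apply: IH yp z.
Qed.

Lemma multiple_edges_meet a b c d : a \in C -> b \in C -> c \in C -> d \in C ->
  multiple_edge m a b -> multiple_edge m c d ->
  a != c -> a != d -> b != c -> b != d -> False.
Proof.
move=> aC bC cC dC mab mcd ac ad bc bd.
have /connectP[p bp ep] := C_connect bC cC.
apply: (@no_connecting_path a b p d) => //; rewrite -?ep //.
by move=> u; rewrite !inE => /or4P[/eqP->|/eqP->|/eqP->|/(path_in bC bp)].
Qed.

(** Any other multiple edge meets both [ab] and [bc] by [multiple_edges_meet];
    it either passes through [b], forming a claw with them, or is [ac], which is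
    simple. *)
Lemma adjacent_type3 a b c : a \in C -> b \in C -> c \in C -> a != c ->
  multiple_edge m a b -> multiple_edge m b c -> component_type3 m C.
Proof.
move=> aC bC cC ac mab mbc.
have [sac ab5 bc5] := triple_multiple aC bC cC ac mab mbc.
have ab := joined_neq (multiple_joined mab); have bc := joined_neq (multiple_joined mbc).
pose D : {set S} := [set a; b; c].
have inD u : (u \in D) = [|| u == a, u == b | u == c] by rewrite !inE -orbA.
exists D; split.
- by apply/subsetP => u; rewrite inD => /or3P[] /eqP ->.
- by rewrite /D -setUA cardsU1 cards2 !inE negb_or ab ac bc.
- by exists a, b, c; split=> //; apply/eqP.
move=> s t sC tC jst; apply: contraNT => nst.
have {jst nst}mst : multiple_edge m s t by case: (joined_cases jst) => // h; rewrite h in nst.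
have mts : multiple_edge m t s by rewrite multipleC.
have third d : d \in C -> d \notin D -> multiple_edge m b d -> False.
  move=> dC; rewrite inD !negb_or => /and3P[da db dc] mbd.
  have [ad cd] : a != d /\ c != d by rewrite eq_sym da eq_sym dc.
  have [sad _ _] := triple_multiple aC bC dC ad mab mbd.
  have mcb : multiple_edge m c b by rewrite multipleC.
  have [scd _ _] := triple_multiple cC bC dC cd mcb mbd.
  apply: (@no_multiple_claw a b c d) => //; first by move=> u; rewrite !inE => /or4P[] /eqP ->.
  by rewrite /= !inE !negb_or ab ac ad bc cd eq_sym db.
have [sb|sb] := eqVneq s b.
  subst s; have [_|nt] := boolP (t \in D); first by rewrite inD eqxx orbT.
  by case: (third t).
have [tb|tb] := eqVneq t b.
  subst t; have [_|ns] := boolP (s \in D); first by rewrite inD eqxx orbT.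
  by case: (third s).
have sta : (s == a) || (t == a).
  apply/norP => -[sa ta]; apply: (@multiple_edges_meet s t a b) => //.
have stc : (s == c) || (t == c).
  apply/norP => -[sc tc]; apply: (@multiple_edges_meet s t b c) => //.
rewrite !inD; case/orP: sta stc => /eqP e1; case/orP => /eqP e2; subst; rewrite ?eqxx ?orbT //.
  by rewrite eqxx in ac.
by rewrite eqxx in ac.
Qed.

(** Two distinct multiple edges must share a vertex. *)
Lemma component_types : component_type2 m C \/ component_type3 m C.
Proof.
have [le|gt] := leqP #|multiple_edges m C| 1; first by left.
right; case/card_gt1P: gt => E1 [E2 [/imsetP[[a b] +] ->] /imsetP[[c d] + ->]].
rewrite !inE /= => /and3P[aC bC mab] /and3P[cC dC mcd] neq.
have mba : multiple_edge m b a by rewrite multipleC.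
have mdc : multiple_edge m d c by rewrite multipleC.
have [ac|ac] := eqVneq a c.
  subst c; apply: (@adjacent_type3 b a d) => //.
  by apply: contraNneq neq => ->.
have [ad|ad] := eqVneq a d.
  subst d; apply: (@adjacent_type3 b a c) => //.
  by apply: contraNneq neq => ->; rewrite setUC.
have [bc|bc] := eqVneq b c.
  subst c; apply: (@adjacent_type3 a b d) => //.
have [bd|bd] := eqVneq b d.
  by subst d; apply: (@adjacent_type3 a b c).
by case: (@multiple_edges_meet a b c d).
Qed.

End Numbers.
End Graph.

(** * Necessity of the condition *)
Section Necessity.
Variables (S : finType) (m : S -> S -> option nat).
Hypotheses (m_cox : coxeter_matrix m) (m_odd : odd_angled m).
Local Open Scope group_scope.

Lemma necessity (H : set (coxeter_group m)) : finite_index_reflection_subgroup H ->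
  exists C : {set S}, is_component m C /\ (component_type2 m C \/ component_type3 m C).
Proof.
move=> [[HT [T [Trefl HE]]] [n Hn]].
have sH : is_subgroup H by rewrite HE; apply: gensub_subgroup.
have [c [c_surj c_eq]] := coset_number sH Hn.
rewrite HE in c_eq HT; pose sg := coset_step c_surj.
have ob : obeys m predT sg := coset_step_obeys c_surj c_eq.
have nd := no_double_edge m_cox m_odd (c_surj := c_surj) Trefl c_eq.
have cl := closed_lift m_cox m_odd (c_surj := c_surj) Trefl c_eq.
have [s [x nx]] : exists s x, sg s x <> x.
  apply: contrapT => no; apply: HT; apply/seteqP; split=> // w _.
  have fix_ s x : sg s x = x by apply: contrapT => h; apply: no; exists s, x.
  have : c 1 = c w.
    elim/(gen_ind m_cox): w => // s w ->.
    by rewrite -[LHS](fix_ s) /sg (coset_step_c c_surj c_eq).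
  by move/c_eq; rewrite invg1 mul1g.
pose C := [set t | connect (joined m) s t]%SET.
have fixC t : t \in C -> #|fixpoints sg t| = #|fixpoints sg s|.
  rewrite inE => /connectP[p + ->]; elim: p (s) => //= y p IH u /andP[uy yp].
  by rewrite (IH y yp); have /(joinedP m_cox m_odd)[uy' [k mk _]] := uy;
    rewrite (card_fix m_cox m_odd ob uy' mk).
have eE : #|{: 'I_n}| = (#|fixpoints sg s| + #|Edges sg [set s]%SET|.*2)%N.
  have := card_Edges (phi := #|fixpoints sg s|) m_cox ob (B := [set s]%SET) _.
  rewrite cards1 mul1n => <-; first by rewrite subnKC ?max_card.
  by move=> t; rewrite inE => /eqP ->.
have e_gt0 : (0 < #|Edges sg [set s]%SET|)%N.
  rewrite lt0n; apply/eqP => e0; move: eE; rewrite e0 addn0 => eE; apply: nx.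
  have FT : fixpoints sg s = [set: 'I_n]%SET by apply/eqP; rewrite eqEcard subsetT cardsT eE leqnn.
  by apply/fixpointsP; rewrite FT inE.
exists C; split; first by exists s.
have jsym : connect_sym (joined m) by apply: sym_connect_sym => u v; apply: joinedC.
apply: (component_types m_cox m_odd ob nd cl fixC eE e_gt0).
- by move=> u v; rewrite !inE => su sv; rewrite jsym in su; apply: connect_trans su sv.
- by move=> u v; rewrite !inE => su uv; apply: connect_trans su (connect1 uv).
Qed.
End Necessity.

(** * Subgroups built from finite sets of chambers *)
Section Sufficiency.
Variables (S : finType) (m : S -> S -> option nat).
Hypotheses (m_cox : coxeter_matrix m) (m_odd : odd_angled m).
Notation W := (coxeter_group m).
Notation gen := (coxeter_gen m).
Local Open Scope group_scope.

Section Tiling.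
Variables (X : finType) (sg : S -> X -> X) (x0 : X) (g : X -> W).
Hypotheses (sg_ob : obeys m predT sg) (g0 : g x0 = 1)
  (g_tree : forall s x, sg s x = x \/ gen s * g x = g (sg s x)).

Definition stab_reflections : set W := fun r => @reflection S m r /\ act sg r x0 = x0.

Lemma g_act (w : W) : act sg (g (act sg w x0)) x0 = act sg w x0.
Proof.
elim/(gen_ind m_cox): w => [|s w IH]; first by rewrite (act1 m_cox sg_ob) g0 (act1 m_cox sg_ob).
rewrite (actM m_cox sg_ob) (act_gen m_cox sg_ob).
by case: (g_tree s (act sg w x0)) => [-> //|<-]; rewrite (actM m_cox sg_ob) IH (act_gen m_cox
  sg_ob).
Qed.

(** Schreier's argument: the generators [(g (s y))^-1 s (g y)] of the stabiliser
    are trivial when [s] moves [y] and reflections when it does not. *)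
Lemma g_coset (w : W) : generated_subgroup stab_reflections ((g (act sg w x0))^-1 * w).
Proof.
have [H1 HM HV] := gensub_subgroup stab_reflections.
elim/(gen_ind m_cox): w => [|s w IH].
  by rewrite (act1 m_cox sg_ob) g0 invg1 mulg1.
rewrite (actM m_cox sg_ob) (act_gen m_cox sg_ob).
set y := act sg w x0 in IH *.
have -> : (g (sg s y))^-1 * (gen s * w) = (g (sg s y))^-1 * gen s * g y * ((g y)^-1 * w).
  by rewrite -!mulgA mulVKg.
apply: HM => //; case: (g_tree s y) => [fy|<-]; last first.
  by rewrite invgM genV // -!mulgA genK // mulVg.
rewrite fy; apply: gensub_sub; split.
  by exists (g y), s; rewrite conjgE mulgA.
have gy : act sg (g y) x0 = y := g_act w.
by rewrite !(actM m_cox sg_ob) (act_gen m_cox sg_ob) gy fy -[X in act _ _ X]gy (actVK m_cox sg_ob).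
Qed.

Lemma stab_generated (w : W) : generated_subgroup stab_reflections w <-> act sg w x0 = x0.
Proof.
split=> [|fw]; last by have := g_coset w; rewrite fw g0 invg1 mul1g.
apply: (gensub_min (A := fun w : W => act sg w x0 = x0)); last by move=> r [].
split=> [|x y fx fy|x fx]; first exact: (act1 m_cox sg_ob).
  by rewrite (actM m_cox sg_ob) fy.
by rewrite -{1}fx (actVK m_cox sg_ob).
Qed.

(** The stabiliser of [x0] is generated by reflections, and [g] represents all
    of its cosets. *)
Lemma tiling_subgroup : (exists s, sg s x0 <> x0) ->
  exists H : set W, finite_index_reflection_subgroup H.
Proof.
move=> [s sx0]; exists (generated_subgroup stab_reflections); split; first split.
- move=> HT; apply: sx0; rewrite -(act_gen m_cox sg_ob); apply/stab_generated.
  by rewrite HT.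
- by exists stab_reflections; split=> // r [].
suff /finite_setP : finite_set (left_cosets (generated_subgroup stab_reflections)) by [].
apply: (@sub_finite_set _ _ ((fun x : X => left_coset (generated_subgroup stab_reflections) (g x))
  @` [set: X])).
  move=> _ [w _ <-]; exists (act sg w x0) => //.
  apply/left_coset_eq; first exact: gensub_subgroup.
  exact: g_coset.
by apply: finite_image; apply: finite_finset.
Qed.
End Tiling.

Lemma iter_dvd (T : Type) (f : T -> T) d k x : d %| k -> iter d f x = x -> iter k f x = x.
Proof.
by case/dvdnP => j -> fd; elim: j => // j IH; rewrite mulSn iterD IH.
Qed.

(** A set [Y] of chambers for the letters of [D] is coloured black and white, in
    such a way that moves change the colour and that black chambers are moved by
    every letter of [D].  Each black chamber [y] receives a leaf [(y, Some u)]
    across every letter [u] of the component outside [D].  For a letter [s] of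
    [D] and [u] outside, the orbit through a black [y] is then the path formed by
    [(y, Some u)], [y] and [s y], for the latter is white and has no leaf; for two
    letters outside it is a path with two leaves around [y].  These orbits have
    one or three points, as required by an edge labelled 3. *)
Section Leaves.
Variables (C D : {set S}) (Y : finType) (base_step : S -> Y ->
  Y) (black : pred Y) (y0 : Y) (g : Y -> W).
Hypotheses (DC : D \subset C)
  (C_closed : forall s t, s \in C -> joined m s t -> t \in C)
  (C_simple : forall s t, s \in C -> t \in C -> joined m s t -> ~~ ((s \in D) && (t \in D)) ->
    simple_edge m s t)
  (base_step_ob : obeys m (mem D) base_step)
  (black_moves : forall s y, s \in D -> black y -> base_step s y != y)
  (black_flip : forall s y, s \in D -> base_step s y != y -> black (base_step s y) = ~~ black y)
  (g0 : g y0 = 1) (g_tree : forall s y, s \in D -> base_step s y = y \/ gen s * g y = g (base_step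
    s y))
  (y0_moves : exists2 s, s \in D & base_step s y0 <> y0).

Definition leafy s (x : Y * option S) : Y * option S :=
  if s \in D then (if x.2 is None then (base_step s x.1, None) else x)
  else if (s \in C) && black x.1 then
    match x.2 with
    | None => (x.1, Some s)
    | Some u => if u == s then (x.1, None) else x
    end
  else x.

Lemma leafy_node s y : s \in D -> leafy s (y, None) = (base_step s y, None).
Proof. by rewrite /leafy => ->. Qed.

Lemma leafy_other s y u : s \in D -> leafy s (y, Some u) = (y, Some u).
Proof. by rewrite /leafy => ->. Qed.

Section Letter.
Variable t : S.
Hypotheses (tC : t \in C) (tD : t \notin D).

Lemma leafy_white y o : ~~ black y -> leafy t (y, o) = (y, o).
Proof. by rewrite /leafy (negPf tD) tC /= => /negPf ->. Qed.

Lemma leafy_out y : black y -> leafy t (y, None) = (y, Some t).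
Proof. by rewrite /leafy (negPf tD) tC /= => ->. Qed.

Lemma leafy_back y : black y -> leafy t (y, Some t) = (y, None).
Proof. by rewrite /leafy (negPf tD) tC /= => ->; rewrite eqxx. Qed.

Lemma leafy_away y u : u != t -> leafy t (y, Some u) = (y, Some u).
Proof. by rewrite /leafy (negPf tD) tC /= => /negPf ->; case: ifP. Qed.
End Letter.

Lemma leafyK s : involutive (leafy s).
Proof.
move=> [y o]; have [sD|sD] := boolP (s \in D).
  by case: o => [u|]; rewrite ?leafy_other // !leafy_node // (obeys_inv m_cox _ base_step_ob).
have [sC|sC] := boolP (s \in C); last by rewrite /leafy (negPf sD) (negPf sC).
have [by_|wy] := boolP (black y); last by rewrite !leafy_white.
case: o => [u|]; last by rewrite leafy_out // leafy_back.
have [->|us] := eqVneq u s; last by rewrite !leafy_away.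
by rewrite leafy_back // leafy_out.
Qed.

Lemma leafy_base s t x : s \in D -> t \in C -> t \notin D -> iter 3 (rotation leafy s t) x = x.
Proof.
move=> sD tC tD; have sK y : base_step s (base_step s y) = y := obeys_inv m_cox y base_step_ob sD.
have bf y : black y -> ~~ black (base_step s y).
  by move=> by_; rewrite black_flip ?by_ // black_moves.
case: x => y [u|]; rewrite /= /rotation; have [by_|wy] := boolP (black y).
- have [->|ut] := eqVneq u t; last by do 3 rewrite leafy_away // leafy_other //.
  by rewrite leafy_back // leafy_node // leafy_white ?bf // leafy_node // sK leafy_out //
    leafy_other.
- by do 3 rewrite leafy_white // leafy_other //.
- by rewrite leafy_out // leafy_other // leafy_back // leafy_node // leafy_white ?bf // leafy_node
  // sK.
have [e|ne] := eqVneq (base_step s y) y; first by do 3 rewrite leafy_white // leafy_node // e.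
have bs : black (base_step s y) by rewrite black_flip.
by rewrite leafy_white // leafy_node // leafy_out // leafy_other // leafy_back // leafy_node // sK.
Qed.

Lemma leafy_leaf s t x : s \in C -> s \notin D -> t \in C -> t \notin D -> s != t ->
  iter 3 (rotation leafy s t) x = x.
Proof.
move=> sC sD tC tD st; have ts : t != s by rewrite eq_sym.
case: x => y o; have [by_|wy] := boolP (black y); last by rewrite /= /rotation;
  do 6 rewrite leafy_white //.
have oK o' : o' = Some t \/ o' = Some s \/ o' = None -> iter 3 (rotation leafy s t) (y, o') = (y,
  o').
  case=> [->|[->|->]]; rewrite /= /rotation.
  - by rewrite leafy_back // leafy_out // leafy_away // leafy_back // leafy_out // leafy_away.
  - by rewrite (leafy_away tC tD) // leafy_back // leafy_out // leafy_away // leafy_back //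
    leafy_out.
  by rewrite leafy_out // leafy_away // leafy_back // leafy_out // leafy_away // leafy_back.
case: o => [u|]; last by apply: oK; right; right.
have [->|ut] := eqVneq u t; first by apply: oK; left.
have [->|us] := eqVneq u s; first by apply: oK; right; left.
by rewrite /= /rotation; do 6 rewrite leafy_away //.
Qed.

Lemma leafy_obeys : obeys m predT leafy.
Proof.
have three s t k : s != t -> m s t = Some k -> simple_edge m s t -> 3 %| k.
  move=> st mk; rewrite /simple_edge /= /cox_div (negPf st) mk /= least_divisorE.
    by move/eqP => [<-]; apply: pdiv_dvd.
  by have [_ /ltnW] := label_odd3 m_cox m_odd st mk.
have swap s t k x : (forall y, iter k (rotation leafy t s) y = y) ->
  iter k (rotation leafy s t) x = x.
  by move=> h; rewrite -{1}[x]h; apply: rotation_iterK; apply: leafyK.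
move=> s t k x _ _ mk.
have [est|st] := eqVneq s t.
  by subst t; move: mk; rewrite (m_diag m_cox) => -[<-]; apply: leafyK.
have jst : joined m s t by rewrite /joined /= /cox_div (negPf st) mk.
have jts : joined m t s by rewrite joinedC.
have [sC|sC] := boolP (s \in C); last first.
  have tC : t \notin C by apply: contra sC => tC; apply: C_closed jts.
  have triv u y : u \notin C -> leafy u y = y.
    move=> uC; rewrite /leafy (negPf uC); case: ifP => // uD.
    by rewrite (subsetP DC) in uC.
  by elim: k {mk} => // k IH; rewrite iterS IH /rotation !triv.
have tC : t \in C by apply: C_closed jst.
have simp := C_simple sC tC jst.
have [sD|sD] := boolP (s \in D); have [tD|tD] := boolP (t \in D).
- have E j y o : iter j (rotation leafy s t) (y, o) =
      if o is None then (iter j (rotation base_step s t) y, None) else (y, o).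
    elim: j => [|j IH]; first by case: o.
    by rewrite iterS IH; case: o {IH} => [u|]; rewrite /rotation /leafy sD tD.
  by case: x => y [u|]; rewrite E // base_step_ob.
- apply: (@iter_dvd _ _ 3); last exact: leafy_base.
  by apply: three mk _ => //; apply: simp; rewrite (negPf tD) andbF.
- apply: swap => y; apply: (@iter_dvd _ _ 3); last exact: leafy_base.
  by apply: three mk _ => //; apply: simp; rewrite (negPf sD).
apply: (@iter_dvd _ _ 3); last exact: leafy_leaf.
by apply: three mk _ => //; apply: simp; rewrite (negPf sD).
Qed.

Lemma attach_leaves : exists H : set W, finite_index_reflection_subgroup H.
Proof.
pose gl (x : Y * option S) := if x.2 is Some u then gen u * g x.1 else g x.1.
apply: (@tiling_subgroup _ leafy (y0, None) gl leafy_obeys) => //.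
  move=> s [y o]; rewrite /leafy /gl /=; case: ifP => sD.
    case: o => [u|] /=; first by left.
    by case: (g_tree y sD) => [->|->]; [left|right].
  case: ifP => _ /=; last by left.
  case: o => [u|] /=; last by right.
  by case: (eqVneq u s) => [->|_] /=; [right; rewrite genK|left].
have [s sD sy] := y0_moves; exists s; rewrite /leafy sD /= => -[].
exact: sy.
Qed.

End Leaves.
End Sufficiency.

(** * Chambers for the admissible components *)
Section Constructions.
Variables (S : finType) (m : S -> S -> option nat).
Hypotheses (m_cox : coxeter_matrix m) (m_odd : odd_angled m).
Notation W := (coxeter_group m).
Notation gen := (coxeter_gen m).
Local Open Scope group_scope.
Variable C : {set S}.
Hypothesis C_closed : forall s t, s \in C -> joined m s t -> t \in C.

(** A component with a single vertex: two chambers exchanged by [s]. *)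
Lemma single_subgroup s : s \in C -> (forall u v, u \in C -> v \in C -> ~~ joined m u v) ->
  exists H : set W, finite_index_reflection_subgroup H.
Proof.
move=> sC nj; pose g (y : bool) : W := if y then gen s else 1.
apply: (@attach_leaves S m m_cox m_odd C [set s] bool (fun _ => negb) id false g) => //.
- by rewrite sub1set.
- by move=> u v uC vC; rewrite (negPf (nj u v uC vC)).
- by move=> u v k y /set1P-> /set1P->; rewrite (m_diag m_cox) => -[<-] /=; rewrite /rotation negbK.
- by move=> u [].
- by move=> u y /set1P->; right; case: y; rewrite /g /= ?mulg1 // gen2.
by exists s; rewrite ?inE.
Qed.

Section Path.
Variables (s t : S) (K k : nat).
Hypotheses (sC : s \in C) (tC : t \in C) (st : s != t) (mk : m s t = Some k)
  (K_odd : odd K) (K3 : 2 < K) (Kk : K %| k)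
  (C_simple : forall u v, u \in C -> v \in C -> joined m u v ->
     ~~ ((u \in [set s; t]) && (v \in [set s; t])) -> simple_edge m u v).

(** In the dihedral group of odd order [K] acting on residues modulo [K], [s] is
    [i |-> - i] and [t] is [i |-> 1 - i]; the orbit is a path, with [0] fixed by
    [s]. The residues [1, .., K./2] are the black ones. *)
Definition fold_s i := if i == 0%N then 0%N else (K - i)%N.
Definition fold_t i := if i == 0%N then 1%N else if i == 1%N then 0%N else (K.+1 - i)%N.
Definition path_step (u : S) (i : 'I_K) : 'I_K := insubd i (if u == s then fold_s i else fold_t i).
Definition path_black (i : 'I_K) : bool := (0 < i) && (i <= K./2).
Definition path_word (i : 'I_K) : W :=
  if path_black i then gen t * (gen s * gen t) ^+ i.-1
  else if i == 0%N :> nat then 1 else (gen s * gen t) ^+ (K - i).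

Lemma fold_s_lt i : i < K -> fold_s i < K.
Proof. by move: K3; rewrite /fold_s; clear; case: i => [|n] /=; lia. Qed.

Lemma fold_t_lt i : i < K -> fold_t i < K.
Proof. by move: K3; rewrite /fold_t; clear; case: i => [|[|n]] /=; lia. Qed.

Lemma step_s i : path_step s i = fold_s i :> nat.
Proof. by rewrite /path_step eqxx val_insubd fold_s_lt. Qed.

Lemma step_t i : path_step t i = fold_t i :> nat.
Proof. by rewrite /path_step eq_sym (negPf st) val_insubd fold_t_lt. Qed.

Lemma step_sK : involutive (path_step s).
Proof.
move=> i; apply: val_inj; rewrite /= !step_s /fold_s.
by have := ltn_ord i; move: K3; clear; case: (i : nat) => [|n] //=; case: ifP; lia.
Qed.

Lemma step_tK : involutive (path_step t).
Proof.
move=> i; apply: val_inj; rewrite /= !step_t /fold_t.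
by have := ltn_ord i; move: K3; clear; case: (i : nat) => [|[|n]] //=; do 2?case: ifP; lia.
Qed.

Lemma path_rot i : rotation path_step s t i = (if i == 0%N :> nat then K.-1 else i.-1) :> nat.
Proof.
rewrite /rotation step_s step_t /fold_s /fold_t.
by have := ltn_ord i; move: K3; clear; case: (i : nat) => [|[|n]] //=; do 2?case: ifP; lia.
Qed.

Lemma path_rotK i : iter K (rotation path_step s t) i = i.
Proof.
have down j (x : 'I_K) : j <= x -> iter j (rotation path_step s t) x = x - j :> nat.
  elim: j => [|j IH] jx; first by rewrite subn0.
  rewrite iterS path_rot IH; last exact: ltnW.
  by move: jx; clear; case: ifP; lia.
have eK : K = (K.-1 - i + (1 + i))%N by have := ltn_ord i; move: K3; clear; lia.
rewrite [X in iter X _ _]eK iterD; set x := iter (1 + i) _ _.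
have xE : x = K.-1 :> nat by rewrite /x iterD /= path_rot down // subnn eqxx.
apply: val_inj; rewrite /= down xE; last exact: leq_subr.
by have := ltn_ord i; clear; lia.
Qed.

Lemma path_obeys : obeys m (mem [set s; t]) path_step.
Proof.
move=> u v j x /set2P uE /set2P vE mj.
have [euv|uv] := eqVneq u v.
  subst v; move: mj; rewrite (m_diag m_cox) => -[<-] /=.
  by case: uE => ->; [apply: step_sK|apply: step_tK].
have {}mj : j = k.
  by move: mj uv; case: uE => ->; case: vE => ->; rewrite ?eqxx // ?(m_sym m_cox t) mk => -[].
subst j; case: uE vE uv => -> [->|->]; rewrite ?eqxx // => _; apply: (iter_dvd Kk).
  exact: path_rotK.
by rewrite -{1}(path_rotK x); apply: rotation_iterK; [apply: step_tK|apply: step_sK].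
Qed.

Let K2 : K = (K./2).*2.+1. Proof. by rewrite -[LHS]odd_double_half K_odd. Qed.

Lemma path_black_moves u y : u \in [set s; t] -> path_black y -> path_step u y != y.
Proof.
move=> /set2P uE; rewrite -(inj_eq val_inj) /= /path_black.
case: uE => ->; rewrite ?step_s ?step_t /fold_s /fold_t;
  have := ltn_ord y; move: (y : nat) K2 K3; clear => i;
  move: (K./2) => h -> ; case: i => [|[|i]] /=; lia.
Qed.

Lemma path_black_flip u y : u \in [set s; t] -> path_step u y != y ->
  path_black (path_step u y) = ~~ path_black y.
Proof.
move=> /set2P uE; rewrite -(inj_eq val_inj) /= /path_black.
case: uE => ->; rewrite ?step_s ?step_t /fold_s /fold_t;
  have := ltn_ord y; move: (y : nat) K2 K3; clear => i;
  move: (K./2) => h -> ; case: i => [|[|i]] /=; lia.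
Qed.

Lemma path_tree u y : u \in [set s; t] ->
  path_step u y = y \/ gen u * path_word y = path_word (path_step u y).
Proof.
move=> uE; have := path_black_flip uE (y := y).
have [e|ne] := eqVneq (path_step u y) y; first by left.
move=> /(_ isT) flip; right; rewrite /path_word flip.
have h1 : 0 < K./2 by move: K2 K3; clear; case: (K./2) => // ->.
move: ne {flip}; rewrite -(inj_eq val_inj) /=; have := ltn_ord y.
case/set2P: uE => ->; rewrite ?step_s ?step_t /fold_s /fold_t;
  case by_ : (path_black y) => /= lt; move: by_; rewrite /path_black;
    case: (y : nat) lt => [|i] lt //=.
- move=> _ _; have -> : (K - i.+1 == 0)%N = false by move: lt; clear; lia.
  by rewrite subKn ?(ltnW lt) // expgS !mulgA.
- move=> _ _; have -> : (K - i.+1 = (K - i.+1).-1.+1)%N by move: lt; clear; lia.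
  by rewrite expgS /= -!mulgA genK.
- case: i lt => [|i] lt _ _ /=; first by rewrite expg0 mulg1 gen2.
  have -> : (K.+1 - i.+2 == 0)%N = false by move: lt; clear; lia.
  have -> : (K - (K.+1 - i.+2) = i.+1)%N by move: lt; clear; lia.
  by rewrite genK.
case: i lt => [|i] lt /=; first by rewrite h1.
move=> _ _; congr (_ * _ ^+ _); move: lt; clear; lia.
Qed.

Lemma path_subgroup : exists H : set W, finite_index_reflection_subgroup H.
Proof.
have K0 : 0 < K by apply: ltn_trans K3.
apply: (@attach_leaves S m m_cox m_odd C [set s; t] 'I_K path_step path_black (Ordinal K0)
  path_word) => //.
- by apply/subsetP => u /set2P[] ->.
- exact: path_obeys.
- exact: path_black_moves.
- exact: path_black_flip.
- by move=> u y; apply: path_tree.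
exists t; first by rewrite !inE eqxx orbT.
by move=> /(congr1 val); rewrite /= step_t.
Qed.

End Path.

Section Wheel.
Variables (a b c : S) (M k1 k2 : nat).
Hypotheses (aC : a \in C) (bC : b \in C) (cC : c \in C) (ab : a != b) (bc : b != c) (ac : a != c)
  (mab : m a b = Some k1) (mbc : m b c = Some k2) (mac : m a c = Some M)
  (k1_5 : 5 %| k1) (k2_5 : 5 %| k2) (M3 : 3 %| M) (M_gt0 : 0 < M)
  (C_simple : forall u v, u \in C -> v \in C -> joined m u v ->
     ~~ ((u \in [set a; b; c]) && (v \in [set a; b; c])) -> simple_edge m u v).

(** The cycle of <a,c> has [2 M] chambers [(i, e, None)]. Each has a neighbour
    [(i, e, Some None)] across [b]; for [e = false] the latter has two more
    neighbours [(i, false, Some (Some v))], across [a] if [v = true] and across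
    [c] otherwise. These outer chambers close all the orbits of <a,b> and <b,c>
    to paths of five vertices or one, and those of <a,c> outside the cycle to paths of
    three or one. *)
Definition wheel : finType := ('I_M * bool * option (option bool))%type.

Definition across_a (y : wheel) : wheel :=
  match y with
  | (i, e, None) => (i, ~~ e, None)
  | (i, false, Some None) => (i, false, Some (Some true))
  | (i, false, Some (Some true)) => (i, false, Some None)
  | _ => y
  end.

Definition across_b (y : wheel) : wheel :=
  match y with
  | (i, e, None) => (i, e, Some None)
  | (i, e, Some None) => (i, e, None)
  | _ => y
  end.

Definition across_c (y : wheel) : wheel :=
  match y with
  | (i, false, None) => (ordS i, true, None)
  | (i, true, None) => (ord_pred i, false, None)
  | (i, false, Some None) => (i, false, Some (Some false))
  | (i, false, Some (Some false)) => (i, false, Some None)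
  | _ => y
  end.

Definition wheel_step (u : S) : wheel -> wheel :=
  if u == a then across_a else if u == b then across_b else across_c.

Definition wheel_black (y : wheel) : bool :=
  match y.2 with None => y.1.2 | Some None => ~~ y.1.2 | _ => false end.

(** The word of the cycle is [(ac)^i], with an additional [a] if [e] holds; it
    is consistent around the cycle as [(ac)^M = 1]. *)
Definition wheel_word (y : wheel) : W :=
  let q := (if y.1.2 then gen a else 1) * (gen a * gen c) ^+ y.1.1 in
  match y.2 with
  | None => q
  | Some None => gen b * q
  | Some (Some v) => (if v then gen a else gen c) * (gen b * q)
  end.

Let ba : (b == a) = false. Proof. by rewrite eq_sym (negPf ab). Qed.
Let cb : (c == b) = false. Proof. by rewrite eq_sym (negPf bc). Qed.
Let ca : (c == a) = false. Proof. by rewrite eq_sym (negPf ac). Qed.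
Let D : {set S} := [set a; b; c].

Lemma inD u : u \in D -> [\/ u = a, u = b | u = c].
Proof. by rewrite /D !inE -orbA => /or3P[] /eqP; [constructor 1|constructor 2|constructor 3]. Qed.

Let step_a : wheel_step a = across_a. Proof. by rewrite /wheel_step eqxx. Qed.
Let step_b : wheel_step b = across_b. Proof. by rewrite /wheel_step ba eqxx. Qed.
Let step_c : wheel_step c = across_c. Proof. by rewrite /wheel_step ca cb. Qed.

Lemma wheel_stepK u : u \in D -> involutive (wheel_step u).
Proof.
by case/inD=> ->; rewrite ?step_a ?step_b ?step_c => -[[i [|]] [[[]|]|]] //=;
  rewrite ?ordSK ?ord_predK.
Qed.

Lemma wheel_ab y : iter 5 (rotation wheel_step a b) y = y.
Proof. by rewrite /= /rotation step_a step_b; case: y => -[i [|]] [[[]|]|]. Qed.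

Lemma wheel_bc y : iter 5 (rotation wheel_step b c) y = y.
Proof.
by rewrite /= /rotation step_b step_c; case: y => -[i [|]] [[[]|]|] //=; rewrite ?ordSK ?ord_predK.
Qed.

Lemma iter_ordS j (i : 'I_M) : iter j (@ordS M) i = (i + j) %% M :> nat.
Proof.
elim: j => [|j IH]; first by rewrite addn0 modn_small.
by rewrite iterS /= IH -addn1 modnDml addn1 addnS.
Qed.

Lemma wheel_ac y : iter M (rotation wheel_step a c) y = y.
Proof.
have SK : iter M (@ordS M) =1 id.
  by move=> i; apply: val_inj; rewrite /= iter_ordS modnDr modn_small.
have PK : iter M (@ord_pred M) =1 id.
  have can n (i : 'I_M) : iter n (@ordS M) (iter n (@ord_pred M) i) = i.
    by elim: n i => // n IH i; rewrite iterSr iterS ord_predK IH.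
  by move=> i; rewrite -[LHS]SK can.
case: y => -[i e] [o|].
  by apply: (iter_dvd M3); rewrite /= /rotation step_a step_c; case: e; case: o => [[]|].
case: e.
  have E j : iter j (rotation wheel_step a c) (i, true, None) = (iter j (@ord_pred M) i, true,
    None).
    by elim: j => // j IH; rewrite iterS IH /rotation step_a step_c.
  by rewrite E PK.
have E j : iter j (rotation wheel_step a c) (i, false, None) = (iter j (@ordS M) i, false, None).
  by elim: j => // j IH; rewrite iterS IH /rotation step_a step_c.
by rewrite E SK.
Qed.

Lemma wheel_obeys : obeys m (mem D) wheel_step.
Proof.
move=> u v k y uD vD mk.
have [euv|uv] := eqVneq u v.
  by subst v; move: mk; rewrite (m_diag m_cox) => -[<-]; apply: wheel_stepK.
have swap s t n z : s \in D -> t \in D -> iter n (rotation wheel_step t s) z = z ->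
    iter n (rotation wheel_step s t) z = z.
  by move=> sD tD h; rewrite -{1}h; apply: rotation_iterK; apply: wheel_stepK.
have aD : a \in D by rewrite !inE eqxx.
have bD : b \in D by rewrite !inE eqxx orbT.
have cD : c \in D by rewrite !inE eqxx orbT.
have AB : iter k1 (rotation wheel_step a b) y = y by apply: iter_dvd k1_5 (wheel_ab y).
have BC : iter k2 (rotation wheel_step b c) y = y by apply: iter_dvd k2_5 (wheel_bc y).
case/inD: uD uv mk => ->; case/inD: vD => ->; rewrite ?eqxx // => _.
- by rewrite mab => -[<-].
- by rewrite mac => -[<-]; apply: wheel_ac.
- by rewrite (m_sym m_cox) mab => -[<-]; apply: swap.
- by rewrite mbc => -[<-].
- by rewrite (m_sym m_cox) mac => -[<-]; apply: swap => //; apply: wheel_ac.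
by rewrite (m_sym m_cox) mbc => -[<-]; apply: swap.
Qed.

Lemma wheel_black_moves u y : u \in D -> wheel_black y -> wheel_step u y != y.
Proof.
by case/inD=> ->; rewrite ?step_a ?step_b ?step_c; case: y => -[i [|]] [[[]|]|] //= _;
  apply/eqP => -[].
Qed.

Lemma wheel_black_flip u y : u \in D -> wheel_step u y != y ->
  wheel_black (wheel_step u y) = ~~ wheel_black y.
Proof.
by case/inD=> ->; rewrite ?step_a ?step_b ?step_c; case: y => -[i [|]] [[[]|]|] //=; rewrite ?eqxx.
Qed.

Lemma wheel_tree u y : u \in D ->
  wheel_step u y = y \/ gen u * wheel_word y = wheel_word (wheel_step u y).
Proof.
have qS (i : 'I_M) : (gen a * gen c) ^+ ordS i = gen a * gen c * (gen a * gen c) ^+ i.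
  rewrite -expgS /=; have [lt|ge] := ltnP i.+1 M; first by rewrite modn_small.
  have -> : i.+1 = M by apply/eqP; rewrite eqn_leq ge ltn_ord.
  by rewrite modnn (genM mac).
case/inD=> ->; rewrite ?step_a ?step_b ?step_c; case: y => -[i [|]] [[[]|]|] /=;
  rewrite /wheel_word /= ?mul1g; try by [left]; right; rewrite ?genK //.
- by rewrite -{1}(ord_predK i) qS -!mulgA genK // genK.
by rewrite qS -!mulgA genK.
Qed.

Lemma wheel_subgroup : exists H : set W, finite_index_reflection_subgroup H.
Proof.
apply: (@attach_leaves S m m_cox m_odd C D wheel wheel_step wheel_black
  ((Ordinal M_gt0, false), None) wheel_word) => //.
- by apply/subsetP => u /inD[] ->.
- exact: wheel_obeys.
- exact: wheel_black_moves.
- exact: wheel_black_flip.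
- by rewrite /wheel_word /= mul1g.
- by move=> u y; apply: wheel_tree.
by exists b; [rewrite !inE eqxx orbT|rewrite step_b].
Qed.
End Wheel.

(** The path is built on the multiple edge if there is one, otherwise on an
    arbitrary edge. *)
Lemma type2_subgroup s0 : s0 \in C -> component_type2 m C ->
  exists H : set W, finite_index_reflection_subgroup H.
Proof.
move=> s0C le1.
have path s t : s \in C -> t \in C -> joined m s t ->
    (forall u v, u \in C -> v \in C -> joined m u v ->
     ~~ ((u \in [set s; t]) && (v \in [set s; t])) -> simple_edge m u v) ->
    exists H : set W, finite_index_reflection_subgroup H.
  move=> sC tC /(joinedP m_cox m_odd)[st [k mk ck]] simp.
  have [_ pk_odd pk3 _] := label_bound m_cox m_odd st mk ck.
  exact: (path_subgroup sC tC st mk pk_odd pk3 (pdiv_dvd k) simp).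
have [/existsP[s /existsP[t /and3P[sC tC mst]]]|nomult] :=
    boolP [exists s, exists t, [&& s \in C, t \in C & multiple_edge m s t]].
  apply: (path s t) => //; first exact: multiple_joined.
  move=> u v uC vC juv; apply: contraNT => nuv.
  have muv : multiple_edge m u v by case: (joined_cases juv) => // h; rewrite h in nuv.
  have E : [set u; v] = [set s; t].
    have in_edges x y : x \in C -> y \in C -> multiple_edge m x y ->
        [set x; y] \in multiple_edges m C.
      by move=> xC yC xy; apply/imsetP; exists (x, y); rewrite // inE xC yC xy.
    by have /card_le1_eqP := le1; apply; apply: in_edges.
  by rewrite -E !inE !eqxx orbT.
have [/existsP[s /existsP[t /and3P[sC tC mst]]]|nojoin] :=
    boolP [exists s, exists t, [&& s \in C, t \in C & joined m s t]].
  apply: (path s t) => // u v uC vC juv _.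
  case: (joined_cases juv) => // muv; case/negP: nomult.
  by apply/existsP; exists u; apply/existsP; exists v; rewrite uC vC muv.
apply: (single_subgroup s0C) => u v uC vC; apply: contra nojoin => juv.
by apply/existsP; exists u; apply/existsP; exists v; rewrite uC vC juv.
Qed.

Lemma type1_type2 : component_type1 C -> component_type2 m C.
Proof.
move=> C2; have {}C2 : #|C| <= 2 by case: C2 => ->.
rewrite /component_type2 -(cards1 C); apply: subset_leq_card; apply/subsetP => E.
case/imsetP => -[s t]; rewrite !inE /= => /and3P[sC tC mst] ->.
have st := joined_neq m_cox m_odd (multiple_joined mst).
rewrite eqEcard cards2 st C2 andbT; apply/subsetP => u; rewrite !inE.
by case/orP => /eqP ->.
Qed.

Lemma type3_subgroup : component_type3 m C -> exists H : set W, finite_index_reflection_subgroup H.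
Proof.
move=> [D [DC D3 [a [b [c [DE ab5 bc5 ac3]]]] simp]].
have jE s t n : cox_div m s t = Some n -> exists k, [/\ s != t, m s t = Some k, 0 < k & n %| k].
  move=> st; have : joined m s t by rewrite /joined /= st.
  case/(joinedP m_cox m_odd) => neq [k mk]; rewrite st => -[->]; exists k; split=> //.
    by have [_ /ltnW /ltnW] := label_odd3 m_cox m_odd neq mk.
  exact: pdiv_dvd.
have [k1 [ab mab _ k15]] := jE _ _ _ ab5.
have [k2 [bc mbc _ k25]] := jE _ _ _ bc5.
have [k3 [ac mac k30 k33]] := jE _ _ _ ac3.
rewrite DE in DC simp.
have [aC bC cC] : [/\ a \in C, b \in C & c \in C].
  by split; apply: (subsetP DC); rewrite !inE eqxx ?orbT.
exact: (wheel_subgroup aC bC cC ab bc ac mab mbc mac k15 k25 k33 k30 simp).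
Qed.

End Constructions.

Theorem corollary6p5 (S : finType) (m : S -> S -> option nat)
    (S_neq0 : 0 < #|S|) (m_coxeter : coxeter_matrix m)
    (m_odd : odd_angled m) :
  (exists H : set (coxeter_group m), finite_index_reflection_subgroup H) <->
  (exists C : {set S}, is_component m C /\
     [\/ component_type1 C, component_type2 m C | component_type3 m C]).
Proof.
split=> [[H /(necessity m_coxeter m_odd)[C [compC typ]]]|[C [[s CE] typ]]].
  by exists C; split=> //; case: typ => h; [constructor 2|constructor 3].
have sC : s \in C by rewrite CE inE.
have C_closed u v : u \in C -> joined m u v -> v \in C.
  by rewrite CE !inE => su uv; apply: connect_trans su (connect1 uv).
case: typ => [/(type1_type2 m_coxeter m_odd) typ|typ|typ].
- exact: (type2_subgroup m_coxeter m_odd C_closed sC typ).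
- exact: (type2_subgroup m_coxeter m_odd C_closed sC typ).
exact: (type3_subgroup m_coxeter m_odd C_closed typ).
Qed.
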